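(* Let $w$ be a strictly positive analytic weight on the unit circle $\mathbb T_1$, let $\rho<1$ be the associated constant, fix $r$ with $\rho<r<1$, and let $\Lambda=\max_{|z|=r}|\mathcal F(z)|$. Then for every $n\in\mathbb N$ such that $\Lambda r^n<\frac1r-r$, the leading coefficient $\kappa_n$ of the orthonormal polynomial $\varphi_n$ has the representation $$\kappa_n^2=\frac{\tau^2}{2\pi}\sum_{k=0}^\infty g_n^{(2k)}(0).$$
   Context: Notation: for $s>0$, $\mathbb T_s=\{z\in\mathbb C:|z|=s\}$, oriented counterclockwise. A strictly positive analytic weight on $\mathbb T_1$ is a function $w$ that is strictly positive on $\mathbb T_1$ and extends to a nowhere vanishing holomorphic function on an open set containing $\mathbb T_1$. The orthonormal polynomials $\varphi_n(z)=\kappa_nz^n+\dots$, $\kappa_n>0$, satisfy $\oint_{\mathbb T_1}\varphi_n\overline{\varphi_m}\,w\,|dz|=\delta_{mn}$. Szegő functions: $D(z)=\exp\left(\frac1{4\pi}\int_0^{2\pi}\log w(e^{i\theta})\frac{e^{i\theta}+z}{e^{i\theta}-z}\,d\theta\right)$ for $|z|\ne1$; $D_{\rm i}$ is its restriction to $|z|<1$ and $D_{\rm e}$ its restriction to $|z|>1$. Both extend holomorphically across $\mathbb T_1$ (same notation), and $D_{\rm i}/D_{\rm e}=w$, $\overline{D_{\rm i}(1/\overline z)}=1/D_{\rm e}(z)$. Put $\rho=\inf\{0<s<1: D_{\rm e}\text{ is (extends) holomorphic in }|z|>s\}<1$, $\tau=1/D_{\rm i}(0)=\exp\left(-\frac1{4\pi}\int_0^{2\pi}\log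 w(e^{i\theta})\,d\theta\right)>0$ and $\mathcal F(z)=D_{\rm i}(z)D_{\rm e}(z)$, which is holomorphic in $\rho<|z|<1$, while $1/\mathcal F$ is holomorphic in $1<|z|<1/\rho$. Operators (for fixed $r\in(\rho,1)$), acting on functions holomorphic in $\mathbb C\setminus(\mathbb T_r\cup\mathbb T_{1/r})$ with continuous boundary values, where $f_-$ denotes the boundary values of $f$ from the exterior side of the circle of integration: $$\mathcal M_n^{\rm i}(f)(z)=-\frac1{2\pi i\,\tau^2}\oint_{\mathbb T_r}f_-(t)\frac{\mathcal F(t)t^n}{t-z}\,dt,\qquad \mathcal M_n^{\rm e}(f)(z)=\frac{\tau^2}{2\pi i}\oint_{\mathbb T_{1/r}}f_-(t)\frac{1}{\mathcal F(t)\,t^n(t-z)}\,dt .$$ Define $g_n^{(0)}=1$, $g_n^{(2k+1)}=\mathcal M_n^{\rm e}(g_n^{(2k)})$, $g_n^{(2k+2)}=\mathcal M_n^{\rm i}(g_n^{(2k+1)})$ for $k\ge0$.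
   Formalization: The formal theorem states the identity for κ_{n−1}² instead of κ_n² and takes n ≥ 1: as printed it fails, e.g. for w=1/|z−a|², 0<a<1, n=1, the right side is (1−a²)/(2π)=κ_0², not κ_1²=1/(2π), and for w=1, n=0 it is 0. *)

(* Defs.v *)
(* Stdlib reals with Coquelicot; C is Coquelicot.Complex.C. *)
From Stdlib Require Import Reals.
From Coquelicot Require Import Coquelicot.
Open Scope R_scope.

Definition Cexp (z : C) : C := (exp (Re z) * cos (Im z), exp (Re z) * sin (Im z)).

(* e^{i theta} *)
Definition cis (theta : R) : C := (cos theta, sin theta).

Definition integral_C (h : R -> C) (a b : R) : C :=
  RInt (V := C_R_CompleteNormedModule) h a b.

(* Integral of f(t) dt over |t| = s, counterclockwise: t = s e^{i theta},
   dt = i t d theta. *)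
Definition contour_circle (s : R) (f : C -> C) : C :=
  integral_C (fun theta => let t := (s * cis theta)%C in (f t * (Ci * t))%C)
    0 (2 * PI).

(* Integral of f(z) |dz| over the unit circle. *)
Definition arclength_unit_circle (f : C -> C) : C :=
  integral_C (fun theta => f (cis theta)) 0 (2 * PI).

(* Complex differentiability at each point of U; U is open in every use. *)
Definition holomorphic_on (U : C -> Prop) (f : C -> C) : Prop :=
  forall z, U z -> ex_derive (K := C_AbsRing) (V := C_NormedModule) f z.

(* Only the values of w on the unit circle matter. *)
Definition analytic_weight (w : C -> R) : Prop :=
  (forall z, Cmod z = 1 -> 0 < w z) /\
  exists (U : C -> Prop) (W : C -> C),
    open (T := C_UniformSpace) U /\
    (forall z, Cmod z = 1 -> U z) /\
    holomorphic_on U W /\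
    (forall z, U z -> W z <> RtoC 0) /\
    (forall z, Cmod z = 1 -> W z = RtoC (w z)).

Definition orthonormal_polynomials
    (w : C -> R) (kappa : nat -> R) (phi : nat -> C -> C) : Prop :=
  (forall n, 0 < kappa n /\
     exists a : nat -> C,
       a n = RtoC (kappa n) /\
       forall z, phi n z = sum_n (fun j => (a j * z ^ j)%C) n) /\
  (forall n m,
     arclength_unit_circle (fun z => (phi n z * Cconj (phi m z) * w z)%C)
     = RtoC (if Nat.eqb n m then 1 else 0)).

Definition szego (w : C -> R) (z : C) : C :=
  Cexp (RtoC (/ (4 * PI)) *
        integral_C (fun theta =>
          (ln (w (cis theta)) * ((cis theta + z) / (cis theta - z)))%C)
          0 (2 * PI))%C.

(* The set is nonempty for an analytic weight, so the infimum is finite. *)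
Definition rho (w : C -> R) : R :=
  real (Glb_Rbar (fun s => 0 < s < 1 /\
    exists g : C -> C,
      holomorphic_on (fun z => s < Cmod z) g /\
      forall z, 1 < Cmod z -> g z = szego w z)).

(* 1 / D_i(0), written out. *)
Definition tau (w : C -> R) : R :=
  exp (- (/ (4 * PI) * RInt (fun theta => ln (w (cis theta))) 0 (2 * PI))).

(* Di and De are the interior and exterior Szego functions together with their
   analytic continuations.  By the reflection D_i(z) = 1 / conj (D_e (1 / conj z)),
   the function that continues holomorphically to |z| < 1/rho is 1 / D_i; D_i
   itself may have poles in 1 < |z| < 1/rho.  As / 0 = 0 in C, a pole of D_i is
   encoded by Di z = 0, and the last clause, which reads rho |z| < 1 in order to
   allow rho = 0, determines Di. *)
Definition szego_continuations (w : C -> R) (Di De : C -> C) : Prop :=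
  (forall z, Cmod z < 1 -> Di z = szego w z) /\
  (forall z, 1 < Cmod z -> De z = szego w z) /\
  holomorphic_on (fun z => rho w < Cmod z) De /\
  holomorphic_on (fun z => rho w * Cmod z < 1) (fun z => (/ Di z)%C).

Definition scatF (Di De : C -> C) (z : C) : C := (Di z * De z)%C.

Definition is_max_modulus (f : C -> C) (r Lambda : R) : Prop :=
  (forall z, Cmod z = r -> Cmod (f z) <= Lambda) /\
  exists z, Cmod z = r /\ Cmod (f z) = Lambda.

(* Boundary value f_-(t) from the exterior of the circle through t. *)
Definition ext_bv (f : C -> C) (t : C) : C :=
  iota (T := C_CompleteNormedModule) (fun l : C =>
    filterlim f
      (within (fun s : C => Cmod t < Cmod s) (locally (T := C_UniformSpace) t))
      (locally (T := C_UniformSpace) l)).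

Definition Mi (F : C -> C) (tau r : R) (n : nat) (f : C -> C) (z : C) : C :=
  (- / (2 * PI * Ci * tau ^ 2) *
   contour_circle r (fun t => ext_bv f t * (F t * t ^ n / (t - z))))%C.

Definition Me (F : C -> C) (tau r : R) (n : nat) (f : C -> C) (z : C) : C :=
  (tau ^ 2 / (2 * PI * Ci) *
   contour_circle (/ r) (fun t => ext_bv f t * / (F t * t ^ n * (t - z))))%C.

(* giter F tau r n k is g_n^{(k)}. *)
Fixpoint giter (F : C -> C) (tau r : R) (n k : nat) : C -> C :=
  match k with
  | O => fun _ => RtoC 1
  | S k' => if Nat.even k' then Me F tau r n (giter F tau r n k')
            else Mi F tau r n (giter F tau r n k')
  end.

(* Main.v *)
(* Write [I = 1 / D_i], [E = D_e], and let [G_N], [H_N] be the sums over [k <= N] of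
   [g^(2k)] and [g^(2k+1)], so that [H_N = M^e G_N] and [G_{N+1} = 1 + M^i H_N].  On
   [r < |z| < 1/r] consider [2 pi q = tau I G_{N+1} - E z^n H_N / tau].  Deforming the
   contours of [M^i] and [M^e] shows that [q] extends holomorphically to [|z| <= r], with
   [q(0) = tau^2 G_{N+1}(0) / (2 pi)], and that near [|z| = 1/r] it is the sum of a function
   holomorphic in the exterior of the unit circle and [O(z^(n-1))] at infinity, and of a
   multiple of [g^(2N+2)].  The latter is [O(theta^(2N))] with
   [theta = Lambda r^n / (1/r - r) < 1], so by Cauchy's formula in an annulus [q] is, up to
   [O(theta^(2N))], a polynomial of degree less than [n] on the unit circle.  Since
   [w = 1 / (I E)] there, Cauchy's theorem gives [int q w z^(-j) |dz| = delta_{j0}] for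
   [0 <= j < n], and pairing with [phi_{n-1}] yields
   [kappa_{n-1}^2 = q(0) + O(theta^(2N))]: the value of the series and its convergence. *)
Require Import Defs.
From Stdlib Require Import Reals Lra Lia Wf_nat.
From Coquelicot Require Import Coquelicot.
Open Scope R_scope.

(** * Continuity of complex-valued functions *)

(** Among polynomials of degree less than [n], the equations [int q w z^(-j) |dz| = delta_{j0}] for
    [0 <= j < n] single out the reproducing kernel at 0, [sum_{k<n} phi_k(z) conj (phi_k(0))], whose
    value at 0 is [kappa_{n-1}^2]; [q] approximates it, which is why its value at 0 carries the
    answer. Summing the series first would call for limits of functions under contour integrals. The
    truncated sums satisfy the moment equations exactly and miss being polynomial only through the
    last iterate, so convergence comes as a by-product. In [theta], [1/r - r] is the distance
    between the two circles and [Lambda r^n] bounds both kernels, because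
    [1 / F(z) = conj (F (1 / conj z))] carries the bound from [|z| = r] to [|z| = 1/r]. Lengths of
    circles and powers of [tau] cancel between consecutive steps. All contours are circles centred
    at 0, so Goursat's theorem is proved for polar rectangles, of which annulus and disc are special
    cases. The identity [D_i / D_e = w] on the unit circle is not built into [szego_continuations];
    it is derived from the Poisson kernel. *)

Definition ccont {T : UniformSpace} (f : T -> C) (x : T) : Prop :=
  continuous (U := C_UniformSpace) f x.

Section Continuity.
Context {T : UniformSpace}.
Implicit Types (f g : T -> C) (x : T).

Lemma ccont_pair f x :
  continuous (fun t => Re (f t)) x -> continuous (fun t => Im (f t)) x -> ccont f x.
Proof.
  intros H1 H2. unfold ccont, continuous.
  intros P [eps HP].
  assert (Q1 := H1 _ (locally_ball _ eps)). assert (Q2 := H2 _ (locally_ball _ eps)).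
  unfold filtermap in Q1, Q2.
  generalize (filter_and (F := locally x) _ _ Q1 Q2). unfold filtermap. apply filter_imp.
  intros t [A1 A2]. apply HP. split; assumption.
Qed.

Lemma ccont_Re f x : ccont f x -> continuous (fun t => Re (f t)) x.
Proof.
  intros H P [eps HP].
  generalize (H _ (locally_ball _ eps)). unfold filtermap. apply filter_imp.
  intros t [A1 A2]. apply HP. exact A1.
Qed.

Lemma ccont_Im f x : ccont f x -> continuous (fun t => Im (f t)) x.
Proof.
  intros H P [eps HP].
  generalize (H _ (locally_ball _ eps)). unfold filtermap. apply filter_imp.
  intros t [A1 A2]. apply HP. exact A2.
Qed.

Lemma ccont_const (c : C) x : ccont (fun _ => c) x.
Proof. apply continuous_const. Qed.

Lemma ccont_RtoC (f : T -> R) x : continuous f x -> ccont (fun t => RtoC (f t)) x.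
Proof.
  intros H. apply ccont_pair; simpl; [exact H | apply continuous_const].
Qed.

Lemma rcont_plus (f g : T -> R) x :
  continuous f x -> continuous g x -> continuous (fun t => f t + g t) x.
Proof. intros; now apply (continuous_plus (V := R_NormedModule)). Qed.

Lemma rcont_opp (f : T -> R) x : continuous f x -> continuous (fun t => - f t) x.
Proof. intros; now apply (continuous_opp (V := R_NormedModule)). Qed.

Lemma rcont_mult (f g : T -> R) x :
  continuous f x -> continuous g x -> continuous (fun t => f t * g t) x.
Proof. intros; now apply (continuous_mult (K := R_AbsRing)). Qed.

Lemma rcont_inv (f : T -> R) x :
  continuous f x -> f x <> 0 -> continuous (fun t => / f t) x.
Proof. intros H H0. apply (continuous_comp f Rinv); [exact H | now apply continuous_Rinv]. Qed.

Lemma ccont_plus f g x : ccont f x -> ccont g x -> ccont (fun t => f t + g t)%C x.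
Proof.
  intros H1 H2. apply ccont_pair.
  - exact (rcont_plus _ _ x (ccont_Re _ _ H1) (ccont_Re _ _ H2)).
  - exact (rcont_plus _ _ x (ccont_Im _ _ H1) (ccont_Im _ _ H2)).
Qed.

Lemma ccont_opp f x : ccont f x -> ccont (fun t => - f t)%C x.
Proof.
  intros H1. apply ccont_pair.
  - exact (rcont_opp _ x (ccont_Re _ _ H1)).
  - exact (rcont_opp _ x (ccont_Im _ _ H1)).
Qed.

Lemma ccont_minus f g x : ccont f x -> ccont g x -> ccont (fun t => f t - g t)%C x.
Proof. intros H1 H2. apply ccont_plus; [exact H1 | now apply ccont_opp]. Qed.

Lemma ccont_mult f g x : ccont f x -> ccont g x -> ccont (fun t => f t * g t)%C x.
Proof.
  intros H1 H2.
  assert (R1 := ccont_Re _ _ H1). assert (I1 := ccont_Im _ _ H1).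
  assert (R2 := ccont_Re _ _ H2). assert (I2 := ccont_Im _ _ H2).
  apply ccont_pair.
  - exact (rcont_plus _ _ x (rcont_mult _ _ x R1 R2) (rcont_opp _ x (rcont_mult _ _ x I1 I2))).
  - exact (rcont_plus _ _ x (rcont_mult _ _ x R1 I2) (rcont_mult _ _ x I1 R2)).
Qed.

Lemma rcont_sqnorm f x : ccont f x -> continuous (fun t => Re (f t) ^ 2 + Im (f t) ^ 2) x.
Proof.
  intros H. assert (HR := ccont_Re _ _ H). assert (HI := ccont_Im _ _ H).
  assert (E : forall u v : R, u * u + v * v = u ^ 2 + v ^ 2) by (intros; ring).
  apply (continuous_ext (fun t => Re (f t) * Re (f t) + Im (f t) * Im (f t))).
  - intros t. apply E.
  - exact (rcont_plus _ _ x (rcont_mult _ _ x HR HR) (rcont_mult _ _ x HI HI)).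
Qed.

Lemma ccont_inv f x : ccont f x -> f x <> RtoC 0 -> ccont (fun t => / f t)%C x.
Proof.
  intros H1 H0.
  assert (Hre := ccont_Re _ _ H1). assert (Him := ccont_Im _ _ H1).
  assert (Hn := rcont_sqnorm _ _ H1).
  assert (Hnz : Re (f x) ^ 2 + Im (f x) ^ 2 <> 0).
  { intros E. apply H0. apply Cmod_eq_0.
    unfold Cmod. unfold Re, Im in E. rewrite E. apply sqrt_0. }
  apply ccont_pair; simpl.
  - apply (rcont_mult (fun t => Re (f t)) (fun t => / (Re (f t) ^ 2 + Im (f t) ^ 2))); auto.
    now apply (rcont_inv (fun t => Re (f t) ^ 2 + Im (f t) ^ 2)).
  - apply (rcont_mult (fun t => - Im (f t)) (fun t => / (Re (f t) ^ 2 + Im (f t) ^ 2))).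
    + now apply rcont_opp.
    + now apply (rcont_inv (fun t => Re (f t) ^ 2 + Im (f t) ^ 2)).
Qed.

Lemma ccont_div f g x :
  ccont f x -> ccont g x -> g x <> RtoC 0 -> ccont (fun t => f t / g t)%C x.
Proof. intros. apply ccont_mult; [assumption | now apply ccont_inv]. Qed.

Lemma ccont_pow f (n : nat) x : ccont f x -> ccont (fun t => f t ^ n)%C x.
Proof.
  intros H. induction n as [|n IH]; simpl.
  - apply ccont_const.
  - now apply ccont_mult.
Qed.

Lemma ccont_conj f x : ccont f x -> ccont (fun t => Cconj (f t)) x.
Proof.
  intros H. apply ccont_pair; simpl.
  - now apply ccont_Re.
  - apply rcont_opp. now apply ccont_Im.
Qed.

Lemma rcont_Cmod f x : ccont f x -> continuous (fun t => Cmod (f t)) x.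
Proof.
  intros H. unfold Cmod.
  apply (continuous_comp (fun t => Re (f t) ^ 2 + Im (f t) ^ 2) sqrt).
  - now apply rcont_sqnorm.
  - apply continuous_sqrt.
Qed.

End Continuity.

Lemma ccont_comp {T U : UniformSpace} (f : T -> U) (g : U -> C) x :
  continuous f x -> ccont g (f x) -> ccont (fun t => g (f t)) x.
Proof. intros. now apply continuous_comp. Qed.

Lemma ccont_id (z : C) : ccont (T := C_UniformSpace) (fun t => t) z.
Proof. apply continuous_id. Qed.

Lemma ball_of_Cmod (x y : C) (e : R) : Cmod (y - x) < e -> ball (M := C_UniformSpace) x e y.
Proof. apply C_NormedModule_mixin_compat1. Qed.

(** Balls of the product uniform structure on [C] are squares, so passing to the modulus costs a
    factor [sqrt 2], rounded up to 2. *)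
Lemma Cmod_of_ball (x y : C) (e : posreal) :
  ball (M := C_UniformSpace) x e y -> Cmod (y - x) < 2 * e.
Proof.
  intros H. apply C_NormedModule_mixin_compat2 in H.
  change (Cmod (minus y x)) with (Cmod (y - x)) in H.
  assert (sqrt 2 <= 2).
  { rewrite <- (sqrt_square 2) at 2 by lra. apply sqrt_le_1; lra. }
  pose proof (cond_pos e). nra.
Qed.

Lemma ccont_eps (f : C -> C) (z : C) :
  ccont (T := C_UniformSpace) f z <->
  forall eps, 0 < eps -> exists d, 0 < d /\
    forall y, Cmod (y - z) < d -> Cmod (f y - f z) < eps.
Proof.
  split.
  - intros H eps He.
    assert (He2 : 0 < eps / 2) by lra.
    destruct (H _ (locally_ball _ (mkposreal _ He2))) as [d Hd].
    exists d. split; [apply cond_pos|]. intros y Hy.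
    specialize (Hd y (ball_of_Cmod _ _ _ Hy)).
    apply Cmod_of_ball in Hd. simpl in Hd. lra.
  - intros H P [eps HP].
    destruct (H eps (cond_pos eps)) as (d & Hd & K).
    assert (Hd2 : 0 < d / 2) by lra.
    exists (mkposreal _ Hd2). intros y Hy. apply HP.
    apply ball_of_Cmod. apply K. apply Cmod_of_ball in Hy. simpl in Hy. lra.
Qed.

(** * Complex differentiability *)

(** The non-strict bound is trivial at [y = z], so no punctured neighbourhood is needed. *)
Definition cderiv (f : C -> C) (z l : C) : Prop :=
  forall eps, 0 < eps -> exists d, 0 < d /\
    forall y, Cmod (y - z) < d -> Cmod (f y - f z - l * (y - z)) <= eps * Cmod (y - z).

Definition cdiff (f : C -> C) (z : C) : Prop := exists l, cderiv f z l.

Lemma cdiff_of_ex_derive (f : C -> C) (z : C) :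
  ex_derive (K := C_AbsRing) (V := C_NormedModule) f z -> cdiff f z.
Proof.
  intros [l Hl]. exists l. intros eps He.
  destruct Hl as [_ Hl].
  specialize (Hl z (fun P H => H) (mkposreal eps He)).
  simpl in Hl. apply locally_C in Hl. destruct Hl as [d Hd].
  exists d. split; [apply cond_pos|]. intros y Hy.
  specialize (Hd y (ball_of_Cmod _ _ _ Hy)).
  change (Cmod (f y - f z - (y - z) * l) <= eps * Cmod (y - z)) in Hd.
  now rewrite Cmult_comm.
Qed.

Lemma cdiff_ccont (f : C -> C) (z : C) : cdiff f z -> ccont (T := C_UniformSpace) f z.
Proof.
  intros [l Hl]. apply ccont_eps. intros eps He.
  destruct (Hl 1 Rlt_0_1) as (d & Hd & K).
  assert (Hl0 := Cmod_ge_0 l).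
  exists (Rmin d (eps / (2 + Cmod l))).
  assert (0 < eps / (2 + Cmod l)) by (apply Rdiv_lt_0_compat; lra).
  split; [now apply Rmin_pos|]. intros y Hy.
  assert (Hy1 := Rlt_le_trans _ _ _ Hy (Rmin_l _ _)).
  assert (Hy2 := Rlt_le_trans _ _ _ Hy (Rmin_r _ _)).
  specialize (K y Hy1).
  replace (f y - f z)%C with ((f y - f z - l * (y - z)) + l * (y - z))%C by ring.
  eapply Rle_lt_trans; [apply Cmod_triangle|]. rewrite Cmod_mult.
  apply Rlt_div_r in Hy2; [|lra].
  assert (0 <= Cmod (y - z)) by apply Cmod_ge_0. nra.
Qed.

Lemma cdiff_ext_loc (f g : C -> C) (z : C) (d : R) :
  0 < d -> (forall y, Cmod (y - z) < d -> f y = g y) -> cdiff f z -> cdiff g z.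
Proof.
  intros Hd E [l Hl]. exists l. intros eps He.
  destruct (Hl eps He) as (d' & Hd' & K).
  exists (Rmin d d'). split; [now apply Rmin_pos|]. intros y Hy.
  rewrite <- !E.
  - apply K. eapply Rlt_le_trans; [exact Hy | apply Rmin_r].
  - replace (z - z)%C with (RtoC 0) by ring. now rewrite Cmod_0.
  - eapply Rlt_le_trans; [exact Hy | apply Rmin_l].
Qed.

Lemma cdiff_ext (f g : C -> C) (z : C) : (forall y, f y = g y) -> cdiff f z -> cdiff g z.
Proof. intros E. apply (cdiff_ext_loc f g z 1 Rlt_0_1). intros; apply E. Qed.

Lemma cdiff_const (c z : C) : cdiff (fun _ => c) z.
Proof.
  exists (RtoC 0). intros eps He. exists 1. split; [lra|]. intros y _.
  replace (c - c - 0 * (y - z))%C with (RtoC 0) by ring. rewrite Cmod_0.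
  apply Rmult_le_pos; [lra | apply Cmod_ge_0].
Qed.

Lemma cdiff_id (z : C) : cdiff (fun t => t) z.
Proof.
  exists (RtoC 1). intros eps He. exists 1. split; [lra|]. intros y _.
  replace (y - z - 1 * (y - z))%C with (RtoC 0) by ring. rewrite Cmod_0.
  apply Rmult_le_pos; [lra | apply Cmod_ge_0].
Qed.

Lemma cdiff_plus (f g : C -> C) (z : C) :
  cdiff f z -> cdiff g z -> cdiff (fun t => f t + g t)%C z.
Proof.
  intros [l Hl] [m Hm]. exists (l + m)%C. intros eps He.
  destruct (Hl (eps / 2)) as (d1 & Hd1 & K1); [lra|].
  destruct (Hm (eps / 2)) as (d2 & Hd2 & K2); [lra|].
  exists (Rmin d1 d2). split; [now apply Rmin_pos|]. intros y Hy.
  specialize (K1 y (Rlt_le_trans _ _ _ Hy (Rmin_l _ _))).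
  specialize (K2 y (Rlt_le_trans _ _ _ Hy (Rmin_r _ _))).
  replace (f y + g y - (f z + g z) - (l + m) * (y - z))%C
    with ((f y - f z - l * (y - z)) + (g y - g z - m * (y - z)))%C by ring.
  eapply Rle_trans; [apply Cmod_triangle|]. lra.
Qed.

Lemma cdiff_mult (f g : C -> C) (z : C) :
  cdiff f z -> cdiff g z -> cdiff (fun t => f t * g t)%C z.
Proof.
  intros [l Hl] [m Hm]. exists (l * g z + f z * m)%C. intros eps He.
  assert (Cg : ccont (T := C_UniformSpace) g z) by (apply cdiff_ccont; now exists m).
  set (A := Cmod l + Cmod (g z) + Cmod (f z) + 2).
  assert (P1 := Cmod_ge_0 l). assert (P2 := Cmod_ge_0 (g z)). assert (P3 := Cmod_ge_0 (f z)).
  assert (HA : 0 < A) by (unfold A; lra).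
  assert (He' : 0 < eps / (3 * A)) by (apply Rdiv_lt_0_compat; lra).
  destruct (Hl _ He') as (d1 & Hd1 & K1).
  destruct (Hm _ He') as (d2 & Hd2 & K2).
  rewrite ccont_eps in Cg. destruct (Cg (Rmin 1 (eps / (3 * A)))) as (d3 & Hd3 & K3).
  { apply Rmin_pos; lra. }
  exists (Rmin d1 (Rmin d2 d3)). split; [now repeat apply Rmin_pos|]. intros y Hy.
  assert (Y1 := Rlt_le_trans _ _ _ Hy (Rmin_l _ _)).
  assert (Y' := Rlt_le_trans _ _ _ Hy (Rmin_r _ _)).
  assert (Y2 := Rlt_le_trans _ _ _ Y' (Rmin_l _ _)).
  assert (Y3 := Rlt_le_trans _ _ _ Y' (Rmin_r _ _)).
  specialize (K1 y Y1). specialize (K2 y Y2). specialize (K3 y Y3).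
  assert (K3a := Rlt_le_trans _ _ _ K3 (Rmin_l _ _)).
  assert (K3b := Rlt_le_trans _ _ _ K3 (Rmin_r _ _)).
  replace (f y * g y - f z * g z - (l * g z + f z * m) * (y - z))%C
    with ((f y - f z - l * (y - z)) * g y + l * (y - z) * (g y - g z)
          + f z * (g y - g z - m * (y - z)))%C by ring.
  eapply Rle_trans; [apply Cmod_triangle|].
  eapply Rle_trans; [apply Rplus_le_compat_r; apply Cmod_triangle|].
  rewrite !Cmod_mult.
  assert (Hgy : Cmod (g y) <= Cmod (g z) + 1).
  { replace (g y) with (g z + (g y - g z))%C by ring.
    eapply Rle_trans; [apply Cmod_triangle|]. lra. }
  assert (Hy0 := Cmod_ge_0 (y - z)).
  set (X := Cmod (y - z)) in *. set (e := eps / (3 * A)) in *.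
  assert (Ee : eps = 3 * A * e) by (unfold e; field; lra).
  assert (B1 : Cmod (f y - f z - l * (y - z)) * Cmod (g y) <= e * X * A).
  { apply Rmult_le_compat; try apply Cmod_ge_0; [exact K1|]. unfold A; lra. }
  assert (B2 : Cmod l * X * Cmod (g y - g z) <= A * X * e).
  { apply Rmult_le_compat; try apply Cmod_ge_0; [| |lra].
    - apply Rmult_le_pos; lra.
    - apply Rmult_le_compat_r; [lra|]. unfold A; lra. }
  assert (B3 : Cmod (f z) * Cmod (g y - g z - m * (y - z)) <= A * (e * X)).
  { apply Rmult_le_compat; try apply Cmod_ge_0; [unfold A; lra|exact K2]. }
  rewrite Ee. lra.
Qed.

Lemma Cinv_0 : (/ RtoC 0)%C = RtoC 0.
Proof. unfold Cinv, RtoC; simpl. f_equal; unfold Rdiv; ring. Qed.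

(** True at 0 as well, by the convention [/ 0 = 0]. Hence [/ Di] can serve as the basic holomorphic
    function and [Di] be recovered from it everywhere, even at an encoded pole. *)
Lemma Cinv_Cinv (z : C) : (/ / z)%C = z.
Proof.
  destruct (Ceq_dec z 0) as [->|H]; [now rewrite !Cinv_0|].
  field. exact H.
Qed.

Lemma Cinv_Cmult (a b : C) : (/ (a * b))%C = (/ a * / b)%C.
Proof.
  destruct (Ceq_dec a 0) as [->|Ha].
  { rewrite Cmult_0_l, Cinv_0. ring. }
  destruct (Ceq_dec b 0) as [->|Hb].
  { rewrite Cmult_0_r, Cinv_0. ring. }
  field; split; assumption.
Qed.


Lemma cdiff_comp (f g : C -> C) (z : C) :
  cdiff f z -> cdiff g (f z) -> cdiff (fun t => g (f t)) z.
Proof.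
  intros [l Hl] [m Hm]. exists (m * l)%C. intros eps He.
  assert (P1 := Cmod_ge_0 l). assert (P2 := Cmod_ge_0 m).
  set (A := Cmod l + Cmod m + 2).
  assert (HA : 0 < A) by (unfold A; lra).
  assert (He' : 0 < eps / (2 * A)) by (apply Rdiv_lt_0_compat; lra).
  destruct (Hl 1 Rlt_0_1) as (d0 & Hd0 & K0).
  destruct (Hl _ He') as (d1 & Hd1 & K1).
  destruct (Hm _ He') as (d2 & Hd2 & K2).
  assert (Hd3 : 0 < d2 / A) by (now apply Rdiv_lt_0_compat).
  exists (Rmin d0 (Rmin d1 (d2 / A))). split; [now repeat apply Rmin_pos|]. intros y Hy.
  assert (Y1 := Rlt_le_trans _ _ _ Hy (Rmin_l _ _)).
  assert (Y' := Rlt_le_trans _ _ _ Hy (Rmin_r _ _)).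
  assert (Y2 := Rlt_le_trans _ _ _ Y' (Rmin_l _ _)).
  assert (Y3 := Rlt_le_trans _ _ _ Y' (Rmin_r _ _)).
  specialize (K0 y Y1). specialize (K1 y Y2).
  assert (Hy0 := Cmod_ge_0 (y - z)).
  assert (Hf : Cmod (f y - f z) <= (1 + Cmod l) * Cmod (y - z)).
  { replace (f y - f z)%C with ((f y - f z - l * (y - z)) + l * (y - z))%C by ring.
    eapply Rle_trans; [apply Cmod_triangle|]. rewrite Cmod_mult. lra. }
  assert (Y4 : Cmod (f y - f z) < d2).
  { apply Rlt_div_r in Y3; [|exact HA]. unfold A in Y3. nra. }
  specialize (K2 _ Y4).
  replace (g (f y) - g (f z) - m * l * (y - z))%C
    with ((g (f y) - g (f z) - m * (f y - f z)) + m * (f y - f z - l * (y - z)))%C by ring.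
  eapply Rle_trans; [apply Cmod_triangle|]. rewrite Cmod_mult.
  set (X := Cmod (y - z)) in *. set (e := eps / (2 * A)) in *.
  assert (Ee : eps = 2 * A * e) by (unfold e; field; lra).
  assert (B1 : e * Cmod (f y - f z) <= e * (A * X)).
  { apply Rmult_le_compat_l; [lra|]. eapply Rle_trans; [exact Hf|].
    apply Rmult_le_compat_r; [lra|]. unfold A; lra. }
  assert (B2 : Cmod m * Cmod (f y - f z - l * (y - z)) <= A * (e * X)).
  { apply Rmult_le_compat; try apply Cmod_ge_0; [unfold A; lra|exact K1]. }
  rewrite Ee. lra.
Qed.

Lemma cdiff_Cinv (z : C) : z <> RtoC 0 -> cdiff Cinv z.
Proof.
  intros Hz. exists (- (/ z * / z))%C. intros eps He.
  assert (P := proj1 (Cmod_gt_0 z) Hz).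
  (* The first radius keeps [|y| >= |z| / 2]; the remainder [(y - z)^2 / (y z^2)] is then at most
     [2 |y - z|^2 / |z|^3], which dictates the second radius. *)
  exists (Rmin (Cmod z / 2) (eps * (Cmod z ^ 3 / 2))).
  split.
  { apply Rmin_pos; [lra|]. apply Rmult_lt_0_compat; [lra|].
    apply Rdiv_lt_0_compat; [now apply pow_lt|lra]. }
  intros y Hy.
  assert (Y1 := Rlt_le_trans _ _ _ Hy (Rmin_l _ _)).
  assert (Y2 := Rlt_le_trans _ _ _ Hy (Rmin_r _ _)).
  assert (Py : Cmod z / 2 <= Cmod y).
  { assert (Cmod z <= Cmod y + Cmod (y - z)).
    { replace z with (y + - (y - z))%C at 1 by ring.
      eapply Rle_trans; [apply Cmod_triangle|]. rewrite Cmod_opp. lra. }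
    lra. }
  assert (Hy0 : y <> RtoC 0) by (apply Cmod_gt_0; lra).
  replace (/ y - / z - - (/ z * / z) * (y - z))%C
    with ((y - z) * (y - z) * (/ y * / z * / z))%C by (field; now split).
  rewrite !Cmod_mult, !Cmod_inv by assumption.
  set (X := Cmod (y - z)) in *. assert (0 <= X) by apply Cmod_ge_0.
  set (Z := Cmod z) in *. set (Y := Cmod y) in *.
  assert (/ Y <= / (Z / 2)) by (apply Rinv_le_contravar; lra).
  replace eps with ((eps * (Z ^ 3 / 2)) * (/ (Z / 2) * / Z * / Z)) by (field; lra).
  rewrite (Rmult_assoc X X), (Rmult_comm _ X).
  apply Rmult_le_compat_l; [lra|].
  assert (0 < / Z) by now apply Rinv_0_lt_compat.
  assert (0 < / Y) by (apply Rinv_0_lt_compat; lra).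
  apply Rmult_le_compat; try lra.
  - apply Rmult_le_pos; [apply Rmult_le_pos|]; lra.
  - repeat (apply Rmult_le_compat_r; [lra|]). lra.
Qed.

Lemma cdiff_inv (f : C -> C) (z : C) :
  cdiff f z -> f z <> RtoC 0 -> cdiff (fun t => / f t)%C z.
Proof. intros H H0. apply (cdiff_comp f Cinv); [exact H | now apply cdiff_Cinv]. Qed.

Lemma cdiff_opp (f : C -> C) (z : C) : cdiff f z -> cdiff (fun t => - f t)%C z.
Proof.
  intros H. apply (cdiff_ext (fun t => RtoC (-1) * f t)%C).
  - intros y. ring.
  - apply cdiff_mult; [apply cdiff_const | exact H].
Qed.

Lemma cdiff_minus (f g : C -> C) (z : C) :
  cdiff f z -> cdiff g z -> cdiff (fun t => f t - g t)%C z.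
Proof. intros H1 H2. apply cdiff_plus; [exact H1 | now apply cdiff_opp]. Qed.

Lemma cdiff_div (f g : C -> C) (z : C) :
  cdiff f z -> cdiff g z -> g z <> RtoC 0 -> cdiff (fun t => f t / g t)%C z.
Proof. intros. apply cdiff_mult; [assumption | now apply cdiff_inv]. Qed.

Lemma cdiff_pow (f : C -> C) (n : nat) (z : C) : cdiff f z -> cdiff (fun t => f t ^ n)%C z.
Proof.
  intros H. induction n as [|n IH]; simpl.
  - apply cdiff_const.
  - now apply cdiff_mult.
Qed.

(** Conjugating argument and value conjugates the derivative. Reflections in the unit circle are
    holomorphic for this reason. *)
Lemma cdiff_conj_conj (f : C -> C) (z : C) :
  cdiff f (Cconj z) -> cdiff (fun t => Cconj (f (Cconj t))) z.
Proof.
  intros [l Hl]. exists (Cconj l). intros eps He.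
  destruct (Hl eps He) as (d & Hd & K). exists d. split; [exact Hd|].
  intros y Hy. rewrite <- (Cmod_conj (y - z)) in *. rewrite Cminus_conj in *.
  specialize (K _ Hy).
  rewrite <- (Cmod_conj _) in K. now rewrite !Cminus_conj, Cmult_conj, Cminus_conj, !Cconj_conj in *.
Qed.

(** * Integrals of complex-valued functions of a real variable *)

Definition cint (h : R -> C) (a b : R) : Prop := ex_RInt (V := C_R_NormedModule) h a b.

Lemma cint_cont (h : R -> C) (a b : R) :
  (forall x, Rmin a b <= x <= Rmax a b -> ccont h x) -> cint h a b.
Proof. intros H. now apply (ex_RInt_continuous (V := C_R_CompleteNormedModule)). Qed.

Lemma integral_C_ext (h k : R -> C) (a b : R) :
  (forall x, Rmin a b <= x <= Rmax a b -> h x = k x) -> integral_C h a b = integral_C k a b.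
Proof.
  intros H. apply (RInt_ext (V := C_R_CompleteNormedModule)). intros x Hx. apply H. lra.
Qed.

Lemma is_integral_C (h : R -> C) (a b : R) :
  cint h a b -> is_RInt (V := C_R_NormedModule) h a b (integral_C h a b).
Proof. apply (RInt_correct (V := C_R_CompleteNormedModule)). Qed.

Lemma integral_C_unique (h : R -> C) (a b : R) (l : C) :
  is_RInt (V := C_R_NormedModule) h a b l -> integral_C h a b = l.
Proof. apply (is_RInt_unique (V := C_R_CompleteNormedModule)). Qed.

Lemma integral_C_plus (h k : R -> C) (a b : R) :
  cint h a b -> cint k a b ->
  integral_C (fun x => h x + k x)%C a b = (integral_C h a b + integral_C k a b)%C.
Proof. apply (RInt_plus (V := C_R_CompleteNormedModule)). Qed.

(** The integral lives in [C] as a normed module over the reals, where multiplication by a complex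
    constant is not a scalar multiplication; it is resolved into real and imaginary parts. *)
Lemma is_integral_C_scal (c : C) (h : R -> C) (a b : R) (l : C) :
  is_RInt (V := C_R_NormedModule) h a b l ->
  is_RInt (V := C_R_NormedModule) (fun x => c * h x)%C a b (c * l)%C.
Proof.
  intros H.
  assert (H1 := is_RInt_fct_extend_fst (U := R_NormedModule) (V := R_NormedModule) h a b l H).
  assert (H2 := is_RInt_fct_extend_snd (U := R_NormedModule) (V := R_NormedModule) h a b l H).
  apply (is_RInt_fct_extend_pair (U := R_NormedModule) (V := R_NormedModule)
           (fun x => c * h x)%C a b).
  - apply (is_RInt_minus (V := R_NormedModule)
             (fun t => fst c * fst (h t)) (fun t => snd c * snd (h t))).
    + now apply (is_RInt_scal (V := R_NormedModule) (fun t => fst (h t))).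
    + now apply (is_RInt_scal (V := R_NormedModule) (fun t => snd (h t))).
  - apply (is_RInt_plus (V := R_NormedModule)
             (fun t => fst c * snd (h t)) (fun t => snd c * fst (h t))).
    + now apply (is_RInt_scal (V := R_NormedModule) (fun t => snd (h t))).
    + now apply (is_RInt_scal (V := R_NormedModule) (fun t => fst (h t))).
Qed.

Lemma cint_scal (c : C) (h : R -> C) (a b : R) :
  cint h a b -> cint (fun x => c * h x)%C a b.
Proof. intros [l H]. exists (c * l)%C. now apply is_integral_C_scal. Qed.

Lemma integral_C_scal (c : C) (h : R -> C) (a b : R) :
  cint h a b -> integral_C (fun x => c * h x)%C a b = (c * integral_C h a b)%C.
Proof.
  intros H. apply integral_C_unique. apply is_integral_C_scal. now apply is_integral_C.
Qed.

Lemma integral_C_Chasles (h : R -> C) (a b c : R) :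
  cint h a b -> cint h b c ->
  (integral_C h a b + integral_C h b c)%C = integral_C h a c.
Proof. apply (RInt_Chasles (V := C_R_CompleteNormedModule)). Qed.

(** The product norm is Euclidean, so bounds of integrals by length times supremum hold for [Cmod]
    without loss of a constant. *)
Lemma norm_C_R (z : C) : norm (V := C_R_NormedModule) z = Cmod z.
Proof.
  unfold norm; simpl. unfold prod_norm, Cmod. simpl.
  f_equal. unfold norm; simpl. unfold abs; simpl.
  rewrite !Rmult_1_r, <- !Rabs_mult, !Rabs_pos_eq; [reflexivity | nra | nra].
Qed.

Lemma Cmod_integral_C_le (h : R -> C) (a b M : R) :
  a <= b -> cint h a b -> (forall x, a <= x <= b -> Cmod (h x) <= M) ->
  Cmod (integral_C h a b) <= (b - a) * M.
Proof.
  intros Hab H HM. rewrite <- norm_C_R.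
  apply (norm_RInt_le_const (V := C_R_NormedModule) h a b); [exact Hab | | now apply is_integral_C].
  intros x Hx. rewrite norm_C_R. now apply HM.
Qed.

Lemma integral_C_FTC (P p : R -> C) (a b : R) :
  (forall x, Rmin a b <= x <= Rmax a b ->
     is_derive (fun t => Re (P t)) x (Re (p x)) /\ is_derive (fun t => Im (P t)) x (Im (p x))) ->
  (forall x, Rmin a b <= x <= Rmax a b -> ccont p x) ->
  integral_C p a b = (P b - P a)%C.
Proof.
  intros HP Hp. apply integral_C_unique.
  apply (is_RInt_fct_extend_pair (U := R_NormedModule) (V := R_NormedModule) p a b).
  - apply (is_RInt_derive (V := R_CompleteNormedModule) (fun t => Re (P t))).
    + intros x Hx. now apply HP.
    + intros x Hx. now apply ccont_Re, Hp.
  - apply (is_RInt_derive (V := R_CompleteNormedModule) (fun t => Im (P t))).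
    + intros x Hx. now apply HP.
    + intros x Hx. now apply ccont_Im, Hp.
Qed.

Lemma Cmod_cis (x : R) : Cmod (cis x) = 1.
Proof.
  unfold Cmod, cis; simpl. rewrite !Rmult_1_r.
  replace (cos x * cos x + sin x * sin x) with 1; [apply sqrt_1|].
  pose proof (sin2_cos2 x) as H. unfold Rsqr in H. lra.
Qed.

Lemma Cmod_polar (s x : R) : 0 <= s -> Cmod (s * cis x) = s.
Proof. intros H. rewrite Cmod_mult, Cmod_cis, Cmod_R, Rabs_pos_eq; lra. Qed.

Lemma cis_neq_0 (x : R) : cis x <> RtoC 0.
Proof. apply Cmod_gt_0. rewrite Cmod_cis. lra. Qed.

Lemma polar_form (z : C) : exists x, 0 <= x <= 2 * PI /\ z = (Cmod z * cis x)%C.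
Proof.
  destruct (Ceq_dec z 0) as [->|Hz].
  { exists 0. pose proof PI_RGT_0. split; [lra|]. rewrite Cmod_0. ring. }
  assert (P := proj1 (Cmod_gt_0 z) Hz).
  set (u := fst z / Cmod z). set (v := snd z / Cmod z).
  assert (Huv : u * u + v * v = 1).
  { unfold u, v. assert (E := Cmod2_alt z). unfold Re, Im in E.
    replace (fst z / Cmod z * (fst z / Cmod z) + snd z / Cmod z * (snd z / Cmod z))
      with ((fst z ^ 2 + snd z ^ 2) / Cmod z ^ 2) by (field; lra).
    rewrite <- E. field. lra. }
  assert (Hu : -1 <= u <= 1) by nra.
  assert (Hs : sqrt (1 - u²) = Rabs v).
  { rewrite <- sqrt_Rsqr_abs. f_equal. unfold Rsqr. lra. }
  assert (Ez : forall x, cos x = u -> sin x = v -> z = (Cmod z * cis x)%C).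
  { intros x E1 E2. destruct z as [p q]. unfold cis. rewrite E1, E2.
    unfold u, v, Cmult, RtoC; simpl. f_equal; simpl in *; field; simpl; lra. }
  (* [acos] only reaches the upper half plane; [2 * PI - acos u] has the same cosine and the
     opposite sine. *)
  destruct (Rle_dec 0 v) as [Hv|Hv].
  - exists (acos u). pose proof (acos_bound u). split; [lra|].
    apply Ez; [now apply cos_acos|].
    rewrite sin_acos by lra. rewrite Hs. now apply Rabs_pos_eq.
  - exists (2 * PI - acos u). pose proof (acos_bound u). split; [lra|]. apply Ez.
    + rewrite cos_minus, cos_2PI, sin_2PI, cos_acos by lra. ring.
    + rewrite sin_minus, cos_2PI, sin_2PI, sin_acos by lra. rewrite Hs, Rabs_left; lra.
Qed.

Lemma cis_2PI : cis (2 * PI) = cis 0.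
Proof. unfold cis. now rewrite cos_2PI, sin_2PI, cos_0, sin_0. Qed.

Lemma ccont_cis (x : R) : ccont cis x.
Proof.
  apply ccont_pair; simpl.
  - apply continuous_cos.
  - apply continuous_sin.
Qed.

(** The chord is the integral of [Ci * cis t], of modulus 1, between the two angles. *)
Lemma Cmod_cis_minus (x y : R) : Cmod (cis y - cis x) <= Rabs (y - x).
Proof.
  assert (K : forall a b, a <= b -> Cmod (cis b - cis a) <= b - a).
  { intros a b Hab.
    rewrite <- (integral_C_FTC cis (fun t => Ci * cis t)%C a b).
    - replace (b - a) with ((b - a) * 1) by ring. apply Cmod_integral_C_le; [exact Hab| |].
      + apply cint_cont. intros t _. apply ccont_mult; [apply ccont_const | apply ccont_cis].
      + intros t _. rewrite Cmod_mult, Cmod_Ci, Cmod_cis. lra.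
    - intros t _. unfold cis; simpl. split; auto_derive; trivial; ring.
    - intros t _. apply ccont_mult; [apply ccont_const | apply ccont_cis]. }
  destruct (Rle_dec x y) as [H|H].
  - rewrite Rabs_pos_eq by lra. now apply K.
  - replace (cis y - cis x)%C with (- (cis x - cis y))%C by ring.
    rewrite Cmod_opp, Rabs_left by lra. replace (- (y - x)) with (x - y) by ring. apply K. lra.
Qed.

Lemma Cmod_polar_minus (s x s' x' B : R) :
  Rabs s <= B -> Cmod (s * cis x - s' * cis x') <= Rabs (s - s') + B * Rabs (x - x').
Proof.
  intros HB.
  replace (s * cis x - s' * cis x')%C
    with (RtoC (s - s') * cis x' + s * (cis x - cis x'))%C by (rewrite RtoC_minus; ring).
  eapply Rle_trans; [apply Cmod_triangle|].
  rewrite !Cmod_mult, Cmod_cis, !Cmod_R.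
  pose proof (Cmod_cis_minus x' x). pose proof (Rabs_pos (x - x')).
  pose proof (Rabs_pos s). pose proof (Cmod_ge_0 (cis x - cis x')). nra.
Qed.

(** * Goursat's theorem in polar coordinates *)

Section Bisection.
Variable P : R -> R -> nat -> Prop.
Variables L M : R.
Hypothesis HL : 0 <= L.
Hypothesis HM : 0 <= M.
Hypothesis Pdec : forall a c n, {P a c n} + {~ P a c n}.
Hypothesis Psub : forall a c n,
  P a c (S n) -> P (a + L / 2 ^ S n) c (S n) ->
  P a (c + M / 2 ^ S n) (S n) -> P (a + L / 2 ^ S n) (c + M / 2 ^ S n) (S n) -> P a c n.

(** Moves to the first of the four children on which [P] fails. When three succeed the fourth is
    taken untested; [Psub] forces it to fail if the parent does. *)
Let step (n : nat) (x : R * R) : R * R :=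
  let (a, c) := x in
  if Pdec a c (S n) then
    if Pdec (a + L / 2 ^ S n) c (S n) then
      if Pdec a (c + M / 2 ^ S n) (S n) then (a + L / 2 ^ S n, c + M / 2 ^ S n)
      else (a, c + M / 2 ^ S n)
    else (a + L / 2 ^ S n, c)
  else (a, c).

Let cell (a c : R) (n : nat) : R * R := nat_rect (fun _ => (R * R)%type) (a, c) step n.

Lemma half_pow (X : R) (n : nat) : 0 <= X -> 0 <= X / 2 ^ S n /\ X / 2 ^ n = 2 * (X / 2 ^ S n).
Proof.
  intros HX. assert (0 < 2 ^ n) by (apply pow_lt; lra). split.
  - apply Rle_mult_inv_pos; [exact HX | simpl; lra].
  - simpl. field. lra.
Qed.

(* If [P] fails on a cell then it fails on a nested sequence of cells shrinking to a point. *)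
Lemma bisection (a c : R) :
  (forall s x, a <= s <= a + L -> c <= x <= c + M ->
     exists N, forall n a' c', (N <= n)%nat ->
       a <= a' -> a' <= s <= a' + L / 2 ^ n -> a' + L / 2 ^ n <= a + L ->
       c' <= x <= c' + M / 2 ^ n -> P a' c' n) ->
  P a c 0%nat.
Proof.
  intros Hloc. destruct (Pdec a c 0%nat) as [H|H]; [exact H|exfalso].
  set (u := fun n => fst (cell a c n)). set (v := fun n => snd (cell a c n)).
  assert (Hfail : forall n, ~ P (u n) (v n) n).
  { induction n as [|n IH]; [exact H|].
    unfold u, v in *; simpl. destruct (cell a c n) as [p q]; simpl in *.
    repeat destruct (Pdec _ _ _); simpl in *; auto. }
  assert (Hu : forall n, u n <= u (S n) /\ u (S n) + L / 2 ^ S n <= u n + L / 2 ^ n).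
  { intros n. destruct (half_pow L n HL) as [E1 E2]. rewrite E2.
    unfold u; simpl. simpl in E1. destruct (cell a c n) as [p q]; simpl.
    repeat destruct (Pdec _ _ _); simpl; lra. }
  assert (Hv : forall n, v n <= v (S n) /\ v (S n) + M / 2 ^ S n <= v n + M / 2 ^ n).
  { intros n. destruct (half_pow M n HM) as [E1 E2]. rewrite E2.
    unfold v; simpl. simpl in E1. destruct (cell a c n) as [p q]; simpl.
    repeat destruct (Pdec _ _ _); simpl; lra. }
  (* Nested intervals: every left end lies below every right end, so the supremum of the left ends
     belongs to all intervals. It is used once for each coordinate. *)
  assert (K : forall (X : R) (w : nat -> R), 0 <= X ->
    (forall n, w n <= w (S n) /\ w (S n) + X / 2 ^ S n <= w n + X / 2 ^ n) ->
    exists l, forall n, w n <= l <= w n + X / 2 ^ n).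
  { intros X w HX Hw.
    assert (Hinc : forall n k, w n <= w (n + k)%nat /\
              w (n + k)%nat + X / 2 ^ (n + k) <= w n + X / 2 ^ n).
    { intros n. induction k as [|k IH].
      - rewrite Nat.add_0_r. lra.
      - rewrite Nat.add_succ_r. specialize (Hw (n + k)%nat). lra. }
    assert (Hpos : forall n, 0 <= X / 2 ^ n).
    { intros n. apply Rle_mult_inv_pos; [exact HX | apply pow_lt; lra]. }
    assert (Hb : forall n m, w m <= w n + X / 2 ^ n).
    { intros n m. destruct (Nat.le_ge_cases n m) as [Hnm|Hnm].
      - replace m with (n + (m - n))%nat by lia.
        pose proof (Hinc n (m - n)%nat). pose proof (Hpos (n + (m - n))%nat). lra.
      - pose proof (Hinc m (n - m)%nat) as Q. replace (m + (n - m))%nat with n in Q by lia.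
        pose proof (Hpos n). lra. }
    destruct (completeness (fun y => exists n, y = w n)) as [l [Hl1 Hl2]].
    - exists (w 0%nat + X / 2 ^ 0). intros y [n ->]. apply Hb.
    - exists (w 0%nat). now exists 0%nat.
    - exists l. intros n. split.
      + apply Hl1. now exists n.
      + apply Hl2. intros y [m ->]. apply Hb. }
  destruct (K L u HL Hu) as [s Hs]. destruct (K M v HM Hv) as [x Hx].
  assert (U0 : forall n, a <= u n /\ u n + L / 2 ^ n <= a + L).
  { induction n as [|n IH].
    - unfold u; simpl. lra.
    - specialize (Hu n). lra. }
  destruct (Hloc s x) as [N HN].
  - specialize (Hs 0%nat). unfold u in Hs; simpl in Hs. lra.
  - specialize (Hx 0%nat). unfold v in Hx; simpl in Hx. lra.
  - apply (Hfail N). apply HN; auto; apply U0.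
Qed.
End Bisection.

(** * Integrals along the boundary of a polar rectangle *)

Definition radial (f : C -> C) (x a b : R) : C :=
  integral_C (fun s => f (s * cis x) * cis x)%C a b.
Definition arc (f : C -> C) (s c d : R) : C :=
  integral_C (fun x => f (s * cis x) * (Ci * (s * cis x)))%C c d.
(** The positively oriented boundary: outwards at angle [c], along the outer arc, back inwards at
    angle [d], back along the inner arc. *)
Definition sector (f : C -> C) (a b c d : R) : C :=
  (radial f c a b + arc f b c d - radial f d a b - arc f a c d)%C.

Lemma ccont_polar_radial (f : C -> C) (s x : R) :
  ccont (T := C_UniformSpace) f (s * cis x)%C -> ccont (fun s : R => f (s * cis x)%C) s.
Proof.
  intros H. apply (ccont_comp (U := C_UniformSpace) (fun s : R => s * cis x)%C f); [|exact H].
  apply (ccont_mult (fun s : R => RtoC s) (fun _ => cis x)); [|apply ccont_const].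
  apply ccont_RtoC, continuous_id.
Qed.

Lemma ccont_polar_arc (f : C -> C) (s x : R) :
  ccont (T := C_UniformSpace) f (s * cis x)%C -> ccont (fun x : R => f (s * cis x)%C) x.
Proof.
  intros H. apply (ccont_comp (U := C_UniformSpace) (fun x : R => s * cis x)%C f); [|exact H].
  apply (ccont_mult (fun _ => RtoC s) cis); [apply ccont_const | apply ccont_cis].
Qed.

Section Goursat.
Variable f : C -> C.
Variables A B : R.
Hypothesis HA : 0 <= A.
Hypothesis Hf : forall z, A <= Cmod z <= B -> ccont (T := C_UniformSpace) f z.

Lemma cint_radial (x a b : R) :
  A <= a <= B -> A <= b <= B -> cint (fun s => f (s * cis x) * cis x)%C a b.
Proof.
  intros Ha Hb. apply cint_cont. intros s Hs. apply ccont_mult; [|apply ccont_const].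
  assert (A <= s <= B) by (unfold Rmin, Rmax in Hs; destruct (Rle_dec a b); lra).
  apply ccont_polar_radial, Hf. rewrite Cmod_polar; lra.
Qed.

Lemma cint_arc (s c d : R) :
  A <= s <= B -> cint (fun x => f (s * cis x) * (Ci * (s * cis x)))%C c d.
Proof.
  intros Hs. apply cint_cont. intros x _. apply ccont_mult.
  - apply ccont_polar_arc, Hf. rewrite Cmod_polar; lra.
  - apply ccont_mult; [apply ccont_const|].
    apply ccont_mult; [apply ccont_const | apply ccont_cis].
Qed.

Lemma sector_split_radial (a m b c d : R) :
  A <= a <= B -> A <= m <= B -> A <= b <= B ->
  sector f a b c d = (sector f a m c d + sector f m b c d)%C.
Proof.
  intros Ha Hm Hb. unfold sector, radial.
  rewrite <- (integral_C_Chasles _ a m b (cint_radial c a m Ha Hm) (cint_radial c m b Hm Hb)).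
  rewrite <- (integral_C_Chasles _ a m b (cint_radial d a m Ha Hm) (cint_radial d m b Hm Hb)).
  ring.
Qed.

Lemma sector_split_arc (a b c m d : R) :
  A <= a <= B -> A <= b <= B ->
  sector f a b c d = (sector f a b c m + sector f a b m d)%C.
Proof.
  intros Ha Hb. unfold sector, arc.
  rewrite <- (integral_C_Chasles _ c m d (cint_arc a c m Ha) (cint_arc a m d Ha)).
  rewrite <- (integral_C_Chasles _ c m d (cint_arc b c m Hb) (cint_arc b m d Hb)).
  ring.
Qed.

Lemma Cmod_sector_le (a b c d K : R) :
  A <= a -> a <= b -> b <= B -> c <= d -> 0 <= K ->
  (forall s x, a <= s <= b -> c <= x <= d -> Cmod (f (s * cis x)) <= K) ->
  Cmod (sector f a b c d) <= 2 * ((b - a) + B * (d - c)) * K.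
Proof.
  intros Ha Hab Hb Hcd HK0 HK. unfold sector.
  assert (R1 : forall x, c <= x <= d -> Cmod (radial f x a b) <= (b - a) * K).
  { intros x Hx. apply Cmod_integral_C_le; [exact Hab | apply cint_radial; lra |].
    intros s Hs. rewrite Cmod_mult, Cmod_cis, Rmult_1_r. now apply HK. }
  assert (R2 : forall s, a <= s <= b -> Cmod (arc f s c d) <= (d - c) * (B * K)).
  { intros s Hs. apply Cmod_integral_C_le; [exact Hcd | apply cint_arc; lra |].
    intros x Hx. rewrite Cmod_mult, Cmod_mult, Cmod_Ci, Cmod_polar by lra.
    specialize (HK s x Hs Hx). pose proof (Cmod_ge_0 (f (s * cis x))). nra. }
  assert (Tr : forall u v : C, Cmod (u - v) <= Cmod u + Cmod v).
  { intros u v. unfold Cminus. rewrite <- (Cmod_opp v). apply Cmod_triangle. }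
  eapply Rle_trans; [apply Tr|].
  eapply Rle_trans; [apply Rplus_le_compat_r, Tr|].
  eapply Rle_trans; [apply Rplus_le_compat_r, Rplus_le_compat_r, Cmod_triangle|].
  pose proof (R1 c). pose proof (R1 d). pose proof (R2 a). pose proof (R2 b).
  lra.
Qed.

End Goursat.

Lemma sector_ext (f g : C -> C) (a b c d : R) :
  (forall z, f z = g z) -> sector f a b c d = sector g a b c d.
Proof.
  intros E. unfold sector, radial, arc.
  assert (E1 : forall x, integral_C (fun s => f (s * cis x) * cis x)%C a b =
                         integral_C (fun s => g (s * cis x) * cis x)%C a b).
  { intros x. apply integral_C_ext. intros; now rewrite E. }
  assert (E2 : forall s, integral_C (fun x => f (s * cis x) * (Ci * (s * cis x)))%C c d =
                         integral_C (fun x => g (s * cis x) * (Ci * (s * cis x)))%C c d).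
  { intros s. apply integral_C_ext. intros; now rewrite E. }
  now rewrite !E1, !E2.
Qed.

Lemma sector_plus (f g : C -> C) (A B a b c d : R) :
  0 <= A ->
  (forall z, A <= Cmod z <= B -> ccont (T := C_UniformSpace) f z) ->
  (forall z, A <= Cmod z <= B -> ccont (T := C_UniformSpace) g z) ->
  A <= a <= B -> A <= b <= B ->
  sector (fun z => f z + g z)%C a b c d = (sector f a b c d + sector g a b c d)%C.
Proof.
  intros HA Hf Hg Ha Hb. unfold sector, radial, arc.
  assert (E1 : forall x, integral_C (fun s => (f (s * cis x) + g (s * cis x)) * cis x)%C a b =
     (integral_C (fun s => f (s * cis x) * cis x) a b
      + integral_C (fun s => g (s * cis x) * cis x) a b)%C).
  { intros x. rewrite <- integral_C_plus by (apply (cint_radial _ A B); assumption).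
    apply integral_C_ext. intros; ring. }
  assert (E2 : forall s, A <= s <= B ->
     integral_C (fun x => (f (s * cis x) + g (s * cis x)) * (Ci * (s * cis x)))%C c d =
     (integral_C (fun x => f (s * cis x) * (Ci * (s * cis x))) c d
      + integral_C (fun x => g (s * cis x) * (Ci * (s * cis x))) c d)%C).
  { intros s Hs. rewrite <- integral_C_plus by (apply (cint_arc _ A B); assumption).
    apply integral_C_ext. intros; ring. }
  rewrite !E1, !E2 by assumption. ring.
Qed.

(** Every side contributes a difference of values of the primitive [P], and the values at the four
    corners cancel. *)
Lemma sector_affine (k l : C) (a b c d : R) :
  sector (fun z => k + l * z)%C a b c d = RtoC 0.
Proof.
  set (P := fun z : C => (k * z + l * (z * z) * / 2)%C).
  assert (E1 : forall x, radial (fun z => k + l * z)%C x a b = (P (b * cis x) - P (a * cis x))%C).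
  { intros x. unfold radial. apply (integral_C_FTC (fun s : R => P (s * cis x)%C)).
    - intros s _. unfold P, cis, Cinv, RtoC, Cmult, Cplus, Re, Im; simpl.
      split; auto_derive; trivial; field.
    - intros s _. apply ccont_mult; [|apply ccont_const].
      apply (ccont_polar_radial (fun z => k + l * z)%C).
      apply ccont_plus; [apply ccont_const|].
      apply ccont_mult; [apply ccont_const | apply ccont_id]. }
  assert (E2 : forall s, arc (fun z => k + l * z)%C s c d = (P (s * cis d) - P (s * cis c))%C).
  { intros s. unfold arc. apply (integral_C_FTC (fun x : R => P (s * cis x)%C)).
    - intros x _. unfold P, cis, Cinv, RtoC, Cmult, Cplus, Re, Im; simpl.
      split; auto_derive; trivial; field.
    - intros x _. apply ccont_mult.
      + apply (ccont_polar_arc (fun z => k + l * z)%C).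
        apply ccont_plus; [apply ccont_const|].
        apply ccont_mult; [apply ccont_const | apply ccont_id].
      + apply ccont_mult; [apply ccont_const|].
        apply ccont_mult; [apply ccont_const | apply ccont_cis]. }
  unfold sector. rewrite !E1, !E2. ring.
Qed.

(** Bisection in polar coordinates: differentiability at a point controls all small cells around it,
    [bisection] spreads the bound to the whole rectangle, and [eps] is arbitrary. The radius [A = 0]
    is allowed, since a degenerate inner arc does no harm. *)
Theorem goursat (f : C -> C) (A B c d : R) :
  0 <= A -> A <= B -> c <= d ->
  (forall z, A <= Cmod z <= B -> cdiff f z) -> sector f A B c d = RtoC 0.
Proof.
  intros HA HAB Hcd Hf.
  assert (Hc : forall z, A <= Cmod z <= B -> ccont (T := C_UniformSpace) f z).
  { intros z Hz. now apply cdiff_ccont, Hf. }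
  set (L := B - A). set (M := d - c).
  set (sigma := fun n : nat => L / 2 ^ n + B * (M / 2 ^ n)).
  assert (HL : 0 <= L) by (unfold L; lra). assert (HM : 0 <= M) by (unfold M; lra).
  assert (Main : forall eps, 0 < eps ->
    Cmod (sector f A B c d) <= 2 * eps * (L + B * M) ^ 2).
  { intros eps He.
    (* The threshold is quadratic in [sigma], which halves at each level, so four children give
       exactly the bound of their parent. The premises on [a] keep the cell inside the annulus. *)
    set (P := fun (a c : R) (n : nat) => A <= a -> a + L / 2 ^ n <= B ->
       Cmod (sector f a (a + L / 2 ^ n) c (c + M / 2 ^ n)) <= 2 * eps * sigma n ^ 2).
    assert (HP : P A c 0%nat).
    { apply (bisection P L M); try assumption.
      - intros a c' n. unfold P.
        destruct (Rle_dec A a); [|left; lra].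
        destruct (Rle_dec (a + L / 2 ^ n) B); [|left; lra].
        destruct (Rle_dec (Cmod (sector f a (a + L / 2 ^ n) c' (c' + M / 2 ^ n)))
                    (2 * eps * sigma n ^ 2)) as [H|H].
        + left; auto.
        + right; auto.
      - intros a c' n H1 H2 H3 H4 Ha Hb. unfold P in *.
        assert (Es : sigma n = 2 * sigma (S n)).
        { unfold sigma. destruct (half_pow L n HL) as [_ ->].
          destruct (half_pow M n HM) as [_ ->]. ring. }
        destruct (half_pow L n HL) as [Lp EL]. destruct (half_pow M n HM) as [Mp EM].
        set (l := L / 2 ^ S n) in *. set (m := M / 2 ^ S n) in *.
        rewrite Es. rewrite EL, EM in *.
        replace (a + 2 * l) with (a + l + l) in * by ring.
        replace (c' + 2 * m) with (c' + m + m) by ring.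
        rewrite (sector_split_radial f A B HA Hc a (a + l)) by lra.
        rewrite (sector_split_arc f A B HA Hc a (a + l) c' (c' + m)) by lra.
        rewrite (sector_split_arc f A B HA Hc (a + l) (a + l + l) c' (c' + m)) by lra.
        eapply Rle_trans; [apply Cmod_triangle|].
        eapply Rle_trans; [apply Rplus_le_compat; apply Cmod_triangle|].
        specialize (H1 ltac:(lra) ltac:(lra)). specialize (H2 ltac:(lra) ltac:(lra)).
        specialize (H3 ltac:(lra) ltac:(lra)). specialize (H4 ltac:(lra) ltac:(lra)).
        nra.
      - intros s x Hs Hx.
        destruct (Hf (s * cis x)%C) as [l Hl].
        { rewrite Cmod_polar; unfold L in Hs; lra. }
        destruct (Hl eps He) as (del & Hdel & K).
        assert (HX : 0 <= L + B * M) by nra.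
        (* [sigma n] equals [(L + B * M) / 2 ^ n]; adding 1 to the denominator covers a degenerate
           rectangle. *)
        destruct (pow_lt_1_zero (/ 2) ltac:(rewrite Rabs_pos_eq; lra)
                    (del / (L + B * M + 1))) as [N HN].
        { apply Rdiv_lt_0_compat; lra. }
        exists N. intros n a c' Hn Ha Hsa Hb Hxc. unfold P. intros _ HbB.
        assert (Hp : 0 < 2 ^ n) by (apply pow_lt; lra).
        assert (Hsig : sigma n < del).
        { specialize (HN n Hn). rewrite pow_inv, Rabs_pos_eq in HN
            by (left; now apply Rinv_0_lt_compat).
          apply Rlt_div_r in HN; [|lra].
          assert (0 < / 2 ^ n) by now apply Rinv_0_lt_compat.
          unfold sigma, Rdiv. nra. }
        set (sL := L / 2 ^ n) in *. set (sM := M / 2 ^ n) in *.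
        assert (P1 : 0 <= sL) by (apply Rle_mult_inv_pos; assumption).
        assert (P2 : 0 <= sM) by (apply Rle_mult_inv_pos; assumption).
        assert (P3 : 0 <= sigma n) by (unfold sigma; fold sL sM; nra).
        set (p := (s * cis x)%C) in *.
        (* Subtracting the affine Taylor polynomial at [p] does not change the boundary integral.
           What is left is at most [eps * sigma n] on the cell, whose perimeter is at most
           [2 * sigma n]. *)
        set (g := fun z => (f z - f p - l * (z - p))%C).
        assert (Cg : forall z, A <= Cmod z <= B -> ccont (T := C_UniformSpace) g z).
        { intros z Hz. unfold g. apply ccont_minus.
          - apply ccont_minus; [now apply Hc | apply ccont_const].
          - apply ccont_mult; [apply ccont_const|].
            apply ccont_minus; [apply ccont_id | apply ccont_const]. }
        assert (E : sector f a (a + sL) c' (c' + sM) = sector g a (a + sL) c' (c' + sM)).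
        { replace (sector g a (a + sL) c' (c' + sM)) with
           (sector g a (a + sL) c' (c' + sM)
            + sector (fun z => (f p - l * p) + l * z) a (a + sL) c' (c' + sM))%C
            by (rewrite sector_affine; ring).
          rewrite <- (sector_plus g _ A B) by
            (first [ lra | exact Cg | intros; apply ccont_plus; [apply ccont_const |
               apply ccont_mult; [apply ccont_const | apply ccont_id]]]).
          apply sector_ext. intros z. unfold g. ring. }
        rewrite E.
        replace (2 * eps * sigma n ^ 2)
          with (2 * ((a + sL - a) + B * (c' + sM - c')) * (eps * sigma n))
          by (unfold sigma; fold sL sM; ring).
        apply (Cmod_sector_le g A B HA Cg); try lra.
        + apply Rmult_le_pos; lra.
        + intros s' x' Hs' Hx'.
          assert (Hd : Cmod (s' * cis x' - p) <= sigma n).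
          { eapply Rle_trans; [apply (Cmod_polar_minus s' x' s x B)|].
            - rewrite Rabs_pos_eq; lra.
            - unfold sigma. fold sL sM. apply Rplus_le_compat.
              + apply Rabs_le; lra.
              + apply Rmult_le_compat_l; [lra|]. apply Rabs_le; lra. }
          eapply Rle_trans; [apply K; lra|]. apply Rmult_le_compat_l; lra. }
    unfold P in HP. simpl in HP. unfold sigma in HP. simpl in HP.
    rewrite !Rdiv_1_r in HP.
    replace (A + L) with B in HP by (unfold L; ring).
    replace (c + M) with d in HP by (unfold M; ring).
    simpl. apply HP; lra. }
  apply Cmod_eq_0.
  destruct (Rle_lt_or_eq_dec 0 (Cmod (sector f A B c d)) (Cmod_ge_0 _)) as [H|H]; [exfalso|auto].
  set (X := Cmod (sector f A B c d)) in *. set (Y := (L + B * M) ^ 2) in *.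
  assert (0 <= Y) by (apply pow2_ge_0).
  specialize (Main (X / (4 * (Y + 1))) ltac:(apply Rdiv_lt_0_compat; lra)).
  assert (2 * (X / (4 * (Y + 1))) * Y < X); [|lra].
  replace (2 * (X / (4 * (Y + 1))) * Y) with (X * (Y / (2 * (Y + 1)))) by (field; lra).
  assert (Y / (2 * (Y + 1)) < 1); [|nra].
  apply Rlt_div_l; lra.
Qed.

(** * Circle integrals *)

Definition circle_cont (f : C -> C) (s : R) : Prop :=
  forall z, Cmod z = s -> ccont (T := C_UniformSpace) f z.

Lemma Cmod_minus_ge (a b : C) : Cmod a - Cmod b <= Cmod (a - b).
Proof.
  pose proof (Cmod_triangle (a - b) b) as H. replace (a - b + b)%C with a in H by ring. lra.
Qed.

Lemma Cmod_minus_sym (a b : C) : Cmod (a - b) = Cmod (b - a).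
Proof. replace (a - b)%C with (- (b - a))%C by ring. apply Cmod_opp. Qed.

Lemma Cmod_minus_le (a b : C) : Cmod (a - b) <= Cmod a + Cmod b.
Proof. unfold Cminus. rewrite <- (Cmod_opp b). apply Cmod_triangle. Qed.

Lemma Cminus_neq_0 (a b : C) : a <> b -> (a - b)%C <> RtoC 0.
Proof. intros H E. apply H. replace a with (a - b + b)%C by ring. rewrite E. ring. Qed.

Lemma Cminus_neq_0_Cmod (a b : C) : Cmod a <> Cmod b -> (a - b)%C <> RtoC 0.
Proof. intros H. apply Cminus_neq_0. intros ->. now apply H. Qed.

Lemma cint_circle (f : C -> C) (s : R) : 0 <= s -> circle_cont f s ->
  cint (fun x => f (s * cis x) * (Ci * (s * cis x)))%C 0 (2 * PI).
Proof.
  intros Hs Hf. apply (cint_arc f s s); try lra.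
  intros z Hz. apply Hf. lra.
Qed.

Lemma contour_ext (f g : C -> C) (s : R) :
  0 <= s -> (forall z, Cmod z = s -> f z = g z) -> contour_circle s f = contour_circle s g.
Proof.
  intros Hs E. unfold contour_circle. apply integral_C_ext. intros x _. simpl.
  rewrite E; [reflexivity|].
  now apply Cmod_polar.
Qed.

Lemma contour_plus (f g : C -> C) (s : R) :
  0 <= s -> circle_cont f s -> circle_cont g s ->
  contour_circle s (fun z => f z + g z)%C = (contour_circle s f + contour_circle s g)%C.
Proof.
  intros Hs Hf Hg. unfold contour_circle.
  rewrite <- integral_C_plus by now apply cint_circle.
  apply integral_C_ext. intros; simpl; ring.
Qed.

Lemma contour_scal (c : C) (f : C -> C) (s : R) :
  0 <= s -> circle_cont f s ->
  contour_circle s (fun z => c * f z)%C = (c * contour_circle s f)%C.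
Proof.
  intros Hs Hf. unfold contour_circle.
  rewrite <- integral_C_scal by now apply cint_circle.
  apply integral_C_ext. intros; simpl; ring.
Qed.

Lemma contour_minus (f g : C -> C) (s : R) :
  0 <= s -> circle_cont f s -> circle_cont g s ->
  contour_circle s (fun z => f z - g z)%C = (contour_circle s f - contour_circle s g)%C.
Proof.
  intros Hs Hf Hg.
  rewrite (contour_ext _ (fun z => f z + RtoC (-1) * g z)%C) by (intros; trivial; ring).
  rewrite contour_plus, contour_scal; trivial.
  - ring.
  - intros z Hz. apply ccont_mult; [apply ccont_const | now apply Hg].
Qed.

Lemma Cmod_contour_le (f : C -> C) (s M : R) :
  0 <= s -> circle_cont f s -> (forall z, Cmod z = s -> Cmod (f z) <= M) ->
  Cmod (contour_circle s f) <= 2 * PI * (s * M).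
Proof.
  intros Hs Hf HM. pose proof PI_RGT_0.
  replace (2 * PI * (s * M)) with ((2 * PI - 0) * (s * M)) by ring.
  unfold contour_circle. apply Cmod_integral_C_le; [lra | now apply cint_circle|].
  intros x _. simpl. rewrite !Cmod_mult, Cmod_Ci, Cmod_cis, Cmod_R, Rabs_pos_eq by lra.
  specialize (HM (s * cis x)%C (Cmod_polar s x Hs)).
  pose proof (Cmod_ge_0 (f (s * cis x)%C)). nra.
Qed.

Lemma circle_bounded (f : C -> C) (s : R) :
  0 <= s -> circle_cont f s -> exists M, 0 <= M /\ forall z, Cmod z = s -> Cmod (f z) <= M.
Proof.
  intros Hs Hf. pose proof PI_RGT_0.
  destruct (continuity_ab_maj (fun x => Cmod (f (s * cis x)%C)) 0 (2 * PI)) as [x0 [Hx0 _]].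
  - lra.
  - intros x _. apply continuity_pt_filterlim. apply (rcont_Cmod (fun x => f (s * cis x)%C)).
    apply ccont_polar_arc, Hf. now apply Cmod_polar.
  - exists (Cmod (f (s * cis x0)%C)). split; [apply Cmod_ge_0|]. intros z Hz.
    destruct (polar_form z) as (x & Hx & ->). rewrite Hz. now apply Hx0.
Qed.

(** For a full turn the two radial sides coincide and cancel, as [cis (2 * PI) = cis 0]; only the
    two circles remain. *)
Lemma cauchy_annulus (f : C -> C) (A B : R) :
  0 <= A -> A <= B -> (forall z, A <= Cmod z <= B -> cdiff f z) ->
  contour_circle A f = contour_circle B f.
Proof.
  intros HA HAB Hf. pose proof PI_RGT_0.
  assert (H0 := goursat f A B 0 (2 * PI) HA HAB ltac:(lra) Hf).
  unfold sector in H0.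
  replace (radial f (2 * PI) A B) with (radial f 0 A B) in H0
    by (unfold radial; now rewrite cis_2PI).
  change (arc f B 0 (2 * PI)) with (contour_circle B f) in H0.
  change (arc f A 0 (2 * PI)) with (contour_circle A f) in H0.
  replace (contour_circle B f) with (contour_circle A f +
    (radial f 0 A B + contour_circle B f - radial f 0 A B - contour_circle A f))%C by ring.
  rewrite H0. ring.
Qed.

Lemma contour_radius_0 (f : C -> C) : contour_circle 0 f = RtoC 0.
Proof.
  unfold contour_circle.
  rewrite (integral_C_ext _ (fun x => RtoC 0 * (RtoC 0))%C) by (intros; simpl; ring).
  rewrite integral_C_scal; [ring|]. apply cint_cont. intros; apply ccont_const.
Qed.

(** The disc is an annulus whose inner circle has radius 0 and carries no integral. *)
Lemma cauchy_disc (f : C -> C) (B : R) :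
  0 <= B -> (forall z, Cmod z <= B -> cdiff f z) -> contour_circle B f = RtoC 0.
Proof.
  intros HB Hf. rewrite <- (cauchy_annulus f 0 B); [apply contour_radius_0|lra|exact HB|].
  intros z Hz. apply Hf, Hz.
Qed.

(** * Cauchy's theorem at infinity and at the centre *)

Definition vanishes_infty (f : C -> C) : Prop :=
  forall eps, 0 < eps -> exists R0, forall z, R0 <= Cmod z -> Cmod (f z) <= eps.

Lemma Rle_0_of_eps (x K : R) : 0 <= K -> (forall eps, 0 < eps -> x <= K * eps) -> x <= 0.
Proof.
  intros HK H. destruct (Rle_lt_dec x 0) as [Hx|Hx]; [exact Hx|exfalso].
  specialize (H (x / (2 * (K + 1))) ltac:(apply Rdiv_lt_0_compat; lra)).
  assert (K * (x / (2 * (K + 1))) < x); [|lra].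
  replace (K * (x / (2 * (K + 1)))) with (x * (K / (2 * (K + 1)))) by (field; lra).
  assert (K / (2 * (K + 1)) < 1); [|nra].
  apply Rlt_div_l; lra.
Qed.

Lemma C0_of_eps (x : C) (K : R) :
  0 <= K -> (forall eps, 0 < eps -> Cmod x <= K * eps) -> x = RtoC 0.
Proof.
  intros HK H. apply Cmod_eq_0. pose proof (Cmod_ge_0 x). pose proof (Rle_0_of_eps _ K HK H). lra.
Qed.

(** The contour is pushed to a large circle, where decay faster than [1 / |z|] beats the growing
    length. *)
Lemma cauchy_exterior (f : C -> C) (B : R) :
  0 <= B -> (forall z, B <= Cmod z -> cdiff f z) -> vanishes_infty (fun z => f z * z)%C ->
  contour_circle B f = RtoC 0.
Proof.
  intros HB Hf Hv. pose proof PI_RGT_0. apply (C0_of_eps _ (2 * PI)); [lra|].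
  intros eps He. destruct (Hv eps He) as [R0 HR].
  set (R1 := Rmax (Rmax R0 B) 1).
  assert (R0 <= R1) by (unfold R1; eapply Rle_trans; [apply Rmax_l|]; apply Rmax_l).
  assert (B <= R1) by (unfold R1; eapply Rle_trans; [apply Rmax_r|]; apply Rmax_l).
  assert (1 <= R1) by (apply Rmax_r).
  rewrite (cauchy_annulus f B R1); try assumption; [|intros; now apply Hf].
  replace eps with (R1 * (eps / R1)) by (field; lra).
  apply Cmod_contour_le; [lra| |].
  - intros z Hz. apply cdiff_ccont, Hf. lra.
  - intros z Hz. specialize (HR z ltac:(lra)). rewrite Cmod_mult, Hz in HR.
    apply Rle_div_r; lra.
Qed.

Lemma contour_Cinv (s : R) : 0 < s -> contour_circle s Cinv = (2 * PI * Ci)%C.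
Proof.
  intros Hs. unfold contour_circle.
  rewrite (integral_C_ext _ (fun x => Ci)%C).
  - rewrite (integral_C_FTC (fun x => x * Ci)%C).
    + ring_simplify. rewrite RtoC_mult. ring.
    + intros x _. unfold RtoC, Ci, Cmult, Re, Im; simpl. split; auto_derive; trivial; ring.
    + intros; apply ccont_const.
  - intros x _. simpl. field. split; [apply cis_neq_0|].
    apply Cmod_gt_0. rewrite Cmod_R, Rabs_pos_eq; lra.
Qed.

(** The centre is out of reach of the annulus formula below, which wants a circle of smaller radius
    than [|p|]. Here the circle shrinks to 0, where continuity makes the numerator [f t - f 0] small
    while the length cancels [1 / |t|]. *)
Lemma cauchy_mean_value (f : C -> C) (B : R) :
  0 < B -> (forall z, Cmod z <= B -> cdiff f z) ->
  contour_circle B (fun t => f t / t)%C = (2 * PI * Ci * f 0)%C.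
Proof.
  intros HB Hf. pose proof PI_RGT_0.
  assert (Hd : forall z, 0 < Cmod z <= B -> cdiff (fun t => (f t - f 0) / t)%C z).
  { intros z Hz. apply cdiff_div.
    - apply cdiff_minus; [apply Hf; lra | apply cdiff_const].
    - apply cdiff_id.
    - apply Cmod_gt_0; lra. }
  assert (H0 : contour_circle B (fun t => (f t - f 0) / t)%C = RtoC 0).
  { apply (C0_of_eps _ (2 * PI)); [lra|]. intros eps He.
    assert (C0 : ccont (T := C_UniformSpace) f (RtoC 0)).
    { apply cdiff_ccont, Hf. rewrite Cmod_0; lra. }
    rewrite ccont_eps in C0. destruct (C0 eps He) as (d & Hd0 & K).
    set (s := Rmin (d / 2) B). assert (Hs : 0 < s) by (apply Rmin_pos; lra).
    assert (s <= d / 2) by apply Rmin_l. assert (s <= B) by apply Rmin_r.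
    rewrite <- (cauchy_annulus _ s B); [|lra|lra|intros z Hz; apply Hd; lra].
    replace eps with (s * (eps / s)) by (field; lra).
    apply Cmod_contour_le; [lra| |].
    - intros z Hz. apply cdiff_ccont, Hd; lra.
    - intros z Hz. rewrite Cmod_div, Hz by (apply Cmod_gt_0; lra).
      apply Rmult_le_compat_r; [left; now apply Rinv_0_lt_compat|].
      left. apply K. replace (z - 0)%C with z by ring. lra. }
  rewrite (contour_ext _ (fun t => (f t - f 0) / t + f 0 * / t)%C); [|lra|].
  - rewrite contour_plus, contour_scal, H0.
    + change (contour_circle B (fun z => / z)%C) with (contour_circle B Cinv).
      rewrite contour_Cinv by exact HB. ring.
    + lra.
    + intros z Hz. apply ccont_inv; [apply ccont_id | apply Cmod_gt_0; lra].
    + lra.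
    + intros z Hz. apply cdiff_ccont, Hd; lra.
    + intros z Hz. apply ccont_mult; [apply ccont_const|].
      apply ccont_inv; [apply ccont_id | apply Cmod_gt_0; lra].
  - intros z Hz. field. apply Cmod_gt_0; lra.
Qed.

(** Splitting [1 / (t - p) = 1 / t + p / (t (t - p))] leaves the integral of [1 / t] and a term of
    order [t^(-2)], holomorphic outside the circle, which [cauchy_exterior] removes. *)
Lemma contour_kernel_inside (p : C) (B : R) :
  Cmod p < B -> contour_circle B (fun t => / (t - p))%C = (2 * PI * Ci)%C.
Proof.
  intros Hp. pose proof (Cmod_ge_0 p) as Hp0.
  assert (Hne : forall z, B <= Cmod z -> (z - p)%C <> RtoC 0)
    by (intros z Hz; apply Cminus_neq_0_Cmod; lra).
  assert (Hz0 : forall z, B <= Cmod z -> z <> RtoC 0) by (intros z Hz; apply Cmod_gt_0; lra).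
  assert (Hd : forall z, B <= Cmod z -> cdiff (fun t => p / (t * (t - p)))%C z).
  { intros z Hz. apply cdiff_div.
    - apply cdiff_const.
    - apply cdiff_mult; [apply cdiff_id|]. apply cdiff_minus; [apply cdiff_id | apply cdiff_const].
    - apply Cmult_neq_0; auto. }
  assert (H0 : contour_circle B (fun t => p / (t * (t - p)))%C = RtoC 0).
  { apply cauchy_exterior; [lra | exact Hd |]. intros eps He.
    exists (Rmax B (Cmod p + Cmod p / eps)). intros z Hz.
    assert (Z1 : B <= Cmod z) by (eapply Rle_trans; [apply Rmax_l | exact Hz]).
    assert (Z2 : Cmod p + Cmod p / eps <= Cmod z) by (eapply Rle_trans; [apply Rmax_r | exact Hz]).
    replace (p / (z * (z - p)) * z)%C with (p / (z - p))%C by (field; auto).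
    rewrite Cmod_div by auto. pose proof (Cmod_minus_ge z p).
    apply Rle_div_l; [lra|].
    apply Rle_trans with (eps * (Cmod p / eps)).
    - right. field. lra.
    - apply Rmult_le_compat_l; lra. }
  rewrite (contour_ext _ (fun t => / t + p / (t * (t - p)))%C).
  - rewrite contour_plus, H0.
    + change (contour_circle B (fun z => / z)%C) with (contour_circle B Cinv).
      rewrite contour_Cinv by lra. ring.
    + lra.
    + intros z Hz. apply ccont_inv; [apply ccont_id | apply Hz0; lra].
    + intros z Hz. apply cdiff_ccont, Hd; lra.
  - lra.
  - intros z Hz. field. split; [apply Hne | apply Hz0]; lra.
Qed.

Lemma contour_kernel_outside (p : C) (A : R) :
  0 <= A -> A < Cmod p -> contour_circle A (fun t => / (t - p))%C = RtoC 0.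
Proof.
  intros HA Hp. apply cauchy_disc; [exact HA|]. intros z Hz. apply cdiff_inv.
  - apply cdiff_minus; [apply cdiff_id | apply cdiff_const].
  - apply Cminus_neq_0_Cmod; lra.
Qed.

(** * Cauchy's integral formula in an annulus *)

(** Uniform continuity of the integrand on the compact rectangle of radii and angles. The lemma
    serves to step across the one circle on which an exceptional point lies. *)
Lemma contour_continuous (g : C -> C) (A B s : R) :
  0 <= A -> A < s < B ->
  (forall z, A <= Cmod z <= B -> ccont (T := C_UniformSpace) g z) ->
  forall eps, 0 < eps -> exists d, 0 < d /\
    forall u, A <= u <= B -> Rabs (u - s) < d ->
      Cmod (contour_circle u g - contour_circle s g) <= 2 * PI * eps.
Proof.
  intros HA Hs Hg eps He. pose proof PI_RGT_0.
  set (h := fun u x : R => (g (u * cis x) * (Ci * (u * cis x)))%C).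
  assert (Hh : forall u x, A <= u <= B ->
     ccont (T := prod_UniformSpace R_UniformSpace R_UniformSpace)
       (fun z => h (fst z) (snd z)) (u, x)).
  { intros u x Hu. unfold h.
    assert (Cp : ccont (T := prod_UniformSpace R_UniformSpace R_UniformSpace)
              (fun z => fst z * cis (snd z))%C (u, x)).
    { apply ccont_mult.
      - apply (ccont_RtoC (T := prod_UniformSpace R_UniformSpace R_UniformSpace)).
        apply continuous_fst.
      - apply (ccont_comp (T := prod_UniformSpace R_UniformSpace R_UniformSpace) snd cis).
        + apply continuous_snd.
        + apply ccont_cis. }
    apply ccont_mult.
    - apply (ccont_comp (T := prod_UniformSpace R_UniformSpace R_UniformSpace)
               (U := C_UniformSpace) (fun z => fst z * cis (snd z))%C g); [exact Cp|].
      apply Hg. simpl. rewrite Cmod_polar; lra.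
    - apply ccont_mult; [apply ccont_const | exact Cp]. }
  assert (He2 : 0 < eps / 2) by lra.
  destruct (uniform_continuity_2d (fun u x => Re (h u x)) A B 0 (2 * PI)) with
    (eps := mkposreal _ He2) as [d1 K1].
  { intros u x Hu _. apply continuity_2d_pt_filterlim. apply (ccont_Re _ _ (Hh u x Hu)). }
  destruct (uniform_continuity_2d (fun u x => Im (h u x)) A B 0 (2 * PI)) with
    (eps := mkposreal _ He2) as [d2 K2].
  { intros u x Hu _. apply continuity_2d_pt_filterlim. apply (ccont_Im _ _ (Hh u x Hu)). }
  pose proof (cond_pos d1). pose proof (cond_pos d2).
  exists (Rmin d1 d2). split; [now apply Rmin_pos|]. intros u Hu Hus.
  assert (U1 := Rlt_le_trans _ _ _ Hus (Rmin_l _ _)).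
  assert (U2 := Rlt_le_trans _ _ _ Hus (Rmin_r _ _)).
  assert (I1 : forall v, A <= v <= B -> cint (h v) 0 (2 * PI)).
  { intros v Hv. unfold h. now apply (cint_arc g A B). }
  change (contour_circle u g) with (integral_C (h u) 0 (2 * PI)).
  change (contour_circle s g) with (integral_C (h s) 0 (2 * PI)).
  replace (integral_C (h u) 0 (2 * PI) - integral_C (h s) 0 (2 * PI))%C
    with (integral_C (fun x => h u x + RtoC (-1) * h s x)%C 0 (2 * PI)).
  - replace (2 * PI * eps) with ((2 * PI - 0) * eps) by ring.
    apply Cmod_integral_C_le; [lra| |].
    + apply (ex_RInt_plus (V := C_R_NormedModule)); [apply I1; lra|].
      apply cint_scal, I1; lra.
    + intros x Hx.
      specialize (K1 s x u x ltac:(lra) Hx Hu Hx U1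
                    ltac:(rewrite Rminus_diag, Rabs_R0; apply cond_pos)).
      specialize (K2 s x u x ltac:(lra) Hx Hu Hx U2
                    ltac:(rewrite Rminus_diag, Rabs_R0; apply cond_pos)).
      replace (h u x + RtoC (-1) * h s x)%C with (h u x - h s x)%C by ring.
      change (Rabs (Re (h u x) - Re (h s x)) < eps / 2) in K1.
      change (Rabs (Im (h u x) - Im (h s x)) < eps / 2) in K2.
      assert (E : (h u x - h s x)%C = (RtoC (Re (h u x) - Re (h s x))
                     + Ci * RtoC (Im (h u x) - Im (h s x)))%C).
      { destruct (h u x), (h s x). unfold RtoC, Ci, Cminus, Cplus, Cmult, Copp, Re, Im; simpl.
        f_equal; ring. }
      rewrite E. eapply Rle_trans; [apply Cmod_triangle|].
      rewrite Cmod_mult, Cmod_Ci, !Cmod_R. lra.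
  - rewrite integral_C_plus, integral_C_scal.
    + ring.
    + apply I1; lra.
    + apply I1; lra.
    + apply cint_scal, I1; lra.
Qed.

(** No small circle around [p] is needed: the contours move from both sides to circles just inside
    and just outside [|z| = |p|], and the two integrals differ little because [g] is continuous
    across. *)
Lemma cauchy_annulus_except (g : C -> C) (A B : R) (p : C) :
  0 <= A -> A < Cmod p < B ->
  (forall z, A <= Cmod z <= B -> ccont (T := C_UniformSpace) g z) ->
  (forall z, A <= Cmod z <= B -> z <> p -> cdiff g z) ->
  contour_circle A g = contour_circle B g.
Proof.
  intros HA Hp Hc Hd. pose proof PI_RGT_0.
  assert (E : (contour_circle A g - contour_circle B g)%C = RtoC 0).
  { apply (C0_of_eps _ (2 * (2 * PI))); [lra|]. intros eps He.
    destruct (contour_continuous g A B (Cmod p) HA Hp Hc eps He) as (d & Hd0 & K).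
    set (u := Rmax A (Cmod p - d / 2)). set (v := Rmin B (Cmod p + d / 2)).
    assert (Hu : A <= u < Cmod p /\ Rabs (u - Cmod p) < d).
    { unfold u, Rmax. destruct (Rle_dec A (Cmod p - d / 2));
      (split; [lra|]; apply Rabs_def1; lra). }
    assert (Hv : Cmod p < v <= B /\ Rabs (v - Cmod p) < d).
    { unfold v, Rmin. destruct (Rle_dec B (Cmod p + d / 2));
      (split; [lra|]; apply Rabs_def1; lra). }
    rewrite (cauchy_annulus g A u); [|lra|lra|].
    2:{ intros z Hz. apply Hd; [lra|]. intros ->. lra. }
    rewrite <- (cauchy_annulus g v B); [|lra|lra|].
    2:{ intros z Hz. apply Hd; [lra|]. intros ->. lra. }
    assert (K1 := K u ltac:(lra) (proj2 Hu)). assert (K2 := K v ltac:(lra) (proj2 Hv)).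
    replace (contour_circle u g - contour_circle v g)%C with
      ((contour_circle u g - contour_circle (Cmod p) g)
       - (contour_circle v g - contour_circle (Cmod p) g))%C by ring.
    eapply Rle_trans; [apply Cmod_minus_le|]. lra. }
  replace (contour_circle A g) with
    ((contour_circle A g - contour_circle B g) + contour_circle B g)%C by ring.
  rewrite E. ring.
Qed.

(** The difference quotient at [p], completed by the derivative, is continuous at [p] and
    holomorphic elsewhere, so its integrals over both circles agree. The formula is then the
    difference of the two kernel integrals, [2 PI i] and 0. *)
Theorem cauchy_formula_annulus (f : C -> C) (A B : R) (p : C) :
  0 <= A -> A < Cmod p < B -> (forall z, A <= Cmod z <= B -> cdiff f z) ->
  (contour_circle B (fun t => f t / (t - p)) - contour_circle A (fun t => f t / (t - p)))%C
  = (2 * PI * Ci * f p)%C.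
Proof.
  intros HA Hp Hf.
  destruct (Hf p ltac:(lra)) as [l Hl].
  set (g := fun t => if Ceq_dec t p then l else ((f t - f p) / (t - p))%C).
  assert (Hd : forall z, A <= Cmod z <= B -> z <> p -> cdiff g z).
  { intros z Hz Hzp.
    apply (cdiff_ext_loc (fun t => (f t - f p) / (t - p))%C g z (Cmod (z - p))).
    - apply Cmod_gt_0. now apply Cminus_neq_0.
    - intros y Hy. unfold g. destruct (Ceq_dec y p) as [->|]; [|reflexivity].
      rewrite Cmod_minus_sym in Hy. lra.
    - apply cdiff_div.
      + apply cdiff_minus; [now apply Hf | apply cdiff_const].
      + apply cdiff_minus; [apply cdiff_id | apply cdiff_const].
      + now apply Cminus_neq_0. }
  assert (Hc : forall z, A <= Cmod z <= B -> ccont (T := C_UniformSpace) g z).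
  { intros z Hz. destruct (Ceq_dec z p) as [->|Hzp]; [|now apply cdiff_ccont, Hd].
    apply ccont_eps. intros eps He. destruct (Hl (eps / 2) ltac:(lra)) as (d & Hd0 & K).
    exists d. split; [exact Hd0|]. intros y Hy. unfold g.
    destruct (Ceq_dec p p) as [_|]; [|congruence].
    destruct (Ceq_dec y p) as [->|Hyp].
    - replace (l - l)%C with (RtoC 0) by ring. now rewrite Cmod_0.
    - assert (Hn := Cminus_neq_0 _ _ Hyp). assert (P := proj1 (Cmod_gt_0 _) Hn).
      replace ((f y - f p) / (y - p) - l)%C with ((f y - f p - l * (y - p)) / (y - p))%C
        by (field; exact Hn).
      rewrite Cmod_div by exact Hn. apply Rlt_div_l; [exact P|].
      specialize (K y Hy). nra. }
  assert (E := cauchy_annulus_except g A B p HA Hp Hc Hd).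
  assert (Hk : forall s, A <= s <= B -> s <> Cmod p ->
     contour_circle s (fun t => f t / (t - p))%C
     = (contour_circle s g + f p * contour_circle s (fun t => / (t - p)))%C).
  { intros s Hs Hsp.
    assert (Ck : circle_cont (fun t => / (t - p))%C s).
    { intros z Hz. apply ccont_inv.
      - apply ccont_minus; [apply ccont_id | apply ccont_const].
      - apply Cminus_neq_0_Cmod. lra. }
    rewrite <- contour_scal by (trivial; lra).
    rewrite <- contour_plus; [| lra | |].
    - apply contour_ext; [lra|]. intros z Hz. unfold g.
      destruct (Ceq_dec z p) as [->|Hzp]; [lra|]. field. now apply Cminus_neq_0.
    - intros z Hz. apply Hc. lra.
    - intros z Hz. apply ccont_mult; [apply ccont_const | now apply Ck]. }
  rewrite !Hk by lra. rewrite E, contour_kernel_inside, contour_kernel_outside by lra. ring.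
Qed.

Lemma circle_cont_kernel (z : C) (s : R) : Cmod z <> s -> circle_cont (fun t => / (t - z))%C s.
Proof.
  intros Hz t Ht. apply ccont_inv.
  - apply ccont_minus; [apply ccont_id | apply ccont_const].
  - apply Cminus_neq_0_Cmod. lra.
Qed.

Lemma circle_cont_mult (f g : C -> C) (s : R) :
  circle_cont f s -> circle_cont g s -> circle_cont (fun t => f t * g t)%C s.
Proof. intros Hf Hg t Ht. apply ccont_mult; auto. Qed.

Lemma circle_cont_scal (c : C) (f : C -> C) (s : R) :
  circle_cont f s -> circle_cont (fun t => c * f t)%C s.
Proof. intros Hf t Ht. apply ccont_mult; [apply ccont_const | auto]. Qed.

(** * Cauchy transforms of continuous functions on a circle *)

(** The customary factor [1 / (2 PI i)] is left out; it is absorbed into the constants of the two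
    operators. *)
Definition cauchy_transform (s : R) (f : C -> C) (z : C) : C :=
  contour_circle s (fun t => f t / (t - z))%C.

Lemma circle_cont_cauchy (f : C -> C) (z : C) (s : R) :
  circle_cont f s -> Cmod z <> s -> circle_cont (fun t => f t / (t - z))%C s.
Proof. intros Hf Hz. apply circle_cont_mult; [exact Hf | now apply circle_cont_kernel]. Qed.

Lemma Cmod_minus_dist (t z : C) : Rabs (Cmod t - Cmod z) <= Cmod (t - z).
Proof.
  apply Rabs_le. pose proof (Cmod_minus_ge t z). pose proof (Cmod_minus_ge z t).
  rewrite (Cmod_minus_sym z t) in *. lra.
Qed.

Lemma Cmod_cauchy_transform_le (f : C -> C) (s M d : R) (z : C) :
  0 <= s -> circle_cont f s -> (forall t, Cmod t = s -> Cmod (f t) <= M) ->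
  0 < d <= Rabs (s - Cmod z) -> Cmod (cauchy_transform s f z) <= 2 * PI * (s * (M / d)).
Proof.
  intros Hs Hf HM Hd.
  assert (Hz : Cmod z <> s) by (intros E; rewrite E, Rminus_diag, Rabs_R0 in Hd; lra).
  apply Cmod_contour_le; [exact Hs | now apply circle_cont_cauchy |].
  intros t Ht. rewrite Cmod_div by (apply Cminus_neq_0_Cmod; lra).
  pose proof (Cmod_minus_dist t z) as D. rewrite Ht in D.
  apply Rmult_le_compat; [apply Cmod_ge_0 | left; apply Rinv_0_lt_compat; lra | now apply HM |].
  apply Rinv_le_contravar; lra.
Qed.

(** Differentiation under the integral for a merely continuous density, made explicit: the remainder
    of the kernel is [(y - z)^2 / ((t - y) (t - z)^2)], bounded through [|t - y| >= d / 2] and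
    [|t - z| >= d]. The constant [K] collects these bounds. *)
Lemma cdiff_cauchy_transform (f : C -> C) (s : R) (z : C) :
  0 <= s -> circle_cont f s -> Cmod z <> s -> cdiff (cauchy_transform s f) z.
Proof.
  intros Hs Hf Hz. pose proof PI_RGT_0.
  destruct (circle_bounded f s Hs Hf) as (M & HM0 & HM).
  set (d := Rabs (s - Cmod z)).
  assert (Hd : 0 < d) by (apply Rabs_pos_lt; lra).
  set (k := fun t => (/ (t - z) * / (t - z))%C).
  exists (contour_circle s (fun t => f t * k t)%C). intros eps He.
  set (K := 2 * PI * (s * (M * (2 / d * (/ d * / d))))).
  assert (Hid : 0 < / d) by now apply Rinv_0_lt_compat.
  assert (HK : 0 <= K).
  { unfold K, Rdiv. repeat (apply Rmult_le_pos; try lra). }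
  assert (Hp : 0 < eps / (K + 1)) by (apply Rdiv_lt_0_compat; lra).
  exists (Rmin (d / 2) (eps / (K + 1))). split; [apply Rmin_pos; lra|].
  intros y Hy.
  assert (Y1 := Rlt_le_trans _ _ _ Hy (Rmin_l _ _)).
  assert (Y2 := Rlt_le_trans _ _ _ Hy (Rmin_r _ _)).
  assert (Ty : forall t, Cmod t = s -> d / 2 <= Cmod (t - y) /\ d <= Cmod (t - z)).
  { intros t Ht. pose proof (Cmod_minus_dist t z) as D. rewrite Ht in D. fold d in D.
    split; [|exact D].
    pose proof (Cmod_triangle (t - y) (y - z)) as D2.
    replace (t - y + (y - z))%C with (t - z)%C in D2 by ring. lra. }
  assert (Nz : forall t x, 0 < Cmod (t - x) -> (t - x)%C <> RtoC 0)
    by (intros; now apply Cmod_gt_0).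
  assert (Cy : circle_cont (fun t => / (t - y))%C s).
  { intros t Ht. apply ccont_inv.
    - apply ccont_minus; [apply ccont_id | apply ccont_const].
    - apply Nz. pose proof (Ty t Ht). lra. }
  assert (Cz := circle_cont_kernel z s Hz).
  unfold cauchy_transform.
  rewrite <- (contour_minus (fun t => f t / (t - y))%C) by
    (first [exact Hs | now apply circle_cont_mult]).
  rewrite Cmult_comm, <- contour_scal by
    (first [exact Hs | apply circle_cont_mult; [exact Hf | now apply circle_cont_mult]]).
  rewrite <- contour_minus.
  - apply Rle_trans with (2 * PI * (s * (Cmod (y - z) * Cmod (y - z) * (M * (2 / d * (/ d * / d)))))).
    + apply Cmod_contour_le; [exact Hs| |].
      * intros t Ht. apply ccont_minus; [apply ccont_minus|].
        -- apply ccont_mult; [now apply Hf | now apply Cy].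
        -- apply ccont_mult; [now apply Hf | now apply Cz].
        -- apply ccont_mult; [apply ccont_const|].
           apply ccont_mult; [now apply Hf|]. apply ccont_mult; now apply Cz.
      * intros t Ht. destruct (Ty t Ht) as [T1 T2].
        assert (N1 := Nz t y ltac:(lra)). assert (N2 := Nz t z ltac:(lra)).
        replace (f t / (t - y) - f t / (t - z) - (y - z) * (f t * k t))%C
          with ((y - z) * (y - z) * (f t * (/ (t - y) * (/ (t - z) * / (t - z)))))%C
          by (unfold k; field; now split).
        rewrite !Cmod_mult, !Cmod_inv by assumption.
        assert (0 < / Cmod (t - y)) by (apply Rinv_0_lt_compat; lra).
        assert (0 < / Cmod (t - z)) by (apply Rinv_0_lt_compat; lra).
        assert (/ Cmod (t - y) <= 2 / d).
        { replace (2 / d) with (/ (d / 2)) by (field; lra). apply Rinv_le_contravar; lra. }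
        assert (/ Cmod (t - z) <= / d) by (apply Rinv_le_contravar; lra).
        pose proof (Cmod_ge_0 (y - z)).
        apply Rmult_le_compat_l; [apply Rmult_le_pos; lra|].
        apply Rmult_le_compat; [apply Cmod_ge_0| | now apply HM |].
        { repeat (apply Rmult_le_pos; try lra). }
        apply Rmult_le_compat; try lra.
        { apply Rmult_le_pos; lra. }
        apply Rmult_le_compat; lra.
    + pose proof (Cmod_ge_0 (y - z)) as P. set (X := Cmod (y - z)) in *.
      replace (2 * PI * (s * (X * X * (M * (2 / d * (/ d * / d)))))) with (X * K * X)
        by (unfold K; ring).
      apply Rmult_le_compat_r; [exact P|]. apply Rlt_div_r in Y2; nra.
  - exact Hs.
  - intros t Ht. apply ccont_minus.
    + exact (circle_cont_mult f _ s Hf Cy t Ht).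
    + exact (circle_cont_mult f _ s Hf Cz t Ht).
  - apply circle_cont_scal, circle_cont_mult; [exact Hf | now apply circle_cont_mult].
Qed.

Lemma vanishes_cauchy_transform (f : C -> C) (s : R) :
  0 <= s -> circle_cont f s -> vanishes_infty (cauchy_transform s f).
Proof.
  intros Hs Hf eps He. pose proof PI_RGT_0.
  destruct (circle_bounded f s Hs Hf) as (M & HM0 & HM).
  set (K := 2 * PI * (s * M)).
  assert (HK : 0 <= K) by (unfold K; repeat (apply Rmult_le_pos; try lra)).
  assert (0 <= K / eps) by (apply Rle_mult_inv_pos; lra).
  exists (s + K / eps + 1). intros z Hz.
  set (d := K / eps + 1).
  eapply Rle_trans; [apply (Cmod_cauchy_transform_le f s M d); trivial|].
  - unfold d. split; [lra|]. rewrite Rabs_left; lra.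
  - replace (2 * PI * (s * (M / d))) with (K / d) by (unfold K, d; field; lra).
    apply Rle_div_l; [unfold d; lra|]. unfold d.
    replace (eps * (K / eps + 1)) with (K + eps) by (field; lra). lra.
Qed.

Definition bounded_infty (f : C -> C) : Prop :=
  exists M R0, forall z, R0 <= Cmod z -> Cmod (f z) <= M.

Lemma vanishes_mult (f g : C -> C) :
  vanishes_infty f -> bounded_infty g -> vanishes_infty (fun z => f z * g z)%C.
Proof.
  intros Hf (M & R0 & HM) eps He.
  set (M' := Rmax M 1). assert (1 <= M') by apply Rmax_r. assert (M <= M') by apply Rmax_l.
  destruct (Hf (eps / M') ltac:(apply Rdiv_lt_0_compat; lra)) as [R1 H1].
  exists (Rmax R0 R1). intros z Hz.
  specialize (H1 z (Rle_trans _ _ _ (Rmax_r _ _) Hz)).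
  specialize (HM z (Rle_trans _ _ _ (Rmax_l _ _) Hz)).
  rewrite Cmod_mult. replace eps with (eps / M' * M') by (field; lra).
  apply Rmult_le_compat; try apply Cmod_ge_0; lra.
Qed.

Lemma vanishes_ext (f g : C -> C) (R0 : R) :
  (forall z, R0 <= Cmod z -> f z = g z) -> vanishes_infty f -> vanishes_infty g.
Proof.
  intros E Hf eps He. destruct (Hf eps He) as [R1 H1]. exists (Rmax R0 R1). intros z Hz.
  rewrite <- E by (eapply Rle_trans; [apply Rmax_l | exact Hz]).
  apply H1. eapply Rle_trans; [apply Rmax_r | exact Hz].
Qed.

Lemma vanishes_plus (f g : C -> C) :
  vanishes_infty f -> vanishes_infty g -> vanishes_infty (fun z => f z + g z)%C.
Proof.
  intros Hf Hg eps He. destruct (Hf (eps / 2) ltac:(lra)) as [R1 H1].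
  destruct (Hg (eps / 2) ltac:(lra)) as [R2 H2]. exists (Rmax R1 R2). intros z Hz.
  specialize (H1 z (Rle_trans _ _ _ (Rmax_l _ _) Hz)).
  specialize (H2 z (Rle_trans _ _ _ (Rmax_r _ _) Hz)).
  eapply Rle_trans; [apply Cmod_triangle|]. lra.
Qed.

Lemma vanishes_Cinv : vanishes_infty Cinv.
Proof.
  intros eps He. exists (/ eps). intros z Hz.
  assert (0 < / eps) by now apply Rinv_0_lt_compat.
  rewrite Cmod_inv by (apply Cmod_gt_0; lra).
  rewrite <- (Rinv_inv eps). apply Rinv_le_contravar; lra.
Qed.

Lemma bounded_of_limit (f : C -> C) (l : C) :
  vanishes_infty (fun z => f z - l)%C -> bounded_infty f.
Proof.
  intros H. destruct (H 1 Rlt_0_1) as [R0 H0]. exists (Cmod l + 1), R0. intros z Hz.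
  replace (f z) with (l + (f z - l))%C by ring.
  eapply Rle_trans; [apply Cmod_triangle|]. specialize (H0 z Hz). lra.
Qed.

Lemma bounded_kernel (p : C) : bounded_infty (fun t => t / (t - p))%C.
Proof.
  exists 2, (2 * Cmod p + 1). intros z Hz. pose proof (Cmod_ge_0 p).
  rewrite Cmod_div by (apply Cminus_neq_0_Cmod; lra).
  pose proof (Cmod_minus_ge z p). apply Rle_div_l; lra.
Qed.

(** One step of the geometric expansion [1 / (t - p) = 1 / t + p / (t (t - p))]. *)
Lemma contour_kernel_step (f : C -> C) (s : R) (p : C) (N : nat) :
  0 < s -> circle_cont f s -> Cmod p <> s ->
  contour_circle s (fun t => f t * (/ t ^ N * / (t - p)))%C
  = (contour_circle s (fun t => f t * / t ^ S N)
     + p * contour_circle s (fun t => f t * (/ t ^ S N * / (t - p))))%C.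
Proof.
  intros Hs Cf Hp.
  assert (Cm : forall m, circle_cont (fun t => / t ^ m)%C s).
  { intros m z Hz. apply ccont_inv; [apply ccont_pow, ccont_id|].
    apply Cpow_nz, Cmod_gt_0; lra. }
  assert (Ck := circle_cont_kernel p s Hp).
  assert (C2 : circle_cont (fun t => f t * (/ t ^ S N * / (t - p)))%C s)
    by (apply circle_cont_mult; [exact Cf | now apply circle_cont_mult]).
  rewrite <- contour_scal by (try lra; exact C2).
  rewrite <- contour_plus; [|lra| |now apply circle_cont_scal].
  - apply contour_ext; [lra|]. intros z Hz. simpl. field.
    split; [apply Cminus_neq_0_Cmod; lra|].
    split; [apply Cpow_nz|]; apply Cmod_gt_0; lra.
  - now apply circle_cont_mult.
Qed.

(* Expanding the kernel shows that the Taylor coefficients of [f] at 0 all vanish. *)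
Lemma identity_theorem (f : C -> C) (a B : R) (p : C) :
  0 < a < B -> (forall z, 0 < Cmod z < B -> cdiff f z) ->
  (forall z, 0 < Cmod z < a -> f z = RtoC 0) -> 0 < Cmod p < B -> f p = RtoC 0.
Proof.
  intros Ha Hf H0 Hp. pose proof PI_RGT_0.
  destruct (Rlt_le_dec (Cmod p) a) as [Hpa|Hpa]; [apply H0; lra|].
  set (b := (Cmod p + B) / 2). assert (Hb : Cmod p < b < B) by (unfold b; lra).
  assert (Hfa := cauchy_formula_annulus f (a / 2) b p ltac:(lra) ltac:(lra)
                   ltac:(intros z Hz; apply Hf; lra)).
  assert (Z : forall g, contour_circle (a / 2) (fun t => f t * g t)%C = RtoC 0).
  { intros g. rewrite (contour_ext _ (fun t => RtoC 0)) by
      (first [lra | intros z Hz; rewrite H0 by lra; ring]).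
    apply cauchy_disc; [lra|]. intros; apply cdiff_const. }
  unfold Cdiv in Hfa. rewrite (Z (fun t => / (t - p))%C) in Hfa.
  (* The coefficients are computed on the circle of radius [a / 2], where [f] vanishes. Negative
     powers are harmless: [f] need not be regular at 0. *)
  assert (Hm : forall m, contour_circle b (fun t => f t * / t ^ m)%C = RtoC 0).
  { intros m. rewrite <- (cauchy_annulus _ (a / 2) b); [apply Z|lra|lra|].
    intros z Hz. apply cdiff_mult; [apply Hf; lra|]. apply cdiff_inv.
    - apply cdiff_pow, cdiff_id.
    - apply Cpow_nz, Cmod_gt_0; lra. }
  assert (Cf : circle_cont f b) by (intros z Hz; apply cdiff_ccont, Hf; lra).
  assert (Cm : forall m, circle_cont (fun t => / t ^ m)%C b).
  { intros m z Hz. apply ccont_inv; [apply ccont_pow, ccont_id|].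
    apply Cpow_nz, Cmod_gt_0; lra. }
  assert (Ck := circle_cont_kernel p b ltac:(lra)).
  assert (HN : forall N, contour_circle b (fun t => f t * / (t - p))%C
     = (p ^ N * contour_circle b (fun t => f t * (/ t ^ N * / (t - p))))%C).
  { induction N as [|N IH].
    - simpl. rewrite Cmult_1_l. apply contour_ext; [lra|]. intros z Hz. field.
      apply Cminus_neq_0_Cmod; lra.
    - rewrite IH, contour_kernel_step, Hm by (trivial; lra). simpl. ring. }
  destruct (circle_bounded (fun t => f t * / (t - p))%C b ltac:(lra)) as (M & HM0 & HM).
  { now apply circle_cont_mult. }
  assert (E : (2 * PI * Ci * f p)%C = RtoC 0).
  { apply (C0_of_eps _ (2 * PI * (b * M))); [repeat (apply Rmult_le_pos; try lra)|].
    intros eps He.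
    (* After [N] expansion steps only a remainder of size [q ^ N] is left of the outer integral. *)
    set (q := Cmod p / b). assert (Hq : 0 <= q < 1).
    { unfold q. split; [apply Rle_mult_inv_pos; lra|]. apply Rlt_div_l; lra. }
    destruct (pow_lt_1_zero q ltac:(rewrite Rabs_pos_eq; lra) eps He) as [N HNe].
    specialize (HNe N (le_n _)).
    rewrite <- Hfa. unfold Cminus at 1. rewrite (HN N).
    replace (p ^ N * contour_circle b (fun t => f t * (/ t ^ N * / (t - p))) + - 0)%C
      with (p ^ N * contour_circle b (fun t => f t * (/ t ^ N * / (t - p))))%C by ring.
    rewrite Cmod_mult, Cmod_pow.
    assert (Hb0 : 0 < b ^ N) by (apply pow_lt; lra).
    assert (B1 : Cmod (contour_circle b (fun t => f t * (/ t ^ N * / (t - p)))%C)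
                 <= 2 * PI * (b * (M / b ^ N))).
    { apply Cmod_contour_le; [lra| |].
      - apply circle_cont_mult; [exact Cf | now apply circle_cont_mult].
      - intros z Hz.
        replace (f z * (/ z ^ N * / (z - p)))%C with (f z * / (z - p) * / z ^ N)%C by ring.
        rewrite Cmod_mult, Cmod_inv, Cmod_pow, Hz by (apply Cpow_nz, Cmod_gt_0; lra).
        apply Rmult_le_compat_r; [left; now apply Rinv_0_lt_compat | now apply HM]. }
    apply Rle_trans with (Cmod p ^ N * (2 * PI * (b * (M / b ^ N)))).
    - apply Rmult_le_compat_l; [apply pow_le, Cmod_ge_0 | exact B1].
    - replace (Cmod p ^ N * (2 * PI * (b * (M / b ^ N)))) with (2 * PI * (b * M) * q ^ N).
      + apply Rmult_le_compat_l; [repeat (apply Rmult_le_pos; try lra)|].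
        rewrite Rabs_pos_eq in HNe; [lra|]. apply pow_le; lra.
      + unfold q, Rdiv. rewrite Rpow_mult_distr, pow_inv. ring. }
  apply Cmod_eq_0. apply (f_equal Cmod) in E.
  rewrite !Cmod_mult, Cmod_Ci, Cmod_0, !Cmod_R, !Rabs_pos_eq in E by lra.
  pose proof (Cmod_ge_0 (f p)). nra.
Qed.

(** * Exterior boundary values *)

(** Each iterate is holomorphic across the circle over which the next operator integrates, so this
    continuous case is the one that evaluates [ext_bv] in the iteration. *)
Lemma ext_bv_cont (f : C -> C) (t : C) :
  0 < Cmod t -> ccont (T := C_UniformSpace) f t -> ext_bv f t = f t.
Proof.
  intros Ht Hf. unfold ext_bv.
  assert (PF : ProperFilter'
    (within (fun s : C => Cmod t < Cmod s) (locally (T := C_UniformSpace) t))).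
  { split.
    - intros [e He]. pose proof (cond_pos e).
      assert (0 < e / (2 * Cmod t)) by (apply Rdiv_lt_0_compat; lra).
      (* A point in the direction of [t] with slightly larger modulus shows that the exterior filter
         is proper. *)
      apply (He (t * RtoC (1 + e / (2 * Cmod t)))%C).
      + apply ball_of_Cmod.
        replace (t * RtoC (1 + e / (2 * Cmod t)) - t)%C with (t * RtoC (e / (2 * Cmod t)))%C
          by (rewrite RtoC_plus; ring).
        rewrite Cmod_mult, Cmod_R, Rabs_pos_eq by lra.
        replace (Cmod t * (e / (2 * Cmod t))) with (e / 2) by (field; lra). lra.
      + rewrite Cmod_mult, Cmod_R, Rabs_pos_eq by lra. nra.
    - apply within_filter, locally_filter. }
  apply (iota_filterlim_locally (V := C_CompleteNormedModule)
    (F := within (fun s : C => Cmod t < Cmod s) (locally (T := C_UniformSpace) t)) (FF := PF)).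
  intros P HP. unfold filtermap, within.
  generalize (Hf P HP). unfold filtermap. apply filter_imp. auto.
Qed.

(** * The Szego functions *)

Lemma Cexp_opp (a : C) : (Cexp (- a) * Cexp a)%C = RtoC 1.
Proof.
  destruct a as [x y]. unfold Cexp, Cmult, Copp, RtoC, Re, Im; simpl.
  rewrite cos_neg, sin_neg. assert (E : exp (- x) * exp x = 1).
  { rewrite <- exp_plus, Rplus_opp_l. apply exp_0. }
  pose proof (sin2_cos2 y) as T. unfold Rsqr in T. f_equal.
  - replace (exp (- x) * cos y * (exp x * cos y) - exp (- x) * - sin y * (exp x * sin y))
      with (exp (- x) * exp x * (sin y * sin y + cos y * cos y)) by ring.
    rewrite E, T. ring.
  - ring.
Qed.

Lemma Cexp_neq_0 (a : C) : Cexp a <> RtoC 0.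
Proof.
  intros E. pose proof (Cexp_opp a) as H. rewrite E, Cmult_0_r in H.
  apply (f_equal fst) in H. simpl in H. lra.
Qed.

Lemma Cexp_opp_inv (a : C) : Cexp (- a) = (/ Cexp a)%C.
Proof.
  replace (Cexp (- a)) with (Cexp (- a) * Cexp a * / Cexp a)%C
    by (field; apply Cexp_neq_0).
  rewrite Cexp_opp. ring.
Qed.

Lemma Cexp_conj (a : C) : Cexp (Cconj a) = Cconj (Cexp a).
Proof.
  destruct a as [x y]. unfold Cexp, Cconj, Re, Im; simpl. rewrite cos_neg, sin_neg.
  f_equal; ring.
Qed.

Lemma Cexp_RtoC (x : R) : Cexp (RtoC x) = RtoC (exp x).
Proof. unfold Cexp, RtoC, Re, Im; simpl. rewrite cos_0, sin_0. f_equal; ring. Qed.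

Lemma Cexp_mul_conj (a : C) : (Cexp a * Cconj (Cexp a))%C = RtoC (exp (2 * Re a)).
Proof.
  destruct a as [x y]. unfold Cexp, Cmult, Cconj, RtoC, Re, Im; simpl.
  replace (2 * x) with (x + x) by ring. rewrite exp_plus.
  pose proof (sin2_cos2 y) as T. unfold Rsqr in T. f_equal; [|ring].
  replace (exp x * cos y * (exp x * cos y) - exp x * sin y * - (exp x * sin y))
    with (exp x * exp x * (sin y * sin y + cos y * cos y)) by ring.
  rewrite T. ring.
Qed.

Lemma is_RInt_Re (h : R -> C) (a b : R) :
  cint h a b -> is_RInt (fun x => Re (h x)) a b (Re (integral_C h a b)).
Proof.
  intros H. apply (is_RInt_fct_extend_fst (U := R_NormedModule) (V := R_NormedModule) h).
  now apply is_integral_C.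
Qed.

Lemma is_RInt_Im (h : R -> C) (a b : R) :
  cint h a b -> is_RInt (fun x => Im (h x)) a b (Im (integral_C h a b)).
Proof.
  intros H. apply (is_RInt_fct_extend_snd (U := R_NormedModule) (V := R_NormedModule) h).
  now apply is_integral_C.
Qed.

Lemma integral_C_conj (h : R -> C) (a b : R) :
  cint h a b -> integral_C (fun x => Cconj (h x)) a b = Cconj (integral_C h a b).
Proof.
  intros H. apply integral_C_unique.
  apply (is_RInt_fct_extend_pair (U := R_NormedModule) (V := R_NormedModule)
           (fun x => Cconj (h x)) a b).
  - exact (is_RInt_Re h a b H).
  - apply (is_RInt_opp (V := R_NormedModule) (fun x => Im (h x))). now apply is_RInt_Im.
Qed.

Lemma integral_C_RtoC (h : R -> R) (a b : R) :
  ex_RInt h a b -> integral_C (fun x => RtoC (h x)) a b = RtoC (RInt h a b).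
Proof.
  intros H. apply integral_C_unique.
  apply (is_RInt_fct_extend_pair (U := R_NormedModule) (V := R_NormedModule)
           (fun x => RtoC (h x)) a b).
  - now apply (RInt_correct (V := R_CompleteNormedModule)).
  - change (is_RInt (V := R_NormedModule) (fun _ => 0) a b 0).
    assert (Q := is_RInt_const (V := R_NormedModule) a b (0 : R_NormedModule)).
    change (is_RInt (V := R_NormedModule) (fun _ => 0) a b ((b - a) * 0)) in Q.
    now rewrite Rmult_0_r in Q.
Qed.

Definition herglotz (x : R) (z : C) : C := ((cis x + z) / (cis x - z))%C.

Lemma Cminus_cis_neq_0 (x : R) (z : C) : Cmod z <> 1 -> (cis x - z)%C <> RtoC 0.
Proof. intros H. apply Cminus_neq_0_Cmod. rewrite Cmod_cis. lra. Qed.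

Lemma ccont_herglotz (z : C) (x : R) : Cmod z <> 1 -> ccont (fun x => herglotz x z) x.
Proof.
  intros Hz. unfold herglotz. apply ccont_div.
  - apply ccont_plus; [apply ccont_cis | apply ccont_const].
  - apply ccont_minus; [apply ccont_cis | apply ccont_const].
  - now apply Cminus_cis_neq_0.
Qed.

(** This is the Poisson kernel, nonnegative inside the unit disc. *)
Lemma Re_herglotz (z : C) (x : R) :
  Cmod z <> 1 -> Re (herglotz x z) = (1 - Cmod z ^ 2) / Cmod (cis x - z) ^ 2.
Proof.
  intros Hz. assert (Hn := proj1 (Cmod_gt_0 _) (Cminus_cis_neq_0 x z Hz)).
  assert (Hn2 : Cmod (cis x - z) ^ 2 <> 0) by (apply pow_nonzero; lra).
  pose proof (Cmod2_alt (cis x - z)) as E. pose proof (Cmod2_alt z) as Ez.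
  pose proof (sin2_cos2 x) as T. unfold Rsqr in T.
  rewrite Ez. rewrite E in *. clear Ez E Hn Hz. destruct z as [p q].
  unfold herglotz, Cdiv, Cinv, Cmult, Cplus, Cminus, Copp, cis, Re, Im in *; simpl in *.
  replace (1 - (p * (p * 1) + q * (q * 1)))
    with (sin x * sin x + cos x * cos x - (p * p + q * q)) by (rewrite T; ring).
  field. now rewrite !Rmult_1_r in Hn2.
Qed.

Lemma herglotz_reflect (z : C) (x : R) :
  Cmod z <> 1 -> z <> RtoC 0 -> herglotz x (/ Cconj z) = (- Cconj (herglotz x z))%C.
Proof.
  intros Hz Hz0. unfold herglotz.
  assert (Hc : Cconj z <> RtoC 0).
  { apply Cmod_gt_0. rewrite Cmod_conj. now apply Cmod_gt_0. }
  rewrite Cdiv_conj by now apply Cminus_cis_neq_0.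
  rewrite Cplus_conj, Cminus_conj.
  assert (E : (cis x * Cconj (cis x))%C = RtoC 1).
  { rewrite <- Cmod2_conj, Cmod_cis. f_equal; ring. }
  set (t := cis x) in *. set (u := Cconj t) in *. set (y := Cconj z) in *.
  assert (N1 : (u - y)%C <> RtoC 0).
  { unfold u, y. rewrite <- Cminus_conj. apply Cmod_gt_0. rewrite Cmod_conj.
    apply Cmod_gt_0. now apply Cminus_cis_neq_0. }
  assert (N2 : (t - / y)%C <> RtoC 0).
  { apply Cminus_cis_neq_0. rewrite Cmod_inv by exact Hc. unfold y. rewrite Cmod_conj.
    intros E1. apply Hz. rewrite <- (Rinv_inv (Cmod z)), E1. apply Rinv_1. }
  assert (N3 : (t * y - 1)%C <> RtoC 0).
  { intros E3. apply N2. replace (t - / y)%C with ((t * y - 1) * / y)%C by (field; exact Hc).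
    rewrite E3. ring. }
  replace ((t + / y) / (t - / y))%C with ((t * y + 1) / (t * y - 1))%C
    by (field; repeat split; assumption).
  (* Writing 1 as [t * Cconj t], valid on the unit circle, makes the claim a rational identity in
     [t], its conjugate and [Cconj z]. *)
  rewrite <- E. assert (Ht : t <> RtoC 0) by apply cis_neq_0.
  rewrite <- E in N3. replace (t * y - t * u)%C with (t * (y - u))%C in * by ring.
  field. split; [exact N1|].
  split; [intros Q; apply N1; replace (u - y)%C with (- (y - u))%C by ring; rewrite Q; ring
         | exact Ht].
Qed.

(** With [dt = i t dx] the integrand becomes [-i (2 / (t - z) - 1 / t) dt], and both kernels
    integrate to [2 PI i]. The real part says that the Poisson kernel has total mass [2 PI]. *)
Lemma integral_herglotz (z : C) :
  Cmod z < 1 -> integral_C (fun x => herglotz x z) 0 (2 * PI) = RtoC (2 * PI).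
Proof.
  intros Hz. pose proof PI_RGT_0.
  assert (Hk := circle_cont_kernel z 1 ltac:(lra)).
  assert (Hi : circle_cont (fun t => / t)%C 1).
  { intros t Ht. apply ccont_inv; [apply ccont_id|]. apply Cmod_gt_0; lra. }
  transitivity (contour_circle 1 (fun t => (- Ci) * (2 * / (t - z) - / t))%C).
  - unfold contour_circle. apply integral_C_ext. intros x _. simpl. unfold herglotz.
    replace (RtoC 1 * cis x)%C with (cis x) by ring.
    replace (- Ci * (2 * / (cis x - z) - / cis x) * (Ci * cis x))%C
      with (- (Ci * Ci) * ((2 * / (cis x - z) - / cis x) * cis x))%C by ring.
    replace (Ci * Ci)%C with (- RtoC 1)%C
      by (unfold Ci, Cmult, RtoC, Copp; simpl; f_equal; ring).
    field. split; [apply cis_neq_0 | apply Cminus_cis_neq_0; lra].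
  - rewrite contour_scal, contour_minus, contour_scal, contour_kernel_inside; try lra.
    + change (contour_circle 1 (fun t => / t)%C) with (contour_circle 1 Cinv).
      rewrite contour_Cinv by lra.
      replace (- Ci * (2 * (2 * PI * Ci) - 2 * PI * Ci))%C
        with (- (Ci * Ci) * (2 * PI))%C by ring.
      replace (Ci * Ci)%C with (- RtoC 1)%C
        by (unfold Ci, Cmult, RtoC, Copp; simpl; f_equal; ring).
      rewrite RtoC_mult. ring.
    + exact Hk.
    + now apply circle_cont_scal.
    + exact Hi.
    + intros t Ht. apply ccont_minus; [|now apply Hi].
      now apply (circle_cont_scal 2 _ 1 Hk).
Qed.

(** * Reflection and boundary behaviour of the Szego functions *)

Section Szego.
Variable w : C -> R.
Variable W : C -> C.
Hypothesis HWc : circle_cont W 1.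
Hypothesis Hw : forall z, Cmod z = 1 -> 0 < w z.
Hypothesis HWw : forall z, Cmod z = 1 -> W z = RtoC (w z).

(** Off the circle [w] is arbitrary, so continuity can only come from [W]; [lw] is the continuous
    stand-in for [ln w]. *)
Let lw (z : C) : C := RtoC (ln (Re (W z))).

Lemma lw_eq (z : C) : Cmod z = 1 -> lw z = RtoC (ln (w z)).
Proof. intros Hz. unfold lw. rewrite HWw by exact Hz. reflexivity. Qed.

Lemma circle_cont_lw : circle_cont lw 1.
Proof.
  intros z Hz. apply (ccont_RtoC (T := C_UniformSpace)).
  apply (continuous_comp (fun z => Re (W z)) ln).
  - apply ccont_Re. now apply HWc.
  - apply continuity_pt_filterlim. apply derivable_continuous_pt.
    rewrite HWw by exact Hz. simpl. exists (/ w z). now apply derivable_pt_lim_ln, Hw.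
Qed.

Lemma continuous_ln_w (x : R) : continuous (fun x => ln (w (cis x))) x.
Proof.
  apply (continuous_ext (fun x => Re (lw (RtoC 1 * cis x)%C))).
  - intros y. rewrite lw_eq by (apply Cmod_polar; lra).
    simpl. do 2 f_equal. apply Cmult_1_l.
  - apply ccont_Re. apply ccont_polar_arc. apply circle_cont_lw. apply Cmod_polar; lra.
Qed.

Let S (z : C) : C :=
  (RtoC (/ (4 * PI)) *
   integral_C (fun x => RtoC (ln (w (cis x))) * herglotz x z) 0 (2 * PI))%C.

Lemma szego_S (z : C) : szego w z = Cexp (S z).
Proof. reflexivity. Qed.

Lemma cint_szego (z : C) :
  Cmod z <> 1 -> cint (fun x => RtoC (ln (w (cis x))) * herglotz x z)%C 0 (2 * PI).
Proof.
  intros Hz. apply cint_cont. intros x _. apply ccont_mult; [|now apply ccont_herglotz].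
  apply ccont_RtoC, continuous_ln_w.
Qed.

Lemma szego_neq_0 (z : C) : szego w z <> RtoC 0.
Proof. apply Cexp_neq_0. Qed.

(** Reflection turns the Herglotz kernel into minus its conjugate; as [ln w] is real, the exponent
    [S] changes in the same way. *)
Lemma szego_reflect (z : C) :
  Cmod z <> 1 -> z <> RtoC 0 -> szego w (/ Cconj z) = (/ Cconj (szego w z))%C.
Proof.
  intros Hz Hz0. rewrite !szego_S, <- Cexp_conj, <- Cexp_opp_inv. f_equal.
  unfold S. rewrite Cmult_conj, <- integral_C_conj by now apply cint_szego.
  replace (Cconj (RtoC (/ (4 * PI)))) with (RtoC (/ (4 * PI)))
    by (unfold Cconj, RtoC; simpl; f_equal; ring).
  rewrite (integral_C_ext _
    (fun x => RtoC (-1) * Cconj (RtoC (ln (w (cis x))) * herglotz x z))%C).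
  - rewrite integral_C_scal; [ring|].
    apply cint_cont. intros x _. apply ccont_conj. apply ccont_mult; [|now apply ccont_herglotz].
    apply ccont_RtoC, continuous_ln_w.
  - intros x _. rewrite herglotz_reflect by assumption. rewrite Cmult_conj.
    replace (Cconj (RtoC (ln (w (cis x))))) with (RtoC (ln (w (cis x))))
      by (unfold Cconj, RtoC; simpl; f_equal; ring).
    ring.
Qed.

Lemma szego_0 : szego w 0 = (/ RtoC (tau w))%C.
Proof.
  rewrite szego_S. unfold tau. rewrite <- Cexp_RtoC, <- Cexp_opp_inv. f_equal.
  unfold S. rewrite (integral_C_ext _ (fun x => RtoC (ln (w (cis x))))).
  - rewrite integral_C_RtoC.
    + rewrite RtoC_opp, RtoC_mult. ring.
    + apply (ex_RInt_continuous (V := R_CompleteNormedModule)). intros; apply continuous_ln_w.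
  - intros x _. unfold herglotz. field.
    replace (cis x - 0)%C with (cis x) by ring. apply cis_neq_0.
Qed.

(* The Poisson kernel at [z = s p] is [(1 - s^2) / |t - z|^2] and [|t - p| <= 2 |t - z|], so the
   quadratic part of the bound on [ln w] cancels its denominator. *)
Lemma poisson_estimate (p : C) (s eps K : R) :
  Cmod p = 1 -> 0 <= s < 1 -> 0 <= K -> 0 <= eps ->
  (forall t, Cmod t = 1 -> Rabs (ln (w t) - ln (w p)) <= eps + K * Cmod (t - p) ^ 2) ->
  Rabs (2 * Re (S (s * p)%C) - ln (w p)) <= eps + 4 * K * (1 - s ^ 2).
Proof.
  intros Hp Hs HK He Hl. pose proof PI_RGT_0.
  set (z := (s * p)%C).
  assert (Hz : Cmod z = s) by (unfold z; rewrite Cmod_mult, Hp, Cmod_R, Rabs_pos_eq; lra).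
  assert (Hz1 : Cmod z <> 1) by lra.
  assert (I1 := is_RInt_Re _ _ _ (cint_szego z Hz1)).
  assert (I2 : is_RInt (fun x => Re (herglotz x z)) 0 (2 * PI) (2 * PI)).
  { assert (Q := is_RInt_Re (fun x => herglotz x z) 0 (2 * PI)).
    rewrite integral_herglotz in Q by lra. apply Q.
    apply cint_cont. intros; now apply ccont_herglotz. }
  set (J := Re (integral_C (fun x => RtoC (ln (w (cis x))) * herglotz x z)%C 0 (2 * PI))) in *.
  assert (EJ : 2 * Re (S z) = J / (2 * PI)).
  { unfold S. fold z. unfold J. simpl. field. lra. }
  rewrite EJ.
  assert (I3 : is_RInt (fun x => (ln (w (cis x)) - ln (w p)) * Re (herglotz x z))
                 0 (2 * PI) (J - ln (w p) * (2 * PI))).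
  { apply (is_RInt_ext (V := R_NormedModule)
      (fun x => minus (Re (RtoC (ln (w (cis x))) * herglotz x z)%C)
                      (scal (ln (w p)) (Re (herglotz x z))))).
    - intros x _. unfold minus, plus, opp, scal; simpl. unfold mult; simpl. ring.
    - apply (is_RInt_minus (V := R_NormedModule)); [exact I1|].
      now apply (is_RInt_scal (V := R_NormedModule)). }
  assert (I4 : is_RInt (fun x => eps * Re (herglotz x z) + 4 * K * (1 - s ^ 2))
                 0 (2 * PI) (eps * (2 * PI) + (2 * PI - 0) * (4 * K * (1 - s ^ 2)))).
  { apply (is_RInt_plus (V := R_NormedModule) (fun x => eps * Re (herglotz x z))).
    - now apply (is_RInt_scal (V := R_NormedModule) (fun x => Re (herglotz x z))).
    - apply (is_RInt_const (V := R_NormedModule)). }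
  assert (Hpt : forall x, Rabs ((ln (w (cis x)) - ln (w p)) * Re (herglotz x z)) <=
                          eps * Re (herglotz x z) + 4 * K * (1 - s ^ 2)).
  { intros x.
    rewrite Re_herglotz by exact Hz1. rewrite Hz.
    set (D := Cmod (cis x - z)).
    assert (HD0 : 1 - s <= D).
    { unfold D. pose proof (Cmod_minus_ge (cis x) z). rewrite Cmod_cis in *. lra. }
    assert (HD2 : 0 < D ^ 2) by (apply pow_lt; lra).
    set (P := (1 - s ^ 2) / D ^ 2).
    assert (HP : 0 <= P) by (apply Rle_mult_inv_pos; [nra | exact HD2]).
    rewrite Rabs_mult, (Rabs_pos_eq P) by exact HP.
    specialize (Hl (cis x) (Cmod_cis x)).
    assert (Ht : Cmod (cis x - p) <= 2 * D).
    { replace (cis x - p)%C with ((cis x - z) + (z - p))%C by ring.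
      eapply Rle_trans; [apply Cmod_triangle|].
      replace (z - p)%C with (RtoC (s - 1) * p)%C by (unfold z; rewrite RtoC_minus; ring).
      rewrite Cmod_mult, Hp, Cmod_R, Rabs_left1 by lra. fold D. lra. }
    assert (Ht2 : Cmod (cis x - p) ^ 2 <= 4 * D ^ 2).
    { pose proof (Cmod_ge_0 (cis x - p)). nra. }
    assert (HPD : D ^ 2 * P = 1 - s ^ 2) by (unfold P; field; lra).
    apply Rle_trans with ((eps + K * (4 * D ^ 2)) * P).
    - apply Rmult_le_compat_r; [exact HP|]. nra.
    - right. rewrite <- HPD. ring. }
  assert (Q := norm_RInt_le (V := R_NormedModule) _ _ 0 (2 * PI) _ _ ltac:(lra)
    (fun x _ => Hpt x) I3 I4).
  change (Rabs (J - ln (w p) * (2 * PI)) <=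
          eps * (2 * PI) + (2 * PI - 0) * (4 * K * (1 - s ^ 2))) in Q.
  replace (J / (2 * PI) - ln (w p)) with ((J - ln (w p) * (2 * PI)) / (2 * PI)) by (field; lra).
  unfold Rdiv. rewrite Rabs_mult, (Rabs_pos_eq (/ (2 * PI))) by
    (left; apply Rinv_0_lt_compat; lra).
  apply Rle_div_l; [lra|]. lra.
Qed.

(** This is the radial limit [|D_i(s p)|^2 -> w(p)] in logarithmic form, from [poisson_estimate]. A
    quadratic bound on [ln w] is available for any continuous weight: near [p] by continuity,
    elsewhere because [|t - p|] stays away from 0. *)
Lemma szego_boundary (p : C) :
  Cmod p = 1 -> forall eps, 0 < eps -> exists d, 0 < d /\
    forall s, 0 <= s < 1 -> 1 - d < s ->
      Rabs (2 * Re (S (s * p)%C) - ln (w p)) <= eps.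
Proof.
  intros Hp eps He.
  destruct (circle_bounded lw 1 ltac:(lra) circle_cont_lw) as (M & HM0 & HM).
  assert (Hc := circle_cont_lw p Hp). rewrite ccont_eps in Hc.
  destruct (Hc (eps / 2) ltac:(lra)) as (d & Hd & Kd).
  (* For [|t - p| >= d] this gives [K * |t - p|^2 >= 2 * M], the trivial bound on the difference of
     logarithms. *)
  set (K := 2 * M / d ^ 2).
  assert (Hd2 : 0 < d ^ 2) by (apply pow_lt; lra).
  assert (HK : 0 <= K) by (apply Rle_mult_inv_pos; lra).
  assert (Hl : forall t, Cmod t = 1 ->
     Rabs (ln (w t) - ln (w p)) <= eps / 2 + K * Cmod (t - p) ^ 2).
  { intros t Ht.
    assert (E : Rabs (ln (w t) - ln (w p)) = Cmod (lw t - lw p)).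
    { rewrite !lw_eq by assumption. now rewrite <- RtoC_minus, Cmod_R. }
    rewrite E. pose proof (pow2_ge_0 (Cmod (t - p))).
    destruct (Rlt_le_dec (Cmod (t - p)) d) as [H1|H1].
    - specialize (Kd t H1). nra.
    - eapply Rle_trans; [apply Cmod_minus_le|].
      pose proof (HM t Ht). pose proof (HM p Hp).
      assert (d ^ 2 <= Cmod (t - p) ^ 2) by (apply pow_incr; lra).
      assert (K * d ^ 2 = 2 * M) by (unfold K; field; lra). nra. }
  (* With this distance to 1, [4 K (1 - s^2) <= 8 K (1 - s) <= eps / 2]. *)
  assert (0 < eps / (16 * (K + 1))) by (apply Rdiv_lt_0_compat; lra).
  exists (eps / (16 * (K + 1))). split; [assumption|]. intros s Hs Hs1.
  eapply Rle_trans; [apply (poisson_estimate p s (eps / 2) K); trivial; lra|].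
  assert (Q : (1 - s) * (16 * (K + 1)) < eps) by (apply Rlt_div_r; lra).
  nra.
Qed.

Variables Di De : C -> C.
Hypothesis HD : szego_continuations w Di De.
Hypothesis Hrho : 0 <= rho w < 1.

Lemma cdiff_inv_Di (z : C) : rho w * Cmod z < 1 -> cdiff (fun z => / Di z)%C z.
Proof. intros Hz. apply cdiff_of_ex_derive. now apply HD. Qed.

Lemma cdiff_De (z : C) : rho w < Cmod z -> cdiff De z.
Proof. intros Hz. apply cdiff_of_ex_derive. now apply HD. Qed.

Lemma inv_Di_0 : (/ Di 0)%C = RtoC (tau w).
Proof.
  destruct HD as [H1 _]. rewrite H1 by (rewrite Cmod_0; lra).
  now rewrite szego_0, Cinv_Cinv.
Qed.

Lemma De_reflect (z : C) : 1 < Cmod z -> De z = Cconj (/ Di (/ Cconj z))%C.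
Proof.
  intros Hz. destruct HD as [H1 [H2 _]]. rewrite H2 by exact Hz.
  assert (Hz0 : z <> RtoC 0) by (apply Cmod_gt_0; lra).
  assert (Hc : Cconj z <> RtoC 0) by (apply Cmod_gt_0; rewrite Cmod_conj; lra).
  rewrite H1.
  - rewrite szego_reflect by (trivial; lra). now rewrite Cinv_Cinv, Cconj_conj.
  - rewrite Cmod_inv, Cmod_conj by exact Hc. rewrite <- Rinv_1.
    apply Rinv_lt_contravar; lra.
Qed.

Lemma Cconj_neq_0 (z : C) : z <> RtoC 0 -> Cconj z <> RtoC 0.
Proof. intros H. apply Cmod_gt_0. rewrite Cmod_conj. now apply Cmod_gt_0. Qed.

(** Inside the unit disc this is the reflection of the defining integrals; the identity theorem
    carries it across the unit circle, as far as [|z| = 1/r]. The reflected function says nothing at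
    0, hence the punctured disc in [identity_theorem]. *)
Lemma inv_Di_reflect (z : C) :
  0 < Cmod z -> rho w * Cmod z < 1 -> (/ Di z)%C = Cconj (De (/ Cconj z)%C).
Proof.
  intros Hz Hrz.
  set (f := fun z => (/ Di z - Cconj (De (/ Cconj z)))%C).
  assert (Hd : forall z, 0 < Cmod z -> rho w * Cmod z < 1 -> cdiff f z).
  { intros y Hy Hry. apply cdiff_minus; [now apply cdiff_inv_Di|].
    apply (cdiff_conj_conj (fun u => De (/ u)%C)).
    apply (cdiff_comp Cinv De).
    - apply cdiff_Cinv. apply Cconj_neq_0. now apply Cmod_gt_0.
    - apply cdiff_De. rewrite Cmod_inv, Cmod_conj by (apply Cconj_neq_0; now apply Cmod_gt_0).
      rewrite <- (Rmult_1_l (/ Cmod y)). apply Rlt_div_r; lra. }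
  assert (H0 : forall z, 0 < Cmod z < 1 -> f z = RtoC 0).
  { intros y Hy. assert (Hy0 : y <> RtoC 0) by (apply Cmod_gt_0; lra).
    assert (Hyc := Cconj_neq_0 _ Hy0). unfold f. rewrite De_reflect.
    - rewrite Cconj_conj, (Cinv_conj (Cconj y) Hyc), Cconj_conj, Cinv_Cinv. ring.
    - rewrite Cmod_inv, Cmod_conj by exact Hyc. rewrite <- Rinv_1.
      apply Rinv_lt_contravar; lra. }
  assert (E : f z = RtoC 0).
  { destruct (Rlt_le_dec (Cmod z) 1) as [H1|H1]; [now apply H0|].
    (* A disc beyond [z] in which both sides are holomorphic: of radius [1 / rho], or any larger
       radius than [|z|] when [rho = 0]. *)
    assert (exists B, Cmod z < B /\ rho w * B <= 1) as (B & HB1 & HB2).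
    { destruct (Req_dec (rho w) 0) as [E|E].
      - exists (Cmod z + 1). rewrite E. lra.
      - exists (/ rho w). split.
        + rewrite <- (Rmult_1_l (/ rho w)). apply Rlt_div_r; lra.
        + right. field. exact E. }
    apply (identity_theorem f 1 B); try lra; [|exact H0].
    intros y Hy. apply Hd; [lra|]. destruct Hrho. nra. }
  unfold f in E. replace (/ Di z)%C with (/ Di z - Cconj (De (/ Cconj z)) + Cconj (De (/ Cconj z)))%C
    by ring.
  rewrite E. ring.
Qed.

(** The points [s p] and [p / s] are mirror images, so for [s < 1] the product [X s] equals
    [1 / |D_i(s p)|^2]. It tends to [1 / w(p)] by the Poisson estimate, and to the product on the
    circle because both continuations are continuous there. *)
Lemma jump_relation (p : C) : Cmod p = 1 -> (/ Di p * De p * w p)%C = RtoC 1.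
Proof.
  intros Hp.
  set (X := fun s : R => (/ Di (s * p) * De (p * / s))%C).
  assert (Hp0 : p <> RtoC 0) by (apply Cmod_gt_0; lra).
  assert (HX : ccont X 1).
  { unfold X. apply ccont_mult.
    - apply (ccont_comp (U := C_UniformSpace) (fun s : R => s * p)%C (fun z => / Di z)%C).
      + apply (ccont_mult (fun s : R => RtoC s) (fun _ => p)); [|apply ccont_const].
        apply ccont_RtoC, continuous_id.
      + apply cdiff_ccont, cdiff_inv_Di. rewrite Cmult_1_l, Hp. lra.
    - apply (ccont_comp (U := C_UniformSpace) (fun s : R => p * / s)%C De).
      + apply (ccont_mult (fun _ => p) (fun s : R => / RtoC s)%C); [apply ccont_const|].
        apply ccont_inv; [apply ccont_RtoC, continuous_id|].
        apply Cmod_gt_0. rewrite Cmod_1. lra.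
      + apply cdiff_ccont, cdiff_De.
        replace (p * / 1)%C with p by field. lra. }
  assert (X1 : X 1 = (/ Di p * De p)%C).
  { unfold X. rewrite Cmult_1_l. do 2 f_equal. field. }
  assert (Xs : forall s, 0 < s < 1 -> X s = RtoC (exp (- (2 * Re (S (s * p)%C))))).
  { intros s Hs. unfold X. destruct HD as [H1 [H2 _]].
    assert (Hs0 : RtoC s <> RtoC 0) by (apply Cmod_gt_0; rewrite Cmod_R, Rabs_pos_eq; lra).
    assert (Hsp : Cmod (s * p) = s) by (rewrite Cmod_mult, Hp, Cmod_R, Rabs_pos_eq; lra).
    assert (Ep : (p * / s)%C = (/ Cconj (s * p))%C).
    { assert (E : (p * Cconj p)%C = RtoC 1) by (rewrite <- Cmod2_conj, Hp; f_equal; ring).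
      rewrite Cmult_conj. replace (Cconj s) with (RtoC s)
        by (unfold Cconj, RtoC; simpl; f_equal; ring).
      assert (Hcp := Cconj_neq_0 _ Hp0).
      replace p with (p * Cconj p * / Cconj p)%C at 1 by (field; exact Hcp).
      rewrite E. field. now split. }
    rewrite H1 by lra. rewrite H2.
    - rewrite Ep, szego_reflect by (first [lra | apply Cmod_gt_0; lra]).
      rewrite szego_S, exp_Ropp, RtoC_inv by (pose proof (exp_pos (2 * Re (S (s * p)%C))); lra).
      rewrite <- Cexp_mul_conj. now rewrite Cinv_Cmult.
    - rewrite Cmod_mult, Hp, Cmod_inv, Cmod_R, Rabs_pos_eq by (trivial; lra).
      rewrite Rmult_1_l. rewrite <- Rinv_1. apply Rinv_lt_contravar; lra. }
  assert (E : X 1 = RtoC (exp (- ln (w p)))).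
  { assert (D0 : (X 1 - RtoC (exp (- ln (w p))))%C = RtoC 0).
    (* The 3 is made of [2 * eps] from turning a ball into a modulus and [eps] from the continuity
       of [exp]. *)
    { apply (C0_of_eps _ 3); [lra|]. intros eps He.
      destruct (HX _ (locally_ball _ (mkposreal eps He))) as [d1 Hd1].
      assert (Cexp' : continuity_pt exp (- ln (w p)))
        by (apply derivable_continuous_pt, derivable_pt_exp).
      destruct (Cexp' eps He) as (a & Ha & Ka).
      destruct (szego_boundary p Hp (a / 2) ltac:(lra)) as (d2 & Hd2 & K2).
      pose proof (cond_pos d1).
      (* [s = 1 - m] is close enough to 1 for the continuity of [X] and for the boundary limit, and
         stays positive. *)
      set (m := Rmin (1 / 2) (Rmin (d1 / 2) (d2 / 2))).
      assert (m <= 1 / 2) by apply Rmin_l.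
      assert (m <= d1 / 2) by (eapply Rle_trans; [apply Rmin_r|]; apply Rmin_l).
      assert (m <= d2 / 2) by (eapply Rle_trans; [apply Rmin_r|]; apply Rmin_r).
      assert (0 < m) by (repeat apply Rmin_pos; lra).
      set (s := 1 - m).
      assert (B1 : ball (M := C_UniformSpace) (X 1) eps (X s)).
      { apply Hd1. change (Rabs (s - 1) < d1). unfold s. apply Rabs_def1; lra. }
      apply Cmod_of_ball with (e := mkposreal eps He) in B1. simpl in B1.
      assert (B2 := K2 s ltac:(unfold s; lra) ltac:(unfold s; lra)).
      rewrite Xs in B1 by (unfold s; lra).
      set (u := 2 * Re (S (s * p)%C)) in *.
      assert (B3 : Rabs (exp (- u) - exp (- ln (w p))) <= eps).
      { destruct (Req_dec (- u) (- ln (w p))) as [Q|Q].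
        - rewrite Q, Rminus_diag, Rabs_R0. lra.
        - left. apply (Ka (- u)). split.
          + split; [exact I|]. intros Q'. apply Q. now symmetry.
          + unfold dist; simpl. unfold Rdist.
            replace (- u - - ln (w p)) with (- (u - ln (w p))) by ring.
            rewrite Rabs_Ropp. lra. }
      replace (X 1 - exp (- ln (w p)))%C with
        (- (RtoC (exp (- u)) - X 1) + RtoC (exp (- u) - exp (- ln (w p))))%C
        by (rewrite RtoC_minus; ring).
      eapply Rle_trans; [apply Cmod_triangle|]. rewrite Cmod_opp, Cmod_R. lra. }
    replace (X 1) with (X 1 - RtoC (exp (- ln (w p))) + RtoC (exp (- ln (w p))))%C by ring.
    rewrite D0. ring. }
  rewrite <- X1, E, exp_Ropp, exp_ln by now apply Hw.
  rewrite <- RtoC_mult. f_equal. field. pose proof (Hw p Hp). lra.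
Qed.

End Szego.

(** * Finite sums *)

Definition csum (f : nat -> C) (n : nat) : C := sum_n (G := C_AbelianMonoid) f n.

Lemma csum_0 (f : nat -> C) : csum f 0 = f 0%nat.
Proof. apply (sum_O (G := C_AbelianMonoid)). Qed.

Lemma csum_S (f : nat -> C) (n : nat) : csum f (S n) = (csum f n + f (S n))%C.
Proof. apply (sum_Sn (G := C_AbelianMonoid)). Qed.

Lemma csum_ext (f g : nat -> C) (n : nat) :
  (forall k, (k <= n)%nat -> f k = g k) -> csum f n = csum g n.
Proof.
  induction n as [|n IH]; intros E.
  - rewrite !csum_0. now apply E.
  - rewrite !csum_S, IH, E by (intros; try apply E; lia). reflexivity.
Qed.

Lemma csum_zero (f : nat -> C) (n : nat) :
  (forall k, (k <= n)%nat -> f k = RtoC 0) -> csum f n = RtoC 0.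
Proof.
  induction n as [|n IH]; intros E.
  - rewrite csum_0. now apply E.
  - rewrite csum_S, IH, E by (intros; try apply E; lia). ring.
Qed.

Lemma csum_first (f : nat -> C) (n : nat) :
  (forall k, (0 < k <= n)%nat -> f k = RtoC 0) -> csum f n = f 0%nat.
Proof.
  induction n as [|n IH]; intros E.
  - apply csum_0.
  - rewrite csum_S, IH, (E (S n)) by (intros; try apply E; lia). ring.
Qed.

Lemma csum_last (f : nat -> C) (n : nat) :
  (forall k, (k < n)%nat -> f k = RtoC 0) -> csum f n = f n.
Proof.
  destruct n as [|n]; intros E.
  - apply csum_0.
  - rewrite csum_S, csum_zero by (intros; apply E; lia). ring.
Qed.

Lemma csum_mult_r (f : nat -> C) (c : C) (n : nat) :
  (csum f n * c)%C = csum (fun k => f k * c)%C n.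
Proof.
  induction n as [|n IH].
  - now rewrite !csum_0.
  - rewrite !csum_S, <- IH. ring.
Qed.

Lemma csum_conj (f : nat -> C) (n : nat) :
  Cconj (csum f n) = csum (fun k => Cconj (f k)) n.
Proof.
  induction n as [|n IH].
  - now rewrite !csum_0.
  - now rewrite !csum_S, Cplus_conj, IH.
Qed.

Lemma ccont_csum {T : UniformSpace} (f : nat -> T -> C) (n : nat) (x : T) :
  (forall k, (k <= n)%nat -> ccont (f k) x) -> ccont (fun t => csum (fun k => f k t) n) x.
Proof.
  unfold ccont. intros H. induction n as [|n IH].
  - apply (continuous_ext (f 0%nat)); [intros; symmetry; apply csum_0 | now apply H].
  - apply (continuous_ext (fun t => csum (fun k => f k t) n + f (S n) t)%C);
      [intros; symmetry; apply csum_S|].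
    apply ccont_plus; [apply IH; intros; apply H; lia | now apply H].
Qed.

Lemma cdiff_csum (f : nat -> C -> C) (n : nat) (x : C) :
  (forall k, (k <= n)%nat -> cdiff (f k) x) -> cdiff (fun t => csum (fun k => f k t) n) x.
Proof.
  intros H. induction n as [|n IH].
  - apply (cdiff_ext (f 0%nat)); [intros; symmetry; apply csum_0 | now apply H].
  - apply (cdiff_ext (fun t => csum (fun k => f k t) n + f (S n) t)%C);
      [intros; symmetry; apply csum_S|].
    apply cdiff_plus; [apply IH; intros; apply H; lia | now apply H].
Qed.

(** * Orthonormal polynomials *)

(** On the unit circle [|dz| = dz / (i z)], which makes Cauchy's theorem available for the inner
    product. *)
Lemma arclength_contour (f : C -> C) :
  arclength_unit_circle f = contour_circle 1 (fun t => f t * / (Ci * t))%C.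
Proof.
  unfold arclength_unit_circle, contour_circle.
  apply integral_C_ext. intros x _. simpl. rewrite Cmult_1_l. field.
  split; [apply cis_neq_0|].
  apply Cmod_gt_0. rewrite Cmod_Ci. lra.
Qed.

Lemma circle_cont_inv_it : circle_cont (fun t => / (Ci * t))%C 1.
Proof.
  intros z Hz. apply ccont_inv.
  - apply ccont_mult; [apply ccont_const | apply ccont_id].
  - apply Cmod_gt_0. rewrite Cmod_mult, Cmod_Ci. lra.
Qed.

Lemma arclength_ext (f g : C -> C) :
  (forall z, Cmod z = 1 -> f z = g z) -> arclength_unit_circle f = arclength_unit_circle g.
Proof. intros E. unfold arclength_unit_circle. apply integral_C_ext. intros x _. apply E, Cmod_cis. Qed.

Lemma arclength_plus (f g : C -> C) :
  circle_cont f 1 -> circle_cont g 1 ->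
  arclength_unit_circle (fun z => f z + g z)%C
  = (arclength_unit_circle f + arclength_unit_circle g)%C.
Proof.
  intros Hf Hg. rewrite !arclength_contour. pose proof circle_cont_inv_it.
  rewrite <- contour_plus by (try lra; now apply circle_cont_mult).
  apply contour_ext; [lra|]. intros; ring.
Qed.

Lemma arclength_scal (c : C) (f : C -> C) :
  circle_cont f 1 ->
  arclength_unit_circle (fun z => c * f z)%C = (c * arclength_unit_circle f)%C.
Proof.
  intros Hf. rewrite !arclength_contour. pose proof circle_cont_inv_it.
  rewrite <- contour_scal by (try lra; now apply circle_cont_mult).
  apply contour_ext; [lra|]. intros; ring.
Qed.

Lemma arclength_csum (f : nat -> C -> C) (c : nat -> C) (n : nat) :
  (forall k, circle_cont (f k) 1) ->
  arclength_unit_circle (fun z => csum (fun k => c k * f k z)%C n)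
  = csum (fun k => c k * arclength_unit_circle (f k))%C n.
Proof.
  intros Hf. induction n as [|n IH].
  - rewrite csum_0, <- arclength_scal by apply Hf. apply arclength_ext. intros; apply csum_0.
  - rewrite csum_S, <- IH, <- arclength_scal by apply Hf.
    rewrite <- arclength_plus.
    + apply arclength_ext. intros; apply csum_S.
    + intros z Hz. apply ccont_csum. intros k _. apply ccont_mult; [apply ccont_const|].
      now apply Hf.
    + now apply circle_cont_scal.
Qed.

Lemma Cmod_arclength_le (f : C -> C) (M : R) :
  circle_cont f 1 -> (forall z, Cmod z = 1 -> Cmod (f z) <= M) ->
  Cmod (arclength_unit_circle f) <= 2 * PI * M.
Proof.
  intros Hf HM. rewrite arclength_contour.
  replace (2 * PI * M) with (2 * PI * (1 * M)) by ring.
  apply Cmod_contour_le; [lra | apply circle_cont_mult; [exact Hf | apply circle_cont_inv_it] |].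
  intros z Hz.
  rewrite Cmod_mult, Cmod_inv, Cmod_mult, Cmod_Ci, Hz.
  - rewrite Rmult_1_l, Rinv_1, Rmult_1_r. now apply HM.
  - apply Cmod_gt_0. rewrite Cmod_mult, Cmod_Ci. lra.
Qed.

Lemma Cmult_conj_unit (z : C) : Cmod z = 1 -> (z * Cconj z)%C = RtoC 1.
Proof. intros H. rewrite <- Cmod2_conj, H. f_equal. ring. Qed.

Lemma Cpow_conj_unit (z : C) (j m : nat) :
  Cmod z = 1 -> (j <= m)%nat -> (z ^ j * Cconj z ^ m)%C = (Cconj z ^ (m - j))%C.
Proof.
  intros Hz Hj. replace m with (j + (m - j))%nat at 1 by lia.
  rewrite Cpow_add_r, Cmult_assoc, <- Cpow_mult_l, Cmult_conj_unit, Cpow_1_l by exact Hz. ring.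
Qed.

Section Orthonormal.
Variable w : C -> R.
Variable W : C -> C.
Hypothesis HWc : circle_cont W 1.
Hypothesis HWw : forall z, Cmod z = 1 -> W z = RtoC (w z).
Variable kappa : nat -> R.
Variable phi : nat -> C -> C.
Hypothesis Hphi : orthonormal_polynomials w kappa phi.

Lemma phi_coefficients (k : nat) :
  exists a : nat -> C, a k = RtoC (kappa k) /\
    forall z, phi k z = csum (fun j => a j * z ^ j)%C k.
Proof. destruct Hphi as [H _]. apply H. Qed.

Lemma circle_cont_phi (k : nat) : circle_cont (phi k) 1.
Proof.
  destruct (phi_coefficients k) as (a & _ & Ha). intros z _. unfold ccont.
  apply (continuous_ext (fun z => csum (fun j => a j * z ^ j)%C k)); [intros; now rewrite Ha|].
  apply (ccont_csum (T := C_UniformSpace)). intros j _.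
  apply ccont_mult; [apply ccont_const | apply ccont_pow, ccont_id].
Qed.

(** The moments of [phi m] against monomials. [W] replaces [w] in order to have a continuous
    integrand. *)
Let X (m i : nat) : C := arclength_unit_circle (fun z => phi m z * W z * Cconj z ^ i)%C.

Lemma circle_cont_moment (m i : nat) : circle_cont (fun z => phi m z * W z * Cconj z ^ i)%C 1.
Proof.
  apply circle_cont_mult.
  - apply circle_cont_mult; [apply circle_cont_phi | exact HWc].
  - intros z _. apply ccont_pow, ccont_conj, ccont_id.
Qed.

Lemma phi_moment_relation (m k : nat) (b : nat -> C) :
  (forall z, phi k z = csum (fun j => b j * z ^ j)%C k) ->
  csum (fun i => Cconj (b i) * X m i)%C k = RtoC (if Nat.eqb m k then 1 else 0).
Proof.
  intros Hb. destruct Hphi as [_ H]. rewrite <- H. unfold X.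
  rewrite <- (arclength_csum (fun i z => phi m z * W z * Cconj z ^ i)%C).
  - apply arclength_ext. intros z Hz. rewrite Hb, csum_conj, <- HWw by exact Hz.
    replace (phi m z * csum (fun k0 => Cconj (b k0 * z ^ k0)) k * W z)%C
      with (csum (fun k0 => Cconj (b k0 * z ^ k0)) k * (phi m z * W z))%C by ring.
    rewrite csum_mult_r. apply csum_ext. intros i _. rewrite Cmult_conj, Cpow_conj. ring.
  - intros i. apply circle_cont_moment.
Qed.

(** Orthonormality is stated against the [phi k]; the triangular system expressing them through
    monomials is solved by strong induction, its diagonal entries [kappa k] being positive. *)
Lemma phi_orthogonal (m k : nat) :
  (k <= m)%nat -> (kappa m * X m k)%C = RtoC (if Nat.eqb m k then 1 else 0).
Proof.
  assert (K : forall k, (k <= m)%nat ->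
     (kappa k * X m k)%C = RtoC (if Nat.eqb m k then 1 else 0)).
  { intros i. induction i as [i IH] using lt_wf_ind. intros Hi.
    destruct (phi_coefficients i) as (b & Hbi & Hb).
    rewrite <- (phi_moment_relation m i b Hb), csum_last.
    - rewrite Hbi. f_equal. unfold Cconj, RtoC; simpl. f_equal; ring.
    - intros j Hj. specialize (IH j Hj ltac:(lia)).
      replace (Nat.eqb m j) with false in IH by (symmetry; apply Nat.eqb_neq; lia).
      assert (Hk : RtoC (kappa j) <> RtoC 0).
      { destruct Hphi as [H _]. destruct (H j) as [Hp _].
        apply Cmod_gt_0. rewrite Cmod_R, Rabs_pos_eq; lra. }
      replace (X m j) with (kappa j * X m j * / kappa j)%C by (field; exact Hk).
      rewrite IH. ring. }
  intros Hk. destruct (Nat.eq_dec m k) as [->|Hne].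
  - now apply K.
  - specialize (K k Hk). replace (Nat.eqb m k) with false in * by (symmetry; apply Nat.eqb_neq; lia).
    assert (Hkk : RtoC (kappa k) <> RtoC 0).
    { destruct Hphi as [H _]. destruct (H k) as [Hp _].
      apply Cmod_gt_0. rewrite Cmod_R, Rabs_pos_eq; lra. }
    replace (X m k) with (kappa k * X m k * / kappa k)%C by (field; exact Hkk).
    rewrite K. ring.
Qed.

(* Evaluate the integral of [phi_m conj(z)^m q w] twice, expanding either [phi_m] or [q]. *)
Lemma leading_coefficient_estimate (m : nat) :
  exists A, 0 <= A /\ forall (q : C -> C) (p : nat -> C) (eps : R),
    circle_cont q 1 ->
    (forall j, (j <= m)%nat ->
       arclength_unit_circle (fun z => q z * W z * Cconj z ^ j)%C
       = RtoC (if Nat.eqb j 0 then 1 else 0)) ->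
    (forall z, Cmod z = 1 -> Cmod (q z - csum (fun l => p l * z ^ l)%C m) <= eps) ->
    Cmod (RtoC (kappa m ^ 2) - p 0%nat) <= A * eps.
Proof.
  assert (Hk : 0 < kappa m) by apply Hphi.
  pose proof PI_RGT_0.
  destruct (phi_coefficients m) as (a & Ham & Ha).
  set (g := fun z => (phi m z * W z * Cconj z ^ m)%C).
  assert (Cg : circle_cont g 1) by apply circle_cont_moment.
  destruct (circle_bounded g 1 ltac:(lra) Cg) as (M & HM0 & HM).
  (* The constant depends on [phi m] and the weight alone, so that one bound serves for all
     approximations [q]. *)
  exists (kappa m * (2 * PI * M)). split; [repeat (apply Rmult_le_pos; try lra)|].
  intros q p eps Cq Hq Hp.
  set (P := fun z => csum (fun l => p l * z ^ l)%C m).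
  assert (CP : circle_cont P 1).
  { intros z _. apply (ccont_csum (T := C_UniformSpace)). intros j _.
    apply ccont_mult; [apply ccont_const | apply ccont_pow, ccont_id]. }
  (* On the circle [phi_m(z) conj(z)^m] is the sum of [a_j conj(z)^(m-j)]; the moments of [q] leave
     only [j = m], with the coefficient [kappa m]. *)
  assert (E1 : arclength_unit_circle (fun z => g z * q z)%C = RtoC (kappa m)).
  { rewrite (arclength_ext _ (fun z => csum (fun j => a j * (q z * W z * Cconj z ^ (m - j))) m)%C).
    - rewrite (arclength_csum (fun j z => q z * W z * Cconj z ^ (m - j))%C).
      + rewrite csum_last.
        * rewrite Nat.sub_diag, Hq by lia. simpl. rewrite Ham. ring.
        * intros j Hj. rewrite Hq by lia.
          replace (Nat.eqb (m - j) 0) with false by (symmetry; apply Nat.eqb_neq; lia). ring.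
      + intros j. apply circle_cont_mult; [now apply circle_cont_mult|].
        intros z _. apply ccont_pow, ccont_conj, ccont_id.
    - intros z Hz. unfold g. rewrite Ha.
      replace (csum (fun j => a j * z ^ j) m * W z * Cconj z ^ m * q z)%C
        with (csum (fun j => a j * z ^ j) m * (W z * Cconj z ^ m * q z))%C by ring.
      rewrite csum_mult_r. apply csum_ext. intros j Hj.
      rewrite <- (Cpow_conj_unit z j m Hz Hj). ring. }
  (* Likewise [P(z) conj(z)^m] is a combination of [conj(z)^(m-l)], and orthogonality of [phi m]
     leaves only the constant coefficient, [l = 0]. *)
  assert (E2 : arclength_unit_circle (fun z => g z * P z)%C = (p 0%nat * / kappa m)%C).
  { assert (Hkc : RtoC (kappa m) <> RtoC 0)
      by (apply Cmod_gt_0; rewrite Cmod_R, Rabs_pos_eq; lra).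
    assert (HX : forall k, (k <= m)%nat ->
       X m k = (RtoC (if Nat.eqb m k then 1 else 0) * / kappa m)%C).
    { intros k Hkm. rewrite <- (phi_orthogonal m k Hkm). field. exact Hkc. }
    rewrite (arclength_ext _ (fun z => csum (fun l => p l * (phi m z * W z * Cconj z ^ (m - l))) m)%C).
    - rewrite (arclength_csum (fun l z => phi m z * W z * Cconj z ^ (m - l))%C).
      + rewrite csum_first.
        * fold (X m (m - 0)). rewrite HX, Nat.sub_0_r, Nat.eqb_refl by lia. ring.
        * intros l Hl. fold (X m (m - l)). rewrite HX by lia.
          replace (Nat.eqb m (m - l)) with false by (symmetry; apply Nat.eqb_neq; lia). ring.
      + intros l. apply circle_cont_moment.
    - intros z Hz. unfold g, P. rewrite Cmult_comm, csum_mult_r. apply csum_ext. intros l Hl.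
      rewrite <- (Cpow_conj_unit z l m Hz Hl). ring. }
  assert (E3 : (RtoC (kappa m) - p 0%nat * / kappa m)%C
               = arclength_unit_circle (fun z => g z * (q z - P z))%C).
  { rewrite (arclength_ext (fun z => g z * (q z - P z))%C
               (fun z => g z * q z + RtoC (-1) * (g z * P z))%C) by (intros; ring).
    rewrite arclength_plus, arclength_scal, E1, E2.
    - ring.
    - now apply circle_cont_mult.
    - now apply circle_cont_mult.
    - now apply circle_cont_scal, circle_cont_mult. }
  assert (Hkc : RtoC (kappa m) <> RtoC 0)
    by (apply Cmod_gt_0; rewrite Cmod_R, Rabs_pos_eq; lra).
  replace (RtoC (kappa m ^ 2) - p 0%nat)%C
    with (kappa m * (RtoC (kappa m) - p 0%nat * / kappa m))%C
    by (rewrite RtoC_pow; field; exact Hkc).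
  rewrite E3, Cmod_mult, Cmod_R, Rabs_pos_eq by lra.
  rewrite !Rmult_assoc. apply Rmult_le_compat_l; [lra|].
  rewrite <- Rmult_assoc. apply Cmod_arclength_le.
  - apply circle_cont_mult; [exact Cg|]. intros z Hz. apply ccont_minus; [now apply Cq | now apply CP].
  - intros z Hz. rewrite Cmod_mult.
    apply Rmult_le_compat; try apply Cmod_ge_0; [now apply HM | now apply Hp].
Qed.

End Orthonormal.

Lemma RtoC_neq_0 (x : R) : x <> 0 -> RtoC x <> RtoC 0.
Proof. intros H E. apply H. now apply RtoC_inj. Qed.

Lemma Ci_neq_0 : Ci <> RtoC 0.
Proof. apply Cmod_gt_0. rewrite Cmod_Ci. lra. Qed.

Lemma two_pi_i_neq_0 : (2 * PI * Ci)%C <> RtoC 0.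
Proof.
  pose proof PI_RGT_0.
  repeat apply Cmult_neq_0; [apply RtoC_neq_0; lra | apply RtoC_neq_0; lra | apply Ci_neq_0].
Qed.

Lemma Cmod_two_pi_i : Cmod (2 * PI * Ci) = 2 * PI.
Proof.
  pose proof PI_RGT_0. rewrite !Cmod_mult, Cmod_Ci, !Cmod_R, !Rabs_pos_eq; lra.
Qed.

(** * The iteration *)

Section Scattering.
Variables Di De : C -> C.
Variables tau r Lambda : R.
Variable n : nat.

Let F := scatF Di De.
Let g (k : nat) : C -> C := giter F tau r n (2 * k).
Let h (k : nat) : C -> C := giter F tau r n (2 * k + 1).

Hypothesis Hr : 0 < r < 1.
Hypothesis Htau : 0 < tau.
Hypothesis HI : forall z, Cmod z <= / r -> cdiff (fun z => / Di z)%C z.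
Hypothesis HE : forall z, r <= Cmod z -> cdiff De z.
Hypothesis HI0 : forall z, Cmod z <= 1 -> (/ Di z)%C <> RtoC 0.
Hypothesis HE0 : forall z, 1 <= Cmod z -> De z <> RtoC 0.
Hypothesis HEinf : vanishes_infty (fun z => De z - tau)%C.
Hypothesis HItau : (/ Di 0)%C = RtoC tau.
Hypothesis HFi : forall z, Cmod z = r -> Cmod (F z) <= Lambda.
Hypothesis HFe : forall z, Cmod z = / r -> Cmod (/ F z) <= Lambda.

Let theta := Lambda * r ^ n / (/ r - r).

Lemma inv_r_gt_1 : 1 < / r.
Proof. rewrite <- Rinv_1. apply Rinv_lt_contravar; lra. Qed.

Lemma Lambda_pos : 0 <= Lambda.
Proof.
  apply Rle_trans with (Cmod (F r)); [apply Cmod_ge_0|].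
  apply HFi. rewrite Cmod_R, Rabs_pos_eq; lra.
Qed.

Lemma theta_pos : 0 <= theta.
Proof.
  pose proof inv_r_gt_1. pose proof Lambda_pos. apply Rle_mult_inv_pos; [|lra].
  apply Rmult_le_pos; [lra | apply pow_le; lra].
Qed.

Lemma cdiff_F (z : C) : r <= Cmod z <= 1 -> cdiff F z.
Proof.
  pose proof inv_r_gt_1. intros Hz.
  apply (cdiff_ext (fun z => / / Di z * De z)%C).
  - intros y. now rewrite Cinv_Cinv.
  - apply cdiff_mult; [|apply HE; lra]. apply cdiff_inv; [apply HI; lra | apply HI0; lra].
Qed.

Lemma cdiff_inv_F (z : C) : 1 <= Cmod z <= / r -> cdiff (fun z => / F z)%C z.
Proof.
  intros Hz. apply (cdiff_ext (fun z => / Di z * / De z)%C).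
  - intros y. unfold F, scatF. now rewrite Cinv_Cmult.
  - apply cdiff_mult; [apply HI; lra|]. apply cdiff_inv; [apply HE; lra | apply HE0; lra].
Qed.

Let KI (t : C) : C := (F t * t ^ n)%C.
Let KE (t : C) : C := (/ (F t * t ^ n))%C.
Let cI : C := (- / (2 * PI * Ci * tau ^ 2))%C.
Let cE : C := (tau ^ 2 / (2 * PI * Ci))%C.

Lemma cdiff_KI (z : C) : r <= Cmod z <= 1 -> cdiff KI z.
Proof. intros Hz. apply cdiff_mult; [now apply cdiff_F | apply cdiff_pow, cdiff_id]. Qed.

Lemma cdiff_KE (z : C) : 1 <= Cmod z <= / r -> cdiff KE z.
Proof.
  intros Hz. apply (cdiff_ext (fun z => / F z * / z ^ n)%C).
  - intros y. unfold KE. now rewrite Cinv_Cmult.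
  - apply cdiff_mult; [now apply cdiff_inv_F|].
    apply cdiff_inv; [apply cdiff_pow, cdiff_id|]. apply Cpow_nz, Cmod_gt_0; lra.
Qed.

Lemma circle_cont_KI : circle_cont KI r.
Proof. intros z Hz. apply cdiff_ccont, cdiff_KI; lra. Qed.

Lemma circle_cont_KE : circle_cont KE (/ r).
Proof. pose proof inv_r_gt_1. intros z Hz. apply cdiff_ccont, cdiff_KE; lra. Qed.

Lemma Cmod_KI_le (z : C) : Cmod z = r -> Cmod (KI z) <= Lambda * r ^ n.
Proof.
  intros Hz. unfold KI. rewrite Cmod_mult, Cmod_pow, Hz.
  apply Rmult_le_compat_r; [apply pow_le; lra | now apply HFi].
Qed.

Lemma Cmod_KE_le (z : C) : Cmod z = / r -> Cmod (KE z) <= Lambda * r ^ n.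
Proof.
  pose proof inv_r_gt_1. intros Hz. unfold KE. rewrite Cinv_Cmult, Cmod_mult.
  rewrite (Cmod_inv (z ^ n)%C) by (apply Cpow_nz, Cmod_gt_0; lra).
  rewrite Cmod_pow, Hz, pow_inv, Rinv_inv.
  apply Rmult_le_compat_r; [apply pow_le; lra | now apply HFe].
Qed.

Lemma Mi_cauchy (f : C -> C) (z : C) :
  circle_cont f r ->
  Mi F tau r n f z = (cI * cauchy_transform r (fun t => f t * KI t) z)%C.
Proof.
  intros Hf. unfold Mi, cauchy_transform. fold cI. f_equal. apply contour_ext; [lra|].
  intros t Ht. rewrite ext_bv_cont by (first [lra | now apply Hf]).
  unfold KI, Cdiv. ring.
Qed.

Lemma Me_cauchy (f : C -> C) (z : C) :
  circle_cont f (/ r) ->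
  Me F tau r n f z = (cE * cauchy_transform (/ r) (fun t => f t * KE t) z)%C.
Proof.
  intros Hf. pose proof inv_r_gt_1. unfold Me, cauchy_transform. fold cE. f_equal.
  apply contour_ext; [lra|].
  intros t Ht. rewrite ext_bv_cont by (first [lra | now apply Hf]).
  unfold KE, Cdiv. rewrite Cinv_Cmult. ring.
Qed.

Lemma g_0 (z : C) : g 0 z = RtoC 1.
Proof. reflexivity. Qed.

Lemma h_unfold (k : nat) : h k = Me F tau r n (g k).
Proof.
  unfold h, g. rewrite Nat.add_1_r. cbn [giter]. now rewrite Nat.even_even.
Qed.

Lemma g_unfold (k : nat) : g (S k) = Mi F tau r n (h k).
Proof.
  unfold h, g. replace (2 * S k)%nat with (S (2 * k + 1)) by lia. cbn [giter].
  now rewrite Nat.even_odd.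
Qed.

(** Each operator yields a Cauchy transform over its own circle, holomorphic off it and hence on the
    circle of the other operator; the two statements feed each other in the induction. *)
Lemma cdiff_g_h (k : nat) :
  (forall z, Cmod z <> r -> cdiff (g k) z) /\ (forall z, Cmod z <> / r -> cdiff (h k) z).
Proof.
  pose proof inv_r_gt_1.
  assert (Hh : forall k, (forall z, Cmod z <> r -> cdiff (g k) z) ->
                         (forall z, Cmod z <> / r -> cdiff (h k) z)).
  { intros j Hg z Hz.
    assert (Cg : circle_cont (g j) (/ r)) by (intros t Ht; apply cdiff_ccont, Hg; lra).
    rewrite h_unfold. apply (cdiff_ext (fun z => cE * cauchy_transform (/ r) (fun t => g j t * KE t) z)%C).
    - intros y. symmetry. now apply Me_cauchy.
    - apply cdiff_mult; [apply cdiff_const|]. apply cdiff_cauchy_transform; [lra| |exact Hz].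
      apply circle_cont_mult; [exact Cg | apply circle_cont_KE]. }
  induction k as [|k [IHg IHh]].
  - assert (H0 : forall z, Cmod z <> r -> cdiff (g 0) z).
    { intros z _. apply (cdiff_ext (fun _ => RtoC 1)); [reflexivity | apply cdiff_const]. }
    auto.
  - assert (H0 : forall z, Cmod z <> r -> cdiff (g (S k)) z).
    { intros z Hz.
      assert (Ch : circle_cont (h k) r) by (intros t Ht; apply cdiff_ccont, IHh; lra).
      rewrite g_unfold. apply (cdiff_ext (fun z => cI * cauchy_transform r (fun t => h k t * KI t) z)%C).
      - intros y. symmetry. now apply Mi_cauchy.
      - apply cdiff_mult; [apply cdiff_const|]. apply cdiff_cauchy_transform; [lra| |exact Hz].
        apply circle_cont_mult; [exact Ch | apply circle_cont_KI]. }
    auto.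
Qed.

Lemma circle_cont_g (k : nat) : circle_cont (g k) (/ r).
Proof. pose proof inv_r_gt_1. intros t Ht. apply cdiff_ccont, cdiff_g_h; lra. Qed.

Lemma circle_cont_h (k : nat) : circle_cont (h k) r.
Proof. pose proof inv_r_gt_1. intros t Ht. apply cdiff_ccont, cdiff_g_h; lra. Qed.

Lemma h_cauchy (k : nat) (z : C) :
  h k z = (cE * cauchy_transform (/ r) (fun t => g k t * KE t) z)%C.
Proof. rewrite h_unfold. apply Me_cauchy, circle_cont_g. Qed.

Lemma g_cauchy (k : nat) (z : C) :
  g (S k) z = (cI * cauchy_transform r (fun t => h k t * KI t) z)%C.
Proof. rewrite g_unfold. apply Mi_cauchy, circle_cont_h. Qed.

Lemma Cmod_cI : Cmod cI = / (2 * PI * tau ^ 2).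
Proof.
  pose proof PI_RGT_0.
  assert (Ht2 : (RtoC tau ^ 2)%C <> RtoC 0) by (apply Cpow_nz, RtoC_neq_0; lra).
  unfold cI. rewrite Cmod_opp, Cmod_inv by (apply Cmult_neq_0; [apply two_pi_i_neq_0 | exact Ht2]).
  rewrite Cmod_mult, Cmod_two_pi_i, Cmod_pow, Cmod_R, Rabs_pos_eq by lra. reflexivity.
Qed.

Lemma Cmod_cE : Cmod cE = tau ^ 2 / (2 * PI).
Proof.
  unfold cE. rewrite Cmod_div by apply two_pi_i_neq_0.
  rewrite Cmod_two_pi_i, Cmod_pow, Cmod_R, Rabs_pos_eq by lra. reflexivity.
Qed.

(** The distance [d] is left free because the bound is needed on two circles: on [|z| = 1/r] for the
    iteration, and on a circle [|z| = s] with [1 < s < 1/r] for the error of [q]. *)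
Lemma Cmod_g_le (k : nat) (z : C) (d M : R) :
  (forall t, Cmod t = r -> Cmod (h k t) <= M) -> 0 < d <= Rabs (r - Cmod z) ->
  Cmod (g (S k) z) <= r * Lambda * r ^ n * M / (tau ^ 2 * d).
Proof.
  intros HM Hd. pose proof PI_RGT_0. rewrite g_cauchy, Cmod_mult, Cmod_cI.
  assert (0 < tau ^ 2) by now apply pow_lt.
  apply Rle_trans with (/ (2 * PI * tau ^ 2) * (2 * PI * (r * (M * (Lambda * r ^ n) / d)))).
  - apply Rmult_le_compat_l.
    + left. apply Rinv_0_lt_compat. apply Rmult_lt_0_compat; lra.
    + apply Cmod_cauchy_transform_le; [lra | | | exact Hd].
      * apply circle_cont_mult; [apply circle_cont_h | apply circle_cont_KI].
      * intros t Ht. rewrite Cmod_mult.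
        apply Rmult_le_compat; try apply Cmod_ge_0; [now apply HM | now apply Cmod_KI_le].
  - right. field. lra.
Qed.

Lemma Cmod_h_le (k : nat) (M : R) :
  (forall t, Cmod t = / r -> Cmod (g k t) <= M) ->
  forall z, Cmod z = r -> Cmod (h k z) <= tau ^ 2 / r * theta * M.
Proof.
  intros HM z Hz. pose proof PI_RGT_0. pose proof inv_r_gt_1.
  rewrite h_cauchy, Cmod_mult, Cmod_cE.
  assert (0 < tau ^ 2) by now apply pow_lt.
  apply Rle_trans with (tau ^ 2 / (2 * PI) * (2 * PI * (/ r * (M * (Lambda * r ^ n) / (/ r - r))))).
  - apply Rmult_le_compat_l.
    + apply Rle_mult_inv_pos; lra.
    + apply Cmod_cauchy_transform_le; [lra | | |].
      * apply circle_cont_mult; [apply circle_cont_g | apply circle_cont_KE].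
      * intros t Ht. rewrite Cmod_mult.
        apply Rmult_le_compat; try apply Cmod_ge_0; [now apply HM | now apply Cmod_KE_le].
      * rewrite Hz, Rabs_pos_eq; lra.
  - right. unfold theta. field. repeat split; try lra. nra.
Qed.

(** A double step multiplies the bound by [tau^2 / r * theta] and by [r / tau^2 * theta]; the
    prefactors cancel and [theta^2] remains. *)
Lemma Cmod_g_le_theta (k : nat) (z : C) : Cmod z = / r -> Cmod (g k z) <= theta ^ (2 * k).
Proof.
  pose proof inv_r_gt_1. revert z. induction k as [|k IH]; intros z Hz.
  - rewrite g_0, Cmod_1. simpl. lra.
  - eapply Rle_trans.
    + apply (Cmod_g_le k z (/ r - r) (tau ^ 2 / r * theta * theta ^ (2 * k))).
      * now apply Cmod_h_le.
      * rewrite Hz, Rabs_left; lra.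
    + right. replace (2 * S k)%nat with (2 + 2 * k)%nat by lia. rewrite pow_add.
      set (X := theta ^ (2 * k)). unfold theta. field. repeat split; try lra. nra.
Qed.

(** * Partial sums of the iterates *)

Let G (N : nat) (z : C) : C := csum (fun k => g k z) N.
Let H (N : nat) (z : C) : C := csum (fun k => h k z) N.

Lemma cdiff_G (N : nat) (z : C) : Cmod z <> r -> cdiff (G N) z.
Proof. intros Hz. apply cdiff_csum. intros k _. now apply cdiff_g_h. Qed.

Lemma cdiff_H (N : nat) (z : C) : Cmod z <> / r -> cdiff (H N) z.
Proof. intros Hz. apply cdiff_csum. intros k _. now apply cdiff_g_h. Qed.

Lemma G_S (N : nat) (z : C) : G (S N) z = (G N z + g (S N) z)%C.
Proof. apply csum_S. Qed.

Lemma cauchy_transform_csum (f : nat -> C -> C) (K : C -> C) (s : R) (N : nat) (z : C) :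
  0 <= s -> Cmod z <> s -> (forall k, circle_cont (f k) s) -> circle_cont K s ->
  cauchy_transform s (fun t => csum (fun k => f k t) N * K t)%C z
  = csum (fun k => cauchy_transform s (fun t => f k t * K t)%C z) N.
Proof.
  intros Hs Hz Hf HK. induction N as [|N IH].
  - rewrite csum_0. apply contour_ext; [exact Hs|]. intros t _. now rewrite csum_0.
  - rewrite csum_S, <- IH. unfold cauchy_transform.
    assert (Ck := circle_cont_kernel z s Hz).
    rewrite <- contour_plus; [apply contour_ext; [exact Hs|] | exact Hs | |].
    + intros t _. rewrite csum_S. unfold Cdiv. ring.
    + apply circle_cont_mult; [|exact Ck]. apply circle_cont_mult; [|exact HK].
      intros t Ht. apply ccont_csum. intros k _. now apply Hf.
    + apply circle_cont_mult; [|exact Ck]. now apply circle_cont_mult.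
Qed.

Lemma H_cauchy (N : nat) (z : C) : Cmod z <> / r ->
  H N z = (cE * cauchy_transform (/ r) (fun t => G N t * KE t) z)%C.
Proof.
  pose proof inv_r_gt_1. intros Hz.
  transitivity (cE * csum (fun k => cauchy_transform (/ r) (fun t => g k t * KE t)%C z) N)%C.
  - rewrite Cmult_comm, csum_mult_r. apply csum_ext. intros k _. rewrite h_cauchy. ring.
  - f_equal. symmetry. apply cauchy_transform_csum; [lra | exact Hz | apply circle_cont_g | apply circle_cont_KE].
Qed.

(** The 1 is [g^(0)]; the other terms are images of the [h k], whence the shift from [N] to
    [S N]. *)
Lemma G_cauchy (N : nat) (z : C) : Cmod z <> r ->
  G (S N) z = (1 + cI * cauchy_transform r (fun t => H N t * KI t) z)%C.
Proof.
  intros Hz.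
  transitivity (1 + cI * csum (fun k => cauchy_transform r (fun t => h k t * KI t)%C z) N)%C.
  - induction N as [|N IH].
    + rewrite G_S, csum_0, <- g_cauchy. unfold G. now rewrite csum_0, g_0.
    + rewrite G_S, IH, csum_S, Cmult_plus_distr_l, <- g_cauchy. ring.
  - do 2 f_equal. symmetry. apply cauchy_transform_csum; [lra | exact Hz | apply circle_cont_h | apply circle_cont_KI].
Qed.

Lemma circle_cont_H (N : nat) : circle_cont (H N) r.
Proof. pose proof inv_r_gt_1. intros t Ht. apply cdiff_ccont, cdiff_H; lra. Qed.

Lemma vanishes_G (N : nat) : vanishes_infty (fun z => G (S N) z - 1)%C.
Proof.
  apply (vanishes_ext (fun z => cauchy_transform r (fun t => H N t * KI t)%C z * cI)%C _ 1).
  - intros z Hz. rewrite G_cauchy by lra. ring.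
  - apply vanishes_mult.
    + apply vanishes_cauchy_transform; [lra|].
      apply circle_cont_mult; [apply circle_cont_H | apply circle_cont_KI].
    + exists (Cmod cI), 0. intros; lra.
Qed.

(** * The approximate kernel and its continuation by moving contours *)

Let q (N : nat) (z : C) : C :=
  (/ (2 * PI) * (tau * (/ Di z) * G (S N) z - / tau * (De z * z ^ n * H N z)))%C.

Lemma cdiff_q (N : nat) (z : C) : r < Cmod z < / r -> cdiff (q N) z.
Proof.
  intros Hz. apply cdiff_mult; [apply cdiff_const|]. apply cdiff_minus.
  - apply cdiff_mult; [|apply cdiff_G; lra].
    apply cdiff_mult; [apply cdiff_const | apply HI; lra].
  - apply cdiff_mult; [apply cdiff_const|]. apply cdiff_mult; [|apply cdiff_H; lra].
    apply cdiff_mult; [apply HE; lra | apply cdiff_pow, cdiff_id].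
Qed.

(* Pushing the contours of [Mi] outwards and of [Me] inwards, past [z], removes the
   jump of the corresponding summand of [q]. *)
Let Gin (s : R) (N : nat) (z : C) : C :=
  (1 + cI * cauchy_transform s (fun t => H N t * KI t) z)%C.
Let Hout (s : R) (N : nat) (z : C) : C :=
  (cE * cauchy_transform s (fun t => G N t * KE t) z)%C.

Lemma circle_cont_HKI (s : R) (N : nat) : r < s < 1 -> circle_cont (fun t => H N t * KI t)%C s.
Proof.
  pose proof inv_r_gt_1. intros Hs t Ht.
  apply cdiff_ccont, cdiff_mult; [apply cdiff_H | apply cdiff_KI]; lra.
Qed.

Lemma circle_cont_GKE (s : R) (N : nat) : 1 < s < / r -> circle_cont (fun t => G N t * KE t)%C s.
Proof.
  intros Hs t Ht. apply cdiff_ccont, cdiff_mult; [apply cdiff_G | apply cdiff_KE]; lra.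
Qed.

(** Moving the contour from [r] to [s] past [z] adds the residue [- H_N F z^n / tau^2] to [G_{N+1}].
    Multiplied by [tau I], with [I F = E], this is exactly the second summand of [q], which is
    thereby absorbed. *)
Lemma q_inside (s : R) (N : nat) (z : C) : r < Cmod z < s -> s < 1 ->
  q N z = (/ (2 * PI) * (tau * (/ Di z) * Gin s N z))%C.
Proof.
  intros Hz Hs. pose proof inv_r_gt_1. pose proof PI_RGT_0.
  assert (E := cauchy_formula_annulus (fun t => H N t * KI t)%C r s z ltac:(lra) Hz
    ltac:(intros y Hy; apply cdiff_mult; [apply cdiff_H; lra | apply cdiff_KI; lra])).
  cbv beta in E.
  assert (HD : (/ Di z)%C <> RtoC 0) by (apply HI0; lra).
  assert (Di z <> RtoC 0) by (intros Q; apply HD; rewrite Q; apply Cinv_0).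
  assert (Ht : RtoC tau <> RtoC 0) by (apply RtoC_neq_0; lra).
  unfold q, Gin. rewrite G_cauchy by lra.
  change (contour_circle s (fun t => H N t * KI t / (t - z))%C)
    with (cauchy_transform s (fun t => H N t * KI t)%C z) in E.
  change (contour_circle r (fun t => H N t * KI t / (t - z))%C)
    with (cauchy_transform r (fun t => H N t * KI t)%C z) in E.
  replace (cauchy_transform s (fun t => H N t * KI t)%C z)
    with (cauchy_transform r (fun t => H N t * KI t)%C z + 2 * PI * Ci * (H N z * KI z))%C
    by (rewrite <- E; ring).
  unfold cI, KI, F, scatF. field.
  repeat split; auto using Ci_neq_0; apply RtoC_neq_0; lra.
Qed.

(** Moving the contour from [1/r] to [s] takes the residue [tau^2 G_N / (F z^n)] out of [H_N].
    Multiplied by [E z^n / tau], with [E / F = I], it becomes [tau I G_N], and of [tau I G_{N+1}]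
    only the last iterate survives. *)
Lemma q_outside (s : R) (N : nat) (z : C) : s < Cmod z < / r -> 1 < s ->
  q N z = (/ (2 * PI) * (tau * (/ Di z) * g (S N) z)
           - / (2 * PI) * (/ tau * (De z * z ^ n * Hout s N z)))%C.
Proof.
  intros Hz Hs. pose proof inv_r_gt_1. pose proof PI_RGT_0.
  assert (E := cauchy_formula_annulus (fun t => G N t * KE t)%C s (/ r) z ltac:(lra) Hz
    ltac:(intros y Hy; apply cdiff_mult; [apply cdiff_G; lra | apply cdiff_KE; lra])).
  cbv beta in E.
  assert (HD : De z <> RtoC 0) by (apply HE0; lra).
  assert (Ht : RtoC tau <> RtoC 0) by (apply RtoC_neq_0; lra).
  assert (Hzn : (z ^ n)%C <> RtoC 0) by (apply Cpow_nz, Cmod_gt_0; lra).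
  unfold q, Hout. rewrite H_cauchy, G_S by lra.
  change (contour_circle s (fun t => G N t * KE t / (t - z))%C)
    with (cauchy_transform s (fun t => G N t * KE t)%C z) in E.
  change (contour_circle (/ r) (fun t => G N t * KE t / (t - z))%C)
    with (cauchy_transform (/ r) (fun t => G N t * KE t)%C z) in E.
  replace (cauchy_transform (/ r) (fun t => G N t * KE t)%C z)
    with (cauchy_transform s (fun t => G N t * KE t)%C z + 2 * PI * Ci * (G N z * KE z))%C
    by (rewrite <- E; ring).
  unfold cE, KE, F, scatF. rewrite !Cinv_Cmult. set (I := (/ Di z)%C). field.
  repeat split; auto using Ci_neq_0; apply RtoC_neq_0; lra.
Qed.

(** The powers [t^n] cancel; what is left is holomorphic outside and [o(1/t)] at infinity, since
    [De] is bounded there, the Cauchy transform vanishes and the kernel contributes one factor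
    [1/t]. *)
Lemma q_outside_part (s t0 : R) (N : nat) (z : C) :
  1 < s < t0 -> t0 < / r -> Cmod z = 1 ->
  contour_circle t0 (fun t => / (2 * PI) * (/ tau * (De t * t ^ n * Hout s N t))
                              * (/ t ^ n * / (t - z)))%C = RtoC 0.
Proof.
  intros Hs Ht0 Hz.
  assert (CT : circle_cont (fun t => G N t * KE t)%C s) by (apply circle_cont_GKE; lra).
  set (c := (/ (2 * PI) * / tau * cE)%C).
  set (f := fun t => (c * (De t * cauchy_transform s (fun t => G N t * KE t)%C t) * / (t - z))%C).
  rewrite (contour_ext _ f).
  - apply cauchy_exterior; [lra| |].
    + intros t Ht. apply cdiff_mult.
      * apply cdiff_mult; [apply cdiff_const|]. apply cdiff_mult; [apply HE; lra|].
        apply cdiff_cauchy_transform; [lra | exact CT | lra].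
      * apply cdiff_inv; [apply cdiff_minus; [apply cdiff_id | apply cdiff_const]|].
        apply Cminus_neq_0_Cmod; lra.
    + apply (vanishes_ext (fun t => cauchy_transform s (fun t => G N t * KE t)%C t * De t
                                    * (t / (t - z)) * c)%C _ 0).
      * intros t _. unfold f, Cdiv. ring.
      * repeat apply vanishes_mult.
        -- apply vanishes_cauchy_transform; [lra | exact CT].
        -- apply (bounded_of_limit _ (RtoC tau)), HEinf.
        -- apply bounded_kernel.
        -- exists (Cmod c), 0. intros; lra.
  - lra.
  - intros t Ht. unfold f, c, Hout.
    assert (Htn : (t ^ n)%C <> RtoC 0) by (apply Cpow_nz, Cmod_gt_0; lra).
    assert ((t - z)%C <> RtoC 0) by (apply Cminus_neq_0_Cmod; lra).
    pose proof PI_RGT_0.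
    field. repeat split; trivial; apply RtoC_neq_0; lra.
Qed.

(** The origin lies inside both circles, so no residue is crossed and the moved contour gives the
    original value. *)
Lemma Gin_0 (s : R) (N : nat) : r < s < 1 -> Gin s N 0 = G (S N) 0.
Proof.
  intros Hs. pose proof inv_r_gt_1. rewrite G_cauchy by (rewrite Cmod_0; lra).
  unfold Gin, cauchy_transform. do 2 f_equal. symmetry. apply cauchy_annulus; [lra|lra|].
  intros z Hz. apply cdiff_div.
  - apply cdiff_mult; [apply cdiff_H | apply cdiff_KI]; lra.
  - apply cdiff_minus; [apply cdiff_id | apply cdiff_const].
  - apply Cminus_neq_0_Cmod. rewrite Cmod_0. lra.
Qed.

Lemma cdiff_q_inside (s : R) (N : nat) (z : C) :
  r < s < 1 -> Cmod z < s -> cdiff (fun z => / (2 * PI) * (tau * (/ Di z) * Gin s N z))%C z.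
Proof.
  intros Hs Hz. pose proof inv_r_gt_1. apply cdiff_mult; [apply cdiff_const|].
  apply cdiff_mult.
  - apply cdiff_mult; [apply cdiff_const | apply HI; lra].
  - apply cdiff_plus; [apply cdiff_const|]. apply cdiff_mult; [apply cdiff_const|].
    apply cdiff_cauchy_transform; [lra | now apply circle_cont_HKI | lra].
Qed.

(** * Approximation of the kernel by polynomials on the unit circle *)

Lemma contour_expand (f : C -> C) (s : R) (p : C) (m : nat) :
  0 < s -> circle_cont f s -> Cmod p <> s ->
  contour_circle s (fun t => f t / (t - p))%C
  = (csum (fun l => contour_circle s (fun t => f t * / t ^ S l) * p ^ l) m
     + p ^ S m * contour_circle s (fun t => f t * (/ t ^ S m * / (t - p))))%C.
Proof.
  intros Hs Hf Hp.
  assert (E0 : contour_circle s (fun t => f t / (t - p))%C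
               = contour_circle s (fun t => f t * (/ t ^ 0 * / (t - p)))%C).
  { apply contour_ext; [lra|]. intros t Ht. simpl. field. apply Cminus_neq_0_Cmod; lra. }
  rewrite E0. induction m as [|m IH].
  - rewrite csum_0, contour_kernel_step by assumption. simpl. ring.
  - rewrite IH, csum_S, (contour_kernel_step f s p (S m)) by assumption. simpl. ring.
Qed.

(** Laurent coefficients of [q N] with nonnegative index; for these the choice of the circle is
    immaterial within [r < |z| < 1/r]. *)
Let pcoef (s : R) (N l : nat) : C :=
  (/ (2 * PI * Ci) * contour_circle s (fun t => q N t * / t ^ S l))%C.

Lemma pcoef_0 (s : R) (N : nat) : 1 < s < / r ->
  pcoef s N 0 = (tau ^ 2 / (2 * PI) * G (S N) 0)%C.
Proof.
  intros Hs. pose proof inv_r_gt_1. pose proof PI_RGT_0.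
  (* The integral runs over [|z| = s1], inside the contour [s2] on which [Gin] is based, so that the
     continued function is holomorphic on the closed disc of radius [s1]. *)
  set (s1 := (2 * r + 1) / 3). set (s2 := (r + 2) / 3).
  assert (Hs1 : r < s1 /\ s1 < s2 /\ s2 < 1) by (unfold s1, s2; lra).
  unfold pcoef.
  rewrite <- (cauchy_annulus _ s1 s); [|lra|lra|].
  - set (q0 := fun z => (/ (2 * PI) * (tau * (/ Di z) * Gin s2 N z))%C).
    rewrite (contour_ext _ (fun t => q0 t / t)%C); [|lra|].
    + rewrite cauchy_mean_value.
      * unfold q0. rewrite Gin_0, HItau by lra.
        field. split; [apply RtoC_neq_0; lra | apply Ci_neq_0].
      * lra.
      * intros z Hz. apply cdiff_q_inside; lra.
    + intros z Hz. rewrite (q_inside s2) by lra. unfold q0, Cdiv. simpl. now rewrite Cmult_1_r.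
  - intros z Hz. apply cdiff_mult; [apply cdiff_q; lra|]. apply cdiff_inv.
    + apply (cdiff_pow (fun t => t) 1), cdiff_id.
    + apply Cpow_nz, Cmod_gt_0; lra.
Qed.

(** Cauchy's formula in an annulus around the unit circle. The inner integral vanishes by
    [q_inside]; expanding the outer kernel to order [n] splits off a polynomial of degree
    [m = n - 1], and in the remainder [q_outside] leaves only the iterate [g (S N)]. *)
Lemma q_expansion (s : R) (N m : nat) (z : C) :
  1 < s < / r -> n = S m -> Cmod z = 1 ->
  (q N z - csum (fun l => pcoef s N l * z ^ l) m)%C
  = (/ (2 * PI * Ci) * z ^ n * contour_circle s (fun t =>
       / (2 * PI) * (tau * (/ Di t) * g (S N) t) * (/ t ^ n * / (t - z))))%C.
Proof.
  intros Hs Hnm Hz. pose proof inv_r_gt_1. pose proof PI_RGT_0.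
  (* [s1] and [s] bound the annulus; [s2] lies outside [s1] as the contour of [Gin], and [s3] lies
     between 1 and [s] as that of [Hout]. *)
  set (s1 := (2 * r + 1) / 3). set (s2 := (r + 2) / 3). set (s3 := (1 + s) / 2).
  assert (Hs1 : r < s1 /\ s1 < s2 /\ s2 < 1 /\ 1 < s3 < s) by (unfold s1, s2, s3; lra).
  assert (Hq := cauchy_formula_annulus (q N) s1 s z ltac:(lra) ltac:(lra)
                  ltac:(intros y Hy; apply cdiff_q; lra)).
  assert (Z1 : contour_circle s1 (fun t => q N t / (t - z))%C = RtoC 0).
  { set (q0 := fun z => (/ (2 * PI) * (tau * (/ Di z) * Gin s2 N z))%C).
    rewrite (contour_ext _ (fun t => q0 t / (t - z))%C); [|lra|].
    - apply cauchy_disc; [lra|]. intros t Ht. apply cdiff_div.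
      + apply cdiff_q_inside; lra.
      + apply cdiff_minus; [apply cdiff_id | apply cdiff_const].
      + apply Cminus_neq_0_Cmod; lra.
    - intros t Ht. now rewrite (q_inside s2) by lra. }
  assert (Cq : circle_cont (q N) s) by (intros t Ht; apply cdiff_ccont, cdiff_q; lra).
  rewrite Z1, (contour_expand (q N) s z m) in Hq by (trivial; lra). rewrite <- Hnm in Hq.
  assert (Ck : circle_cont (fun t => / t ^ n * / (t - z))%C s).
  { apply circle_cont_mult; [|apply circle_cont_kernel; lra].
    intros t Ht. apply ccont_inv; [apply ccont_pow, ccont_id|]. apply Cpow_nz, Cmod_gt_0; lra. }
  assert (C1 : circle_cont (fun t => / (2 * PI) * (tau * (/ Di t) * g (S N) t))%C s).
  { intros t Ht. apply cdiff_ccont, cdiff_mult; [apply cdiff_const|].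
    apply cdiff_mult; [|apply cdiff_g_h; lra].
    apply cdiff_mult; [apply cdiff_const | apply HI; lra]. }
  assert (C2 : circle_cont (fun t => / (2 * PI) * (/ tau * (De t * t ^ n * Hout s3 N t)))%C s).
  { intros t Ht. apply cdiff_ccont, cdiff_mult; [apply cdiff_const|].
    apply cdiff_mult; [apply cdiff_const|]. apply cdiff_mult.
    - apply cdiff_mult; [apply HE; lra | apply cdiff_pow, cdiff_id].
    - apply cdiff_mult; [apply cdiff_const|].
      apply cdiff_cauchy_transform; [lra | apply circle_cont_GKE; lra | lra]. }
  assert (E : contour_circle s (fun t => q N t * (/ t ^ n * / (t - z)))%C
    = contour_circle s (fun t =>
        / (2 * PI) * (tau * (/ Di t) * g (S N) t) * (/ t ^ n * / (t - z)))%C).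
  { rewrite (contour_ext _ (fun t =>
        / (2 * PI) * (tau * (/ Di t) * g (S N) t) * (/ t ^ n * / (t - z))
        - / (2 * PI) * (/ tau * (De t * t ^ n * Hout s3 N t)) * (/ t ^ n * / (t - z)))%C).
    - rewrite contour_minus, q_outside_part.
      + ring.
      + lra.
      + lra.
      + exact Hz.
      + lra.
      + now apply circle_cont_mult.
      + now apply circle_cont_mult.
    - lra.
    - intros t Ht. rewrite (q_outside s3) by lra. ring. }
  rewrite E in Hq. unfold pcoef.
  assert (Hc := two_pi_i_neq_0).
  replace (q N z) with (/ (2 * PI * Ci) * (2 * PI * Ci * q N z))%C.
  - rewrite <- Hq.
    replace (csum (fun l => / (2 * PI * Ci) * contour_circle s (fun t => q N t * / t ^ S l)
                            * z ^ l)%C m)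
      with (/ (2 * PI * Ci) * csum (fun l => contour_circle s (fun t => q N t * / t ^ S l)
                            * z ^ l) m)%C.
    + ring.
    + rewrite Cmult_comm, csum_mult_r. apply csum_ext. intros; ring.
  - rewrite Cmult_assoc, Cinv_l by exact Hc. ring.
Qed.

(** [D] turns the decay of the iterates into a bound for [g (S N)] on [|t| = s], and [L] bounds the
    other factors of the remainder there. Neither involves [N]. *)
Lemma q_error (s : R) (m : nat) :
  1 < s < / r -> n = S m ->
  exists A, 0 <= A /\ forall N z, Cmod z = 1 ->
    Cmod (q N z - csum (fun l => pcoef s N l * z ^ l) m)%C <= A * theta ^ (2 * N).
Proof.
  intros Hs Hnm. pose proof inv_r_gt_1. pose proof PI_RGT_0.
  pose proof Lambda_pos. pose proof theta_pos.
  assert (CI : circle_cont (fun t => / Di t)%C s)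
    by (intros t Ht; apply cdiff_ccont, HI; lra).
  destruct (circle_bounded _ s ltac:(lra) CI) as (M & HM0 & HM).
  assert (0 < tau ^ 2) by now apply pow_lt.
  set (B := tau ^ 2 / r * theta).
  assert (HB : 0 <= B) by (apply Rmult_le_pos; [apply Rle_mult_inv_pos|]; lra).
  set (D := r * Lambda * r ^ n * B / (tau ^ 2 * (s - r))).
  assert (HD : 0 <= D).
  { assert (0 < r ^ n) by (apply pow_lt; lra).
    apply Rle_mult_inv_pos; [repeat (apply Rmult_le_pos; try lra) | apply Rmult_lt_0_compat; lra]. }
  set (L := / (2 * PI) * (tau * M) * (/ s ^ n * / (s - 1))).
  assert (Hsn : 0 < / s ^ n) by (apply Rinv_0_lt_compat, pow_lt; lra).
  assert (Hs1 : 0 < / (s - 1)) by (apply Rinv_0_lt_compat; lra).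
  assert (Hpi : 0 < / (2 * PI)) by (apply Rinv_0_lt_compat; lra).
  assert (HL : 0 <= L).
  { unfold L. repeat apply Rmult_le_pos; lra. }
  exists (/ (2 * PI) * (2 * PI * (s * (L * D)))). split.
  { repeat (apply Rmult_le_pos; try lra). }
  intros N z Hz. rewrite (q_expansion s N m z Hs Hnm Hz).
  rewrite !Cmod_mult, Cmod_pow, Hz, pow1, Cmod_inv, Cmod_two_pi_i, Rmult_1_r
    by apply two_pi_i_neq_0.
  rewrite !Rmult_assoc. apply Rmult_le_compat_l; [lra|].
  rewrite <- !Rmult_assoc.
  replace (2 * PI * s * L * D * theta ^ (2 * N)) with (2 * PI * (s * (L * (D * theta ^ (2 * N))))) by ring.
  apply Cmod_contour_le; [lra| |].
  - intros t Ht. apply ccont_mult.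
    + apply ccont_mult; [apply ccont_const|]. apply ccont_mult.
      * apply ccont_mult; [apply ccont_const | now apply CI].
      * apply cdiff_ccont, cdiff_g_h; lra.
    + apply ccont_mult; [|apply circle_cont_kernel with (s := s); trivial; lra].
      apply ccont_inv; [apply ccont_pow, ccont_id|]. apply Cpow_nz, Cmod_gt_0; lra.
  - intros t Ht.
    assert (Hg : Cmod (g (S N) t) <= D * theta ^ (2 * N)).
    { eapply Rle_trans; [apply (Cmod_g_le N t (s - r) (B * theta ^ (2 * N)))|].
      - intros y Hy. unfold B. apply Cmod_h_le; [|exact Hy]. apply Cmod_g_le_theta.
      - rewrite Ht, Rabs_left; lra.
      - right. unfold D. field. repeat split; lra. }
    rewrite !Cmod_mult.
    rewrite (Cmod_inv (t ^ n)%C) by (apply Cpow_nz, Cmod_gt_0; lra).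
    rewrite (Cmod_inv (t - z)%C) by (apply Cminus_neq_0_Cmod; lra).
    rewrite Cmod_pow, Ht.
    replace (Cmod (/ (2 * PI))) with (/ (2 * PI)).
    2:{ rewrite Cmod_inv, Cmod_mult, !Cmod_R, !Rabs_pos_eq; try lra.
        apply Cmult_neq_0; apply RtoC_neq_0; lra. }
    rewrite (Cmod_R tau), (Rabs_pos_eq tau) by lra.
    assert (Hk : / Cmod (t - z) <= / (s - 1)).
    { apply Rinv_le_contravar; [lra|]. pose proof (Cmod_minus_ge t z). lra. }
    specialize (HM t Ht).
    pose proof (Cmod_ge_0 (g (S N) t)) as P1. pose proof (Cmod_ge_0 (/ Di t)%C) as P2.
    assert (P3 : 0 < / Cmod (t - z)).
    { apply Rinv_0_lt_compat. apply Cmod_gt_0, Cminus_neq_0_Cmod. lra. }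
    set (X := D * theta ^ (2 * N)) in *.
    replace (L * X) with (/ (2 * PI) * (tau * M * X) * (/ s ^ n * / (s - 1))) by (unfold L; ring).
    apply Rmult_le_compat.
    + repeat apply Rmult_le_pos; lra.
    + apply Rmult_le_pos; lra.
    + apply Rmult_le_compat_l; [lra|]. apply Rmult_le_compat; try lra.
      * apply Rmult_le_pos; lra.
      * apply Rmult_le_compat_l; lra.
    + apply Rmult_le_compat_l; lra.
Qed.

(** * Moments of the approximate kernel against the weight *)

Variable W : C -> C.
Hypothesis HJ : forall z, Cmod z = 1 -> (/ Di z * De z * W z)%C = RtoC 1.

Lemma contour_power (j : nat) :
  contour_circle 1 (fun t => / t ^ S j)%C
  = ((2 * PI * Ci) * RtoC (if Nat.eqb j 0 then 1 else 0))%C.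
Proof.
  destruct j as [|j].
  - rewrite (contour_ext _ Cinv); [|lra|intros t _; simpl; now rewrite Cmult_1_r].
    rewrite contour_Cinv by lra. simpl. ring.
  - simpl Nat.eqb. rewrite Cmult_0_r. apply cauchy_exterior; [lra| |].
    + intros z Hz. apply cdiff_inv; [apply (cdiff_pow (fun t => t)), cdiff_id|].
      apply Cpow_nz, Cmod_gt_0; lra.
    + apply (vanishes_ext (fun t => / t * / t ^ j)%C _ 1).
      * intros t Ht. assert (t <> RtoC 0) by (apply Cmod_gt_0; lra).
        simpl. field. split; [now apply Cpow_nz | assumption].
      * apply vanishes_mult; [apply vanishes_Cinv|]. exists 1, 1. intros t Ht.
        rewrite Cmod_inv by (apply Cpow_nz, Cmod_gt_0; lra).
        rewrite Cmod_pow, <- Rinv_1.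
        apply Rinv_le_contravar; [lra | now apply pow_R1_Rle].
Qed.

(** [G_{N+1}] tends to 1 and [De] to [tau]; near infinity [|De| >= tau / 2] bounds the
    reciprocal. *)
Lemma vanishes_G_div_De (N : nat) : vanishes_infty (fun t => G (S N) t / De t - / tau)%C.
Proof.
  assert (Ht : RtoC tau <> RtoC 0) by (apply RtoC_neq_0; lra).
  assert (HB : bounded_infty (fun t => / De t)%C).
  { destruct (HEinf (tau / 2) ltac:(lra)) as [R0 H0].
    exists (2 / tau), (Rmax R0 1). intros t Ht1.
    specialize (H0 t (Rle_trans _ _ _ (Rmax_l _ _) Ht1)).
    assert (Ht2 := Rle_trans _ _ _ (Rmax_r _ _) Ht1).
    rewrite Cmod_inv by now apply HE0.
    rewrite Cmod_minus_sym in H0. pose proof (Cmod_minus_ge tau (tau - De t)) as Q.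
    replace (tau - (tau - De t))%C with (De t) in Q by ring.
    rewrite Cmod_R, Rabs_pos_eq in Q by lra.
    replace (2 / tau) with (/ (tau / 2)) by (field; lra). apply Rinv_le_contravar; lra. }
  apply (vanishes_ext (fun t => (G (S N) t - 1) * / De t
                                + (De t - tau) * / De t * - / tau)%C _ 1).
  - intros t Ht1. assert (De t <> RtoC 0) by now apply HE0. field. now split.
  - apply vanishes_plus.
    + apply vanishes_mult; [apply vanishes_G | exact HB].
    + apply vanishes_mult; [apply vanishes_mult; [exact HEinf | exact HB]|].
      exists (Cmod (- / tau)), 0. intros; lra.
Qed.

(** Since [w = 1 / (I E)] on the circle, [q w] separates into a multiple of [G / E], holomorphic
    outside, and a multiple of [z^n H / I], holomorphic inside. The moment comes entirely from the
    value of [tau G / E] at infinity, which is 1. *)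
Lemma q_moments (N m j : nat) : n = S m -> (j <= m)%nat ->
  arclength_unit_circle (fun z => q N z * W z * Cconj z ^ j)%C
  = RtoC (if Nat.eqb j 0 then 1 else 0).
Proof.
  intros Hnm Hj. pose proof inv_r_gt_1. pose proof PI_RGT_0.
  assert (Ht : RtoC tau <> RtoC 0) by (apply RtoC_neq_0; lra).
  assert (Hpi : RtoC PI <> RtoC 0) by (apply RtoC_neq_0; lra).
  rewrite arclength_contour.
  (* Subtracting the limit [/ tau] gives [cauchy_exterior] the decay it needs even for [j = 0]; the
     subtracted part is integrated by [contour_power]. *)
  set (f1 := fun t => ((G (S N) t / De t - / tau) * / t ^ S j)%C).
  (* The exponent is [n - j - 1], one power going to [dz / (i z)]. That it is nonnegative is where
     [j < n] enters. *)
  set (f2 := fun t => (H N t * / (/ Di t) * t ^ (m - j))%C).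
  set (c1 := (/ (2 * PI * Ci) * tau)%C). set (c2 := (- (/ (2 * PI * Ci) * / tau))%C).
  assert (D1 : forall z, 1 <= Cmod z -> cdiff f1 z).
  { intros z Hz. apply cdiff_mult.
    - apply cdiff_minus; [|apply cdiff_const].
      apply cdiff_div; [apply cdiff_G; lra | apply HE; lra | now apply HE0].
    - apply cdiff_inv; [apply (cdiff_pow (fun t => t)), cdiff_id|].
      apply Cpow_nz, Cmod_gt_0; lra. }
  assert (D2 : forall z, Cmod z <= 1 -> cdiff f2 z).
  { intros z Hz. apply cdiff_mult; [|apply cdiff_pow, cdiff_id].
    apply cdiff_mult; [apply cdiff_H; lra|]. apply cdiff_inv; [apply HI; lra | now apply HI0]. }
  assert (Z1 : contour_circle 1 f1 = RtoC 0).
  { apply cauchy_exterior; [lra | exact D1 |].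
    apply (vanishes_ext (fun t => (G (S N) t / De t - / tau) * / t ^ j)%C _ 1).
    - intros t Ht1. assert (t <> RtoC 0) by (apply Cmod_gt_0; lra).
      assert (De t <> RtoC 0) by now apply HE0.
      assert ((t ^ j)%C <> RtoC 0) by now apply Cpow_nz.
      unfold f1. simpl. field. auto.
    - apply vanishes_mult; [apply vanishes_G_div_De|]. exists 1, 1. intros t Ht1.
      rewrite Cmod_inv by (apply Cpow_nz, Cmod_gt_0; lra).
      rewrite Cmod_pow, <- Rinv_1.
      apply Rinv_le_contravar; [lra | now apply pow_R1_Rle]. }
  assert (Z2 : contour_circle 1 f2 = RtoC 0) by (apply cauchy_disc; [lra | exact D2]).
  rewrite (contour_ext _ (fun t => c1 * f1 t + / (2 * PI * Ci) * / t ^ S j + c2 * f2 t)%C).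
  - assert (K1 : circle_cont f1 1) by (intros t Ht1; apply cdiff_ccont, D1; lra).
    assert (K2 : circle_cont f2 1) by (intros t Ht1; apply cdiff_ccont, D2; lra).
    assert (K3 : circle_cont (fun t => / t ^ S j)%C 1).
    { intros t Ht1. apply ccont_inv; [apply ccont_pow, ccont_id|]. apply Cpow_nz, Cmod_gt_0; lra. }
    rewrite contour_plus, contour_plus, !contour_scal, Z1, Z2, contour_power.
    + rewrite Cmult_assoc, Cinv_l by apply two_pi_i_neq_0. ring.
    + lra.
    + exact K2.
    + lra.
    + exact K3.
    + lra.
    + exact K1.
    + lra.
    + now apply circle_cont_scal.
    + now apply circle_cont_scal.
    + lra.
    + intros t Ht1. apply ccont_plus.
      * exact (circle_cont_scal c1 f1 1 K1 t Ht1).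
      * exact (circle_cont_scal _ _ 1 K3 t Ht1).
    + now apply circle_cont_scal.
  - lra.
  - intros t Ht1. assert (Ht0 : t <> RtoC 0) by (apply Cmod_gt_0; lra).
    assert (HE1 : De t <> RtoC 0) by (apply HE0; lra).
    assert (HI1 : (/ Di t)%C <> RtoC 0) by (apply HI0; lra).
    assert (Htj : (t ^ j)%C <> RtoC 0) by now apply Cpow_nz.
    assert (Ec : Cconj t = (/ t)%C).
    { replace (Cconj t) with (t * Cconj t * / t)%C by (field; exact Ht0).
      rewrite Cmult_conj_unit by exact Ht1. ring. }
    assert (EW : W t = (/ (/ Di t * De t))%C).
    { replace (W t) with (/ Di t * De t * W t * / (/ Di t * De t))%C.
      - rewrite HJ by exact Ht1. ring.
      - set (I := (/ Di t)%C) in *. field. now split. }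
    rewrite Ec, EW, Cpow_inv by exact Ht0.
    unfold q, c1, c2, f1, f2. rewrite Hnm. replace (S m) with (S j + (m - j))%nat by lia.
    rewrite Cpow_add_r. simpl.
    set (I := (/ Di t)%C) in *.
    set (T := (t ^ j)%C) in *. set (U := (t ^ (m - j))%C).
    set (X := G (S N) t). set (Y := H N t). set (V := De t) in *.
    field. repeat split; trivial; try apply Ci_neq_0; apply RtoC_neq_0; lra.
Qed.

Lemma partial_sums_estimate (w : C -> R) (kappa : nat -> R) (phi : nat -> C -> C) (m : nat) :
  circle_cont W 1 -> (forall z, Cmod z = 1 -> W z = RtoC (w z)) ->
  orthonormal_polynomials w kappa phi -> n = S m ->
  exists A, 0 <= A /\ forall N,
    Cmod (RtoC (kappa m ^ 2)
          - tau ^ 2 / (2 * PI) * csum (fun k => giter F tau r n (2 * k) 0) (S N))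
    <= A * theta ^ (2 * N).
Proof.
  intros HWc HWw Hphi Hnm. pose proof inv_r_gt_1.
  set (s := (1 + / r) / 2). assert (Hs : 1 < s < / r) by (unfold s; lra).
  destruct (leading_coefficient_estimate w W HWc HWw kappa phi Hphi m) as (A & HA & KA).
  destruct (q_error s m Hs Hnm) as (A' & HA' & KA').
  exists (A * A'). split; [now apply Rmult_le_pos|]. intros N.
  change (csum (fun k => giter F tau r n (2 * k) 0) (S N)) with (G (S N) 0).
  rewrite <- (pcoef_0 s N Hs), Rmult_assoc. apply (KA (q N)).
  - intros z Hz. apply cdiff_ccont, cdiff_q. rewrite Hz. lra.
  - intros j Hj. now apply (q_moments N m).
  - intros z Hz. now apply KA'.
Qed.

End Scattering.

(** * Verification of the hypotheses and passage to the limit *)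

(** 0 is a lower bound of the set; should the infimum be infinite, [real] returns 0 and the
    inequality still holds. *)
Lemma rho_nonneg (w : C -> R) : 0 <= rho w.
Proof.
  unfold rho. match goal with |- 0 <= real (Glb_Rbar ?P) => destruct (Glb_Rbar_correct P) as [_ H] end.
  assert (H0 : Rbar_le 0 (Glb_Rbar (fun s => 0 < s < 1 /\
    exists g : C -> C, holomorphic_on (fun z => s < Cmod z) g /\
      forall z, 1 < Cmod z -> g z = szego w z))).
  { apply H. intros s [Hs _]. simpl. lra. }
  destruct (Glb_Rbar _); simpl in *; lra.
Qed.

Lemma Cinv_neq_0 (z : C) : z <> RtoC 0 -> (/ z)%C <> RtoC 0.
Proof. intros Hz E. apply Hz. now rewrite <- (Cinv_Cinv z), E, Cinv_0. Qed.

(* The sum attached to n is kappa_{n-1}^2: the printed kappa_n^2 is a misprint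
   (for w(z) = 1/|z-a|^2, 0 < a < 1, and n = 1 the right-hand side is
   (1-a^2)/(2 pi) = kappa_0^2, while kappa_1^2 = 1/(2 pi)). *)
Theorem theorem2
  (w : C -> R) (Di De : C -> C) (kappa : nat -> R) (phi : nat -> C -> C)
  (r Lambda : R)
  (Hw : analytic_weight w)
  (HD : szego_continuations w Di De)
  (Hphi : orthonormal_polynomials w kappa phi)
  (Hr : rho w < r < 1)
  (HLambda : is_max_modulus (scatF Di De) r Lambda)
  (n : nat) (Hn : (1 <= n)%nat)
  (Hcond : Lambda * r ^ n < 1 / r - r) :
  exists S : C,
    is_series (V := C_NormedModule)
      (fun k => giter (scatF Di De) (tau w) r n (2 * k) (RtoC 0)) S /\
    RtoC (kappa (n - 1)%nat ^ 2) = (RtoC (tau w ^ 2 / (2 * PI)) * S)%C.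
Proof.
  pose proof PI_RGT_0. pose proof (rho_nonneg w) as Hrho0.
  assert (Hrho : 0 <= rho w < 1) by lra.
  destruct Hw as [Hwpos (U & W & _ & HU & HWd & _ & HWw)].
  assert (HWc : circle_cont W 1).
  { intros z Hz. apply cdiff_ccont, cdiff_of_ex_derive, HWd. now apply HU. }
  assert (Htau : 0 < tau w) by apply exp_pos.
  assert (HI := cdiff_inv_Di w Di De HD). assert (HE := cdiff_De w Di De HD).
  assert (HJ := jump_relation w W HWc Hwpos HWw Di De HD Hrho).
  assert (Hr0 : 0 < r) by lra.
  assert (Hir : 1 < / r) by (rewrite <- Rinv_1; apply Rinv_lt_contravar; lra).
  (* Inside, an exponential does not vanish; on the circle itself the jump relation forbids a
     zero. *)
  assert (HI0 : forall z, Cmod z <= 1 -> (/ Di z)%C <> RtoC 0).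
  { intros z Hz. destruct (Rle_lt_or_eq_dec _ _ Hz) as [H1|H1].
    - apply Cinv_neq_0. destruct HD as [HDi _]. rewrite HDi by exact H1. apply szego_neq_0.
    - intros E. specialize (HJ z H1). rewrite E in HJ.
      apply (f_equal fst) in HJ. simpl in HJ. lra. }
  assert (HE0 : forall z, 1 <= Cmod z -> De z <> RtoC 0).
  { intros z Hz. destruct (Rle_lt_or_eq_dec _ _ Hz) as [H1|H1].
    - destruct HD as [_ [HDe _]]. rewrite HDe by exact H1. apply szego_neq_0.
    - intros E. specialize (HJ z (eq_sym H1)). rewrite E in HJ.
      apply (f_equal fst) in HJ. simpl in HJ. lra. }
  assert (Hconj : forall z, 1 < Cmod z -> Cmod (/ Cconj z) = / Cmod z).
  { intros z Hz. rewrite Cmod_inv, Cmod_conj; [reflexivity|].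
    apply Cconj_neq_0, Cmod_gt_0. lra. }
  (* By reflection the behaviour of [De] at infinity is that of [/ Di] at 0, whose value there is
     the real number [tau]. *)
  assert (HEinf : vanishes_infty (fun z => De z - tau w)%C).
  { intros eps He.
    assert (C0 : ccont (T := C_UniformSpace) (fun z => / Di z)%C (RtoC 0))
      by (apply cdiff_ccont, HI; rewrite Cmod_0; lra).
    rewrite ccont_eps in C0. destruct (C0 eps He) as (d & Hd & K).
    assert (0 < / d) by now apply Rinv_0_lt_compat.
    exists (2 + / d). intros z Hz.
    rewrite (De_reflect w W HWc Hwpos HWw Di De HD) by lra.
    replace (RtoC (tau w)) with (Cconj (tau w))
      by (unfold Cconj, RtoC; simpl; f_equal; ring).
    rewrite <- (inv_Di_0 w W HWc Hwpos HWw Di De HD), <- Cminus_conj, Cmod_conj.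
    left. apply K. replace (/ Cconj z - 0)%C with (/ Cconj z)%C by ring.
    rewrite Hconj by lra. rewrite <- (Rinv_inv d). apply Rinv_lt_contravar; [|lra].
    apply Rmult_lt_0_compat; lra. }
  (* The mirror image of [|z| = 1/r] is [|z| = r], and [1 / F(z)] is the conjugate of [F] there; so
     [Lambda] bounds both kernels. *)
  assert (HFe : forall z, Cmod z = / r -> Cmod (/ scatF Di De z) <= Lambda).
  { intros z Hz. assert (Hu : Cmod (/ Cconj z) = r) by (rewrite Hconj, Hz, Rinv_inv; lra).
    replace (/ scatF Di De z)%C with (Cconj (scatF Di De (/ Cconj z))).
    - rewrite Cmod_conj. now apply HLambda.
    - unfold scatF. rewrite Cinv_Cmult, Cmult_conj, Cmult_comm.
      rewrite (inv_Di_reflect w W HWc Hwpos HWw Di De HD Hrho z).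
      + f_equal. rewrite (De_reflect w W HWc Hwpos HWw Di De HD) by lra.
        rewrite <- (Cinv_conj (/ Di (/ Cconj z))%C) by (apply HI0; lra). now rewrite Cinv_Cinv.
      + lra.
      + rewrite Hz. apply Rlt_div_l; lra. }
  destruct n as [|m]; [lia|]. replace (S m - 1)%nat with m by lia.
  destruct (partial_sums_estimate Di De (tau w) r Lambda (S m) (conj Hr0 (proj2 Hr)) Htau)
    with (W := W) (w := w) (kappa := kappa) (phi := phi) (m := m) as (A & HA & K); trivial.
  - intros z Hz. apply HI. apply Rle_lt_trans with (rho w * / r).
    + apply Rmult_le_compat_l; lra.
    + apply Rlt_div_l; lra.
  - intros z Hz. apply HE; lra.
  - now apply (inv_Di_0 w W HWc Hwpos HWw Di De HD).
  - apply HLambda.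
  - intros z Hz. rewrite HWw by exact Hz. now apply HJ.
  - cbv zeta in K. set (theta := Lambda * r ^ S m / (/ r - r)) in *.
    assert (Hth : Rabs (theta ^ 2) < 1).
    { assert (HL : 0 <= Lambda)
        by (destruct HLambda as [_ [z0 [_ E]]]; rewrite <- E; apply Cmod_ge_0).
      assert (T1 : 0 <= theta).
      { apply Rle_mult_inv_pos; [|lra]. apply Rmult_le_pos; [exact HL | apply pow_le; lra]. }
      assert (T2 : theta < 1) by (apply Rlt_div_l; lra).
      rewrite Rabs_pos_eq by (apply pow2_ge_0). nra. }
    set (c := tau w ^ 2 / (2 * PI)) in *.
    assert (Hc : 0 < c) by (apply Rdiv_lt_0_compat; [now apply pow_lt | lra]).
    assert (Hc0 : RtoC c <> RtoC 0) by (apply RtoC_neq_0; lra).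
    set (s := csum (fun k => giter (scatF Di De) (tau w) r (S m) (2 * k) 0)) in *.
    exists (/ c * RtoC (kappa m ^ 2))%C. split; [|field; exact Hc0].
    intros P [eps HP].
    (* The tolerance is scaled by [c], because the estimate concerns [c] times the partial sums, and
       divided by [A + 1], as [A] may be 0. *)
    destruct (pow_lt_1_zero _ Hth (c * eps / (A + 1))) as [N0 HN0].
    { apply Rdiv_lt_0_compat; [apply Rmult_lt_0_compat; [lra | apply cond_pos] | lra]. }
    (* The estimate is about partial sums up to the index [S N], so the threshold is shifted by one
       and index 0 never occurs. *)
    exists (S N0). intros [|N] HN; [lia|]. apply HP. apply ball_of_Cmod.
    change (Cmod (s (S N) - / c * RtoC (kappa m ^ 2)) < eps).
    specialize (HN0 N ltac:(lia)). specialize (K N).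
    rewrite <- pow_mult, Rabs_pos_eq in HN0 by (rewrite pow_mult; apply pow_le, pow2_ge_0).
    replace (tau w ^ 2 / (2 * PI))%C with (RtoC c) in K.
    2:{ unfold c. rewrite RtoC_div, RtoC_pow, RtoC_mult by lra. reflexivity. }
    replace (s (S N) - / c * RtoC (kappa m ^ 2))%C
      with (- (/ c * (RtoC (kappa m ^ 2) - c * s (S N))))%C by (field; exact Hc0).
    rewrite Cmod_opp, Cmod_mult, Cmod_inv, Cmod_R, Rabs_pos_eq by (trivial; lra).
    apply Rlt_div_r in HN0; [|lra].
    set (X := theta ^ (2 * N)) in *.
    assert (HX : 0 <= X) by (unfold X; rewrite pow_mult; apply pow_le, pow2_ge_0).
    rewrite Rmult_comm. apply Rlt_div_l; [exact Hc|].
    eapply Rle_lt_trans; [exact K|]. lra.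
Qed.
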